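(* Let $R$ be an indecomposable root system and let $C$ be an indecomposable $\pi$-system in $R$ whose Dynkin diagram is a subdiagram of the Dynkin diagram of $R$. Then $C$ can be extended to a basis of $R$ (i.e., there is a basis $B$ of $R$ with $C \subset B$), unless we are in one of the following two exceptional cases, in which $C$ cannot be extended to a basis of $R$: 1. $R$ is of type $B_n$ with $n \geq 4$, $C = \{r_1, r_2, r_3\}$ is of type $A_3$, with simply laced Dynkin diagram the path $r_1 - r_2 - r_3$, and $(r_1 + 2 r_2 + r_3)/2$ is a root in $R$. 2. $R$ is of type $E_8$, $C = \{r_1, \dots, r_7\}$ is of type $A_7$, with simply laced Dynkin diagram the path $r_1 - r_2 - r_3 - r_4 - r_5 - r_6 - r_7$, and \[ (r_1 + 2 r_2 + 3 r_3 + 4 r_4 + 3 r_5 + 2 r_6 + r_7)/2 \] is a root in $R$.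
   Context: Root systems are finite, reduced and crystallographic, in a Euclidean space $V$ which they span. A basis of $R$ is a subset $B \subset R$ that is a vector space basis of $V$ and such that each root of $R$ is a linear combination of elements of $B$ with integral coefficients that are all nonnegative or all nonpositive. A $\pi$-system in $R$ is a linearly independent set $C \subset R$ such that if $\alpha, \beta \in C$, then $\alpha - \beta$ is not a root. A $\pi$-system is a basis of a root subsystem of $R$ and so has an associated Dynkin diagram, whose nodes are the elements of $C$; $C$ is indecomposable if it is nonempty and this diagram is connected. A subdiagram of the Dynkin diagram of $R$ is a diagram obtained by deleting some (possibly no) nodes together with their links. The nodes corresponding to short roots of $R$ (when $R$ has two root lengths) are marked, both in the diagram of $R$ and in that of $C$, and being a subdiagram requires the marking to be preserved. (For example, two orthogonal short roots do not form a subdiagram of the diagram of $B_n$.) *)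

(* Defs.v *)
From mathcomp Require Import all_boot all_order all_algebra.
From mathcomp Require Import reals.

Set Implicit Arguments.
Unset Strict Implicit.
Unset Printing Implicit Defensive.

Import Order.TTheory GRing.Theory Num.Theory.
Local Open Scope ring_scope.

(* A Dynkin diagram: [bond x y] is the number of links between the nodes [x]  *)
(* and [y] (0 if [x = y]); [arrow x y] holds if there is an arrow from [x] to *)
(* [y], that is, if [x] and [y] are linked and [x] is the longer root.        *)
Record diagram := Diagram {
  node : finType;
  bond : node -> node -> nat;
  arrow : rel node }.

(* A diagram in which some nodes are marked as short. The marking is not part *)
(* of the type of a diagram.                                                  *)
Record marked_diagram := MarkedDiagram {
  underlying :> diagram;
  mark : pred (node underlying) }.

Definition embedding (D D' : diagram) (f : node D -> node D') : Prop :=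
  [/\ injective f,
      forall x y, bond (f x) (f y) = bond x y
    & forall x y, arrow (f x) (f y) = arrow x y].

Definition isomorphism (D D' : diagram) (f : node D -> node D') : Prop :=
  bijective f /\ embedding f.

(* [D] is, up to isomorphism, obtained from [D'] by deleting nodes.           *)
Definition subdiagram (D D' : marked_diagram) : Prop :=
  exists f : node D -> node D',
    embedding f /\ forall x, mark (f x) = mark x.

Definition connected_diagram (D : diagram) : Prop :=
  forall x y : node D, connect (fun u v : node D => 0 < bond u v)%N x y.

(* In the standard diagrams below, nodes are numbered from 0.                 *)

Definition consecutive (i j : nat) : bool := (i.+1 == j) || (j.+1 == i).

Definition type_A (n : nat) : diagram :=
  @Diagram 'I_n (fun i j => nat_of_bool (consecutive i j)) (fun _ _ => false).

(* 0 - 1 - ... - (n-2) => (n-1), to be used for n >= 2.                       *)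
Definition type_B (n : nat) : diagram :=
  @Diagram 'I_n
    (fun i j => if consecutive i j then if (maxn i j).+1 == n then 2 else 1
                else 0)%N
    (fun i j => (i.+1 == j) && (j.+1 == n)).

(* The path 0 - 2 - 3 - 4 - 5 - 6 - 7 with node 1 attached to node 3.         *)
Definition E8_edges : seq (nat * nat) :=
  [:: (0, 2); (2, 3); (3, 4); (4, 5); (5, 6); (6, 7); (1, 3)]%N.

Definition type_E8 : diagram :=
  @Diagram 'I_8
    (fun i j => nat_of_bool
       (((i : nat, j : nat) \in E8_edges) || ((j : nat, i : nat) \in E8_edges)))
    (fun _ _ => false).

(* Finite subsets of [V] are represented by sequences, of which only the      *)
(* membership predicate matters.                                              *)
Section RootSystems.

Variables (K : realType) (V : vectType K) (dot : {dot V for (@idfun K)}).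
Implicit Types (R B C : seq V) (a b : V).

Definition cartan a b : K := 2 * dot a b / dot b b.

Definition root_system R : Prop :=
  [/\ <<R>>%VS = fullv,
      0 \notin R,
      forall a b, a \in R -> b \in R -> b - cartan b a *: a \in R,
      forall a b, a \in R -> b \in R -> cartan b a \is a Num.int
    & forall a (c : K), a \in R -> c *: a \in R -> c = 1 \/ c = -1].

Definition indecomposable_root_system R : Prop :=
  R != [::] /\
  ~ exists R1 R2 : seq V,
      [/\ R1 != [::], R2 != [::], R =i R1 ++ R2
        & forall a b, a \in R1 -> b \in R2 -> dot a b = 0].

Definition root_basis R B : Prop :=
  [/\ {subset B <= R},
      basis_of fullv B
    & forall a, a \in R -> exists c : V -> int,
        a = \sum_(b <- B) (c b)%:~R *: b /\
        ((forall b, b \in B -> 0 <= c b) \/ (forall b, b \in B -> c b <= 0))].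

Definition pi_system R C : Prop :=
  [/\ {subset C <= R}, free C
    & forall a b, a \in C -> b \in C -> a - b \notin R].

(* For distinct elements [x], [y] of a pi-system the product of the two       *)
(* Cartan integers is in {0, 1, 2, 3}, so that [truncn] only converts a       *)
(* natural number of [K] to [nat].                                            *)
Definition dynkin_diagram C : diagram :=
  let links (x y : seq_sub C) : nat :=
    if x == y then 0%N
    else Num.truncn (cartan (val x) (val y) * cartan (val y) (val x)) in
  @Diagram (seq_sub C) links
    (fun x y => (0 < links x y)%N &&
                (dot (val y) (val y) < dot (val x) (val x))).

(* No root is short if all the roots of [R] have the same length.             *)
Definition short_root R : pred V :=
  fun a => has (fun b => dot a a < dot b b) R.

Definition marked_dynkin_diagram R C : marked_diagram :=
  @MarkedDiagram (dynkin_diagram C) (fun x => short_root R (val x)).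

Definition subdiagram_of_root_system R C : Prop :=
  exists B, root_basis R B /\
    subdiagram (marked_dynkin_diagram R C) (marked_dynkin_diagram R B).

Definition indecomposable_pi_system C : Prop :=
  C != [::] /\ connected_diagram (dynkin_diagram C).

(* [C] is the set of the [r i], and [i |-> r i] identifies [D] with the       *)
(* Dynkin diagram of [C].                                                     *)
Definition labelled_by (D : diagram) C (r : node D -> V) : Prop :=
  exists f : node D -> node (dynkin_diagram C),
    isomorphism f /\ forall i, r i = val (f i).

Definition root_system_of_type R (D : diagram) : Prop :=
  exists B (f : node D -> node (dynkin_diagram B)),
    root_basis R B /\ isomorphism f.

Definition extends_to_basis R C : Prop :=
  exists B, root_basis R B /\ {subset C <= B}.

Definition exceptional_B R C : Prop :=
  (exists2 n : nat, (4 <= n)%N & root_system_of_type R (type_B n)) /\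
  exists r1 r2 r3 : V,
    @labelled_by (type_A 3) C (tnth [tuple r1; r2; r3]) /\
    2^-1 *: (r1 + 2 *: r2 + r3) \in R.

Definition exceptional_E8 R C : Prop :=
  root_system_of_type R type_E8 /\
  exists r1 r2 r3 r4 r5 r6 r7 : V,
    @labelled_by (type_A 7) C (tnth [tuple r1; r2; r3; r4; r5; r6; r7]) /\
    2^-1 *: (r1 + 2 *: r2 + 3 *: r3 + 4 *: r4 + 3 *: r5 + 2 *: r6 + r7) \in R.

End RootSystems.

(* Main.v *)
Require Import Defs.
From mathcomp Require Import all_boot all_order all_algebra.
From mathcomp Require Import boolp reals.
From mathcomp Require Import zify ring lra.

Set Implicit Arguments.
Unset Strict Implicit.
Unset Printing Implicit Defensive.

Import Order.TTheory GRing.Theory Num.Theory.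
Local Open Scope ring_scope.

(** Consider the roots of [R] in the span of [C]. If all of them are
    integral combinations of [C], that is, if [C] is primitive, then [C] can
    be extended by one root at a time ([primitive_extend]): a root outside
    of the span which is lowest for suitable linear forms gives again a
    primitive pi-system. A primitive pi-system which spans the space is a
    basis, as the coefficients of a root have the same sign
    ([pi_system_homogeneous]).

    If [C] is not primitive, then there is a root [a] in the span of [C]
    which is not an integral combination, and it can be chosen to have no
    acute angle with [C] ([imprimitive_root]). So [a] and the elements of
    [C] are the nodes of an extended Dynkin diagram. The linear relation
    between them has positive coefficients, the marks; normalized to be 1 at
    [a], they are not all integral. The relation gives an equation at each
    node ([node_eq]), and walking through the diagram from [a] these
    equations determine it: [C] is a fork of long roots and [a] is a short
    root at its other end ([short_end]), or [C] has type A7, A8, D8 or B4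
    ([affine_shapes]).

    Since the diagram of [C] is a subdiagram, [C] is isometric to a part of
    a basis [B] of [R] ([embedding_isometry]). So [C] does not span the
    space, as otherwise the roots would be integral combinations of [C] by a
    determinant argument ([full_rank_int_span]), and there is a root [b]
    outside of the span which is linked to exactly one node of [C] and
    orthogonal to the other ones. The scalar product of [b] with [a] is
    determined by the relation and restricts this node; then A8, D8 and B4
    are impossible, because the projection of [b] to the span of [C] would
    be at least as long as [b].

    In the case A7, the roots [a], [b] and six elements of [C] generate an
    even unimodular lattice of rank 8, which must contain all roots
    ([unimodular_roots]). So [B] consists of the image of [C] and one more
    root; the lattice being unimodular, the type is E8
    ([unimodular_type_E8]). In the case of the fork, [B] contains a short
    root, since [a] is short, and then the long roots of [B] cannot form a
    fork ([no_short_fork]); so [C] has type A3. A basis with three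
    consecutive long roots and a short root has type B
    ([type_B_recognition]). In both cases [- a] is the root in the theorem.

    Conversely, a root with the coefficient 1/2 at an element of [C] is not
    an integral combination of any basis that contains [C]. *)

(** * Scalar products and coordinates *)

Section Geometry.
Variables (K : realType) (V : vectType K) (dot : {dot V for (@idfun K)}).
Implicit Types (S : seq V) (u v w x y z : V).

Lemma dotC u v : dot u v = dot v u.
Proof. by rewrite hermC /= expr0 mul1r. Qed.

Lemma dotDr u v w : dot u (v + w) = dot u v + dot u w.
Proof. exact: linearD. Qed.

Lemma dotDl u v w : dot (v + w) u = dot v u + dot w u.
Proof. by rewrite dotC dotDr !(dotC u). Qed.

Lemma dotZr k u v : dot u (k *: v) = k * dot u v.
Proof. exact: linearZ. Qed.

Lemma dotZl k u v : dot (k *: v) u = k * dot v u.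
Proof. by rewrite dotC dotZr dotC. Qed.

Lemma dotNr u v : dot u (- v) = - dot u v.
Proof. exact: linearN. Qed.

Lemma dotNl u v : dot (- v) u = - dot v u.
Proof. by rewrite dotC dotNr dotC. Qed.

Lemma dot0r u : dot u 0 = 0.
Proof. exact: linear0. Qed.

Lemma dot0l u : dot 0 u = 0.
Proof. by rewrite dotC dot0r. Qed.

Definition dotE := (dotDl, dotDr, dotNl, dotNr, dotZl, dotZr, dot0l, dot0r).

Lemma dot_sumr (I : Type) (r : seq I) (P : pred I) (F : I -> V) u :
  dot u (\sum_(i <- r | P i) F i) = \sum_(i <- r | P i) dot u (F i).
Proof. exact: linear_sum. Qed.

Lemma dot_suml (I : Type) (r : seq I) (P : pred I) (F : I -> V) u :
  dot (\sum_(i <- r | P i) F i) u = \sum_(i <- r | P i) dot (F i) u.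
Proof. by rewrite dotC dot_sumr; apply: eq_bigr => i _; rewrite dotC. Qed.

Lemma dot_gt0 u : u != 0 -> 0 < dot u u.
Proof. exact: neq0_dnorm_gt0. Qed.

Lemma dot_ge0 u : 0 <= dot u u.
Proof. by have [->|/dot_gt0/ltW//] := eqVneq u 0; rewrite dot0l. Qed.

Lemma dot_le0 u : dot u u <= 0 -> u = 0.
Proof.
by move=> h; apply/eqP/negPn/negP => /dot_gt0; rewrite ltNge h.
Qed.

(** The coordinates are indexed by the elements of [S] and not by their
    positions, so that they can be compared when [S] is extended or permuted. *)
Definition crd S v s : K :=
  if insub (index s S) is Some i then coord (in_tuple S) i v else 0.

Lemma crdD S u v s : crd S (u + v) s = crd S u s + crd S v s.
Proof. by rewrite /crd; case: insubP => [i _ _|_]; rewrite ?linearD ?addr0. Qed.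

Lemma crdZ S k v s : crd S (k *: v) s = k * crd S v s.
Proof. by rewrite /crd; case: insubP => [i _ _|_]; rewrite ?linearZ ?mulr0. Qed.

Lemma crd_sum S v : free S -> v \in <<S>>%VS ->
  v = \sum_(s <- S) crd S v s *: s.
Proof.
move=> freeS vS; rewrite [LHS](@coord_span _ _ _ (in_tuple S)) //.
rewrite (big_nth 0) big_mkord /=; apply: eq_bigr => i _; congr (_ *: _).
rewrite /crd index_uniq ?free_uniq //.
by case: insubP => [j _ /= /val_inj->//|]; rewrite ltn_ord.
Qed.

Lemma crdP S (c : V -> K) s : free S -> s \in S ->
  crd S (\sum_(t <- S) c t *: t) s = c s.
Proof.
move=> freeS sS; rewrite /crd; case: insubP => [i _ /= Ei|]; last first.
  by rewrite index_mem sS.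
rewrite (big_nth 0) big_mkord (coord_sum_free (fun j : 'I_(size S) => c S`_j) i) //.
by rewrite Ei nth_index.
Qed.

Lemma crd_inj S (c d : V -> K) : free S ->
  \sum_(t <- S) c t *: t = \sum_(t <- S) d t *: t -> {in S, c =1 d}.
Proof. by move=> fS e s sS; rewrite -(crdP c fS sS) e crdP. Qed.

Lemma crd_id S s t : free S -> s \in S -> t \in S ->
  crd S s t = (s == t)%:R.
Proof.
move=> fS sS tS; rewrite -(crdP (fun t => (s == t)%:R) fS tS); congr (crd _ _ _).
rewrite (bigD1_seq s) ?free_uniq //= eqxx scale1r big1 ?addr0 //.
by move=> i; rewrite eq_sym => /negPf->; rewrite scale0r.
Qed.

Lemma free_neq_opp S s t : free S -> s \in S -> t \in S -> s != - t.
Proof.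
move=> fS sS tS; apply/eqP => e; have := crd_id fS sS sS.
rewrite {1}e -scaleN1r crdZ crd_id // eqxx mulN1r => h.
by have := ler0n K (t == s); rewrite -oppr_le0 h ler10.
Qed.

Lemma sum_in_span S (c : V -> K) : \sum_(t <- S) c t *: t \in <<S>>%VS.
Proof.
by rewrite big_seq; apply: memv_suml => t tS; rewrite memvZ ?memv_span.
Qed.

Definition height S v : K := \sum_(s <- S) crd S v s.

Lemma heightD S u v : height S (u + v) = height S u + height S v.
Proof. by rewrite -big_split; apply: eq_bigr => s _; exact: crdD. Qed.

Lemma heightZ S k v : height S (k *: v) = k * height S v.
Proof. by rewrite mulr_sumr; apply: eq_bigr => s _; exact: crdZ. Qed.

Lemma height_id S s : free S -> s \in S -> height S s = 1.
Proof.
move=> fS sS; rewrite /height (bigD1_seq s) ?free_uniq //= crd_id // eqxx.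
rewrite big_seq_cond big1 ?addr0 // => t /andP[tS nt].
by rewrite crd_id // eq_sym (negPf nt).
Qed.

(** The inverse of the Gram matrix of an obtuse basis has nonnegative entries.
    Split the vector into [p - n], where [p] collects its positive coefficients:
    both [dot (p - n) p] and, by the obtuse angles, [dot n p] are at most 0, so
    that [p = 0]. *)
Lemma obtuse_crd_le0 S (c : V -> K) : free S ->
  {in S &, forall s t, s != t -> dot s t <= 0} ->
  {in S, forall s, dot (\sum_(t <- S) c t *: t) s <= 0} ->
  {in S, forall s, c s <= 0}.
Proof.
move=> fS obt neg; set x := \sum_(t <- S) _ in neg.
pose p := \sum_(t <- S) (Num.max (c t) 0) *: t.
pose n := \sum_(t <- S) (Num.max (- c t) 0) *: t.
have xE : x = p - n.
  rewrite /p /n -sumrB; apply: eq_bigr => t _; rewrite -scalerBl; congr (_ *: _).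
  by case: (lerP (c t) 0); case: (lerP (- c t) 0) => ? ?; lra.
have xp : dot x p <= 0.
  rewrite dot_sumr big_seq; apply: sumr_le0 => s sS.
  by rewrite dotZr mulr_ge0_le0 ?neg // le_max lexx orbT.
have np : dot n p <= 0.
  rewrite dot_sumr big_seq; apply: sumr_le0 => s sS.
  rewrite dotZr dot_suml mulr_sumr big_seq; apply: sumr_le0 => t tS.
  rewrite dotZl; have [->|ts] := eqVneq t s.
    by case: (lerP (c s) 0); case: (lerP (- c s) 0) => ? ?; nra.
  by rewrite mulrA mulr_ge0_le0 ?mulr_ge0 ?le_max ?lexx ?orbT ?obt.
have p0 : p = 0 by apply: dot_le0; move: xp; rewrite xE !dotE; lra.
move=> s sS; have := @crd_inj S (fun t => Num.max (c t) 0) (fun=> 0) fS.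
rewrite -/p p0 [RHS]big1 => [/(_ erefl s sS)<-|t _]; last by rewrite scale0r.
by rewrite le_max lexx.
Qed.

Definition int_span S v := exists z : V -> int, v = \sum_(s <- S) (z s)%:~R *: s.

Lemma int_spanD S u v : int_span S u -> int_span S v -> int_span S (u + v).
Proof.
move=> [y ->] [z ->]; exists (fun s => y s + z s).
by rewrite -big_split; apply: eq_bigr => s _; rewrite rmorphD scalerDl.
Qed.

Lemma int_spanZ S (k : int) v : int_span S v -> int_span S (k%:~R *: v).
Proof.
move=> [z ->]; exists (fun s => k * z s).
by rewrite scaler_sumr; apply: eq_bigr => s _; rewrite rmorphM scalerA.
Qed.

Lemma int_spanN S v : int_span S v -> int_span S (- v).
Proof. by move/(int_spanZ (-1)); rewrite scaleN1r. Qed.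

Lemma int_span_id S s : uniq S -> s \in S -> int_span S s.
Proof.
move=> uS sS; exists (fun t => (t == s)%:R).
rewrite (bigD1_seq s) //= eqxx scale1r big1 ?addr0 // => t /negPf->.
by rewrite scale0r.
Qed.

Lemma int_span0 S : int_span S 0.
Proof. by exists (fun=> 0); rewrite big1 // => s _; rewrite scale0r. Qed.

Lemma int_span_sum S T (z : V -> int) : (forall t, t \in T -> int_span S t) ->
  int_span S (\sum_(t <- T) (z t)%:~R *: t).
Proof.
move=> h; rewrite big_seq; elim/big_ind: _ => [||t tT].
- exact: int_span0.
- exact: int_spanD.
- by apply: int_spanZ; exact: h.
Qed.

Lemma crd_int S v s : free S -> s \in S -> int_span S v ->
  crd S v s \is a Num.int.
Proof. by move=> fS sS [z ->]; rewrite (crdP (fun s => (z s)%:~R)) // rpred_int_num. Qed.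

Lemma int_span_crd S v : free S -> v \in <<S>>%VS ->
  (forall s, s \in S -> crd S v s \is a Num.int) -> int_span S v.
Proof.
move=> fS vS h; exists (fun s => Num.floor (crd S v s)).
rewrite [LHS](crd_sum fS vS) !big_seq; apply: eq_bigr => s sS.
by rewrite floorK ?h.
Qed.

Lemma cauchy_schwarz u v : u != 0 -> v \notin <[u]>%VS ->
  dot u v ^+ 2 < dot u u * dot v v.
Proof.
move=> u0 vu; pose w := v - (dot u v / dot u u) *: u.
have uu := dot_gt0 u0.
have w0 : w != 0.
  by apply: contra vu; rewrite subr_eq0 => /eqP->; rewrite memvZ ?memv_line.
have := dot_gt0 w0; rewrite /w !dotE (dotC v u) -(pmulr_lgt0 _ uu).
set a := dot u u in uu *; set b := dot u v; set c := dot v v.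
set X := (X in 0 < X -> _); have -> : X = a * c - b ^+ 2.
  by rewrite /X; field; rewrite gt_eqF.
by rewrite subr_gt0.
Qed.

End Geometry.

(** * Roots *)

Section Roots.
Variables (K : realType) (V : vectType K) (dot : {dot V for (@idfun K)}).
Variables (R : seq V) (R_root : root_system dot R).
Implicit Types (S C B : seq V) (a b c u v w x y z : V).

Lemma root_neq0 a : a \in R -> a != 0.
Proof. by case: R_root => _ R0 _ _ _ aR; apply: contraNneq R0 => <-. Qed.

Lemma root_gt0 a : a \in R -> 0 < dot a a.
Proof. by move/root_neq0/dot_gt0. Qed.

Lemma reflection_root a b : a \in R -> b \in R -> b - cartan dot b a *: a \in R.
Proof. by case: R_root => _ _ h _ _; exact: h. Qed.

Lemma cartan_id a : a \in R -> cartan dot a a = 2.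
Proof. by move/root_gt0 => h; rewrite /cartan mulfK // gt_eqF. Qed.

Lemma root_opp a : a \in R -> - a \in R.
Proof.
move=> aR; have := reflection_root aR aR; rewrite cartan_id //.
by rewrite scaler_nat mulr2n opprD addrA subrr sub0r.
Qed.

Lemma cartan_int a b : a \in R -> b \in R -> exists m : int, cartan dot a b = m%:~R.
Proof. by case: R_root => _ _ _ h _ aR bR; apply/intrP; exact: h. Qed.

Lemma cartanE a b : b \in R -> cartan dot a b * dot b b = 2 * dot a b.
Proof. by move/root_gt0 => h; rewrite /cartan divfK // gt_eqF. Qed.

Lemma root_line a b : a \in R -> b \in R -> b \in <[a]>%VS -> b = a \/ b = - a.
Proof.
move=> aR bR /vlineP[k bE]; move: bR; rewrite bE => bR.
case: R_root => _ _ _ _ /(_ _ _ aR bR)[]->; rewrite ?scale1r; first by left.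
by right; rewrite scaleN1r.
Qed.

(** By the Cauchy-Schwarz inequality the product of the two integers is less
    than 4. *)
Lemma cartan_lt0_cases a b : a \in R -> b \in R -> dot a b < 0 -> a != - b ->
  exists m n : nat, [/\ cartan dot a b = - m%:R, cartan dot b a = - n%:R
    & (m, n) \in [:: (1, 1); (1, 2); (2, 1); (1, 3); (3, 1)]%N].
Proof.
move=> aR bR ab nab.
have [m mE] := cartan_int aR bR; have [n nE] := cartan_int bR aR.
have aa := root_gt0 aR; have bb := root_gt0 bR.
have := cartanE a bR; have := cartanE b aR; rewrite mE nE (dotC _ b a) => e1 e2.
have m0 : (m%:~R : K) < 0 by rewrite -(pmulr_llt0 _ bb) e2; lra.
have n0 : (n%:~R : K) < 0 by rewrite -(pmulr_llt0 _ aa) e1; lra.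
have mn : (m * n)%:~R < 4 :> K.
  have bNa : b \notin <[a]>%VS.
    apply/negP => /(root_line aR bR)[] be; move: ab nab; rewrite be.
      by rewrite ltNge dot_ge0.
    by rewrite opprK eqxx.
  have := cauchy_schwarz dot (root_neq0 aR) bNa; rewrite rmorphM /= => cs.
  rewrite -(ltr_pM2r (mulr_gt0 aa bb)).
  have -> : m%:~R * n%:~R * (dot a a * dot b b) = 4 * dot a b ^+ 2.
    have -> : 4 * dot a b ^+ 2 = (2 * dot a b) * (2 * dot a b) by ring.
    by rewrite -{1}e1 -e2; ring.
  lra.
rewrite ltrz0 in m0; rewrite ltrz0 in n0.
have {}mn : m * n < 4 by rewrite -(ltr_int K).
have mn' : (`|m|%N, `|n|%N) \in [:: (1, 1); (1, 2); (2, 1); (1, 3); (3, 1)]%N.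
  have /andP[] : ((`|m| <= 3) && (`|n| <= 3))%N by nia.
  have : (`|m|%N * `|n|%N < 4)%N by nia.
  have : (0 < `|m|%N)%N by lia. have : (0 < `|n|%N)%N by lia.
  by case: `|m|%N => [|[|[|[|]]]] //; case: `|n|%N => [|[|[|[|]]]].
exists `|m|%N, `|n|%N; split=> //.
  by rewrite pmulrn -rmorphN /=; congr _%:~R; lia.
by rewrite pmulrn -rmorphN /=; congr _%:~R; lia.
Qed.

Lemma root_add a b : a \in R -> b \in R -> dot a b < 0 -> a != - b -> a + b \in R.
Proof.
move=> aR bR ab nab; have [m [n [mE nE mn]]] := cartan_lt0_cases aR bR ab nab.
have [n1|m1] : n = 1%N \/ m = 1%N.
- by move: mn; rewrite !inE !xpair_eqE => /or4P[|||/orP[]] /andP[/eqP? /eqP?]; tauto.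
- by have := reflection_root aR bR; rewrite nE n1 scaleN1r opprK addrC.
- by have := reflection_root bR aR; rewrite mE m1 scaleN1r opprK.
Qed.

Lemma root_sub a b : a \in R -> b \in R -> 0 < dot a b -> a != b -> a - b \in R.
Proof.
move=> aR bR ab nab; apply: root_add => //; first exact: root_opp.
  by rewrite dotNr oppr_lt0.
by rewrite opprK.
Qed.

Lemma reflection_dot a u v : a \in R ->
  dot (u - cartan dot u a *: a) (v - cartan dot v a *: a) = dot u v.
Proof.
move=> aR; have aa := root_gt0 aR; rewrite /cartan !dotE (dotC _ a v).
by field; rewrite gt_eqF.
Qed.

Lemma pi_obtuse C : pi_system R C -> {in C &, forall a b, a != b -> dot a b <= 0}.
Proof.
move=> [CR _ h] a b aC bC ab; rewrite leNgt; apply/negP => p.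
by have := root_sub (CR _ aC) (CR _ bC) p ab; apply/negP; exact: h.
Qed.

End Roots.

(** * Pi-systems and their integral span *)

Section Extension.
Variables (K : realType) (V : vectType K) (dot : {dot V for (@idfun K)}).
Variables (R : seq V) (R_root : root_system dot R).
Implicit Types (S C B : seq V) (a b c u v w x y z : V).

Lemma positive_term S (c : V -> K) : 0 < \sum_(s <- S) c s ->
  exists2 s, s \in S & 0 < c s.
Proof.
move=> pos; apply: contrapT => none; suff: \sum_(s <- S) c s <= 0 by lra.
rewrite big_seq; apply: sumr_le0 => s sS; rewrite leNgt; apply/negP => cs.
by apply: none; exists s.
Qed.

Let weight C (z : V -> int) : nat := \sum_(s <- C) `|z s|%N.

Let weight_lt C (z z' : V -> int) s : uniq C -> s \in C ->
  (`|z' s| < `|z s|)%N -> {in C, forall t, t != s -> z' t = z t} ->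
  (weight C z' < weight C z)%N.
Proof.
move=> uC sC lt e; rewrite /weight !(bigD1_seq s) //= -addSn leq_add //.
rewrite big_seq_cond [leqRHS]big_seq_cond.
by apply: leq_sum => t /andP[tC ts]; rewrite e.
Qed.

Let shift (z : V -> int) (k : int) s := fun t => z t + k * (t == s)%:R.

Let sum_shift C (z : V -> int) k s : uniq C -> s \in C ->
  \sum_(t <- C) (shift z k s t)%:~R *: t = \sum_(t <- C) (z t)%:~R *: t + k%:~R *: s.
Proof.
move=> uC sC; rewrite (bigD1_seq s) //= [in RHS](bigD1_seq s) //= /shift eqxx.
rewrite mulr1 rmorphD scalerDl addrAC; congr (_ + _ + _).
by apply: eq_bigr => t /negPf->; rewrite mulr0 addr0.
Qed.

Let shift_id (z : V -> int) k s : shift z k s s = z s + k.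
Proof. by rewrite /shift eqxx mulr1. Qed.

Let shift_ne (z : V -> int) k s t : t != s -> shift z k s t = z t.
Proof. by move=> /negPf ts; rewrite /shift ts mulr0 addr0. Qed.

(** A pi-system is a basis of the roots in its integral span. A root of least
    weight with coefficients of both signs is, up to sign, of the form [s - d],
    with [s] in the pi-system and [d] a positive root; moving some [t] with
    [dot d t > 0] from [d] to the left again gives a root, so that [d = t] by
    minimality. But [s - t] is not a root. *)
Lemma pi_system_homogeneous C (z : V -> int) : pi_system R C ->
  \sum_(s <- C) (z s)%:~R *: s \in R ->
  (forall s, s \in C -> 0 <= z s) \/ (forall s, s \in C -> z s <= 0).
Proof.
move=> piC; have [CR fC dC] := piC; have uC := free_uniq fC.
have obt := pi_obtuse R_root piC.
move: {2}(weight C z).+1 (leqnn (weight C z).+1) => n.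
elim: n z => // n IH z; rewrite ltnS => wz gR.
apply: contrapT => /not_orP[npos nneg].
have [s1 s1C z1] : exists2 s, s \in C & z s < 0.
  apply: contrapT => h; apply: npos => s sC; rewrite leNgt; apply/negP => zs.
  by apply: h; exists s.
have [s0 s0C z0] : exists2 s, s \in C & 0 < z s.
  apply: contrapT => h; apply: nneg => s sC; rewrite leNgt; apply/negP => zs.
  by apply: h; exists s.
have [s sC pos] : exists2 s, s \in C & 0 < (z s)%:~R * dot (\sum_(s <- C) (z s)%:~R *: s) s.
  apply: positive_term; have := root_gt0 R_root gR; rewrite {1}dot_sumr.
  by under eq_bigr do rewrite dotZr.
have {npos nneg} : ~ ((forall s, s \in C -> 0 <= z s) \/ (forall s, s \in C -> z s <= 0)).
  by case.
wlog zs : z wz gR s1 s1C z1 s0 s0C z0 pos / 0 < z s.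
  move=> wl; have [zs|] := ltrP 0 (z s); first exact: (wl z wz gR s1 s1C z1 s0 s0C).
  rewrite le_eqVlt => /predU1P[zs|zs]; first by move: pos; rewrite zs mul0r ltxx.
  have e : \sum_(t <- C) (- z t)%:~R *: t = - \sum_(t <- C) (z t)%:~R *: t.
    by rewrite -sumrN; apply: eq_bigr => t _; rewrite rmorphN scaleNr.
  move=> nh; apply: (wl (fun t => - z t) _ _ s0 s0C _ s1 s1C); rewrite ?oppr_lt0 ?oppr_gt0 //.
  - by rewrite /weight; under eq_bigr do rewrite abszN.
  - by rewrite e; exact: (root_opp R_root).
  - by rewrite e rmorphN dotNl mulrNN.
  - by case=> h; apply: nh; [right|left] => t /h; rewrite ?oppr_ge0 ?oppr_le0.
move=> _; set g := \sum_(s <- C) _ in gR pos.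
have gs : 0 < dot g s by rewrite pmulr_rgt0 ?ltr0z in pos.
have coefz (y : V -> int) t : t \in C -> crd C (\sum_(s <- C) (y s)%:~R *: s) t = (y t)%:~R.
  by move=> tC; rewrite (crdP (fun s => (y s)%:~R)).
have g_s : g != s.
  apply: contraTneq z1 => gE; rewrite -(ltr_int K) -coefz // -/g gE crd_id //.
  by rewrite -leNgt ler0n.
have gsR := root_sub R_root gR (CR _ sC) gs g_s.
have zs1 : z s = 1 /\ {in C, forall t, t != s -> z t <= 0}.
  case: (IH (shift z (-1) s)).
  - apply: leq_trans wz; apply: (weight_lt (s := s)) => //.
      by rewrite shift_id; move: zs; clear; lia.
    by move=> t tC; exact: shift_ne.
  - by rewrite sum_shift // scaleN1r.
  - move=> /(_ s1 s1C); have [s1s|ns] := eqVneq s1 s.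
      by move: z1; rewrite s1s ltNge (ltW zs).
    by rewrite shift_ne // leNgt z1.
  - move=> h; split; first by have := h s sC; rewrite shift_id; move: zs; clear; lia.
    by move=> t tC ts; have := h t tC; rewrite shift_ne.
case: zs1 => zs1 zt.
have dR : s - g \in R by rewrite -opprB; exact: (root_opp R_root).
have [t tC pos'] : exists2 t, t \in C & 0 < (- shift z (-1) s t)%:~R * dot (s - g) t.
  apply: positive_term; have := root_gt0 R_root dR.
  have {2}-> : s - g = \sum_(t <- C) (- shift z (-1) s t)%:~R *: t.
    rewrite -opprB -/g -[- s]scaleN1r -[-1 in RHS]/(-1)%R.
    under eq_bigr do rewrite rmorphN scaleNr.
    by rewrite sumrN sum_shift.
  by rewrite dot_sumr; under eq_bigr do rewrite dotZr.
have [ts|ts] := eqVneq t s.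
  by move: pos'; rewrite ts shift_id zs1 subrr oppr0 mul0r ltxx.
have zt0 := zt t tC ts.
have dt : 0 < dot (s - g) t /\ z t < 0.
  move: pos'; rewrite shift_ne // => pos'.
  have : 0 <= (- z t)%:~R :> K by rewrite ler0z oppr_ge0.
  rewrite le_eqVlt => /predU1P[e|e]; first by move: pos'; rewrite -e mul0r ltxx.
  by move: (e); rewrite ltr0z oppr_gt0; rewrite pmulr_rgt0 in pos'.
case: dt => dt zt1.
have gt : dot g t < 0.
  have st : dot s t <= 0 by apply: obt => //; rewrite eq_sym.
  by move: dt; rewrite dotDl dotNl; lra.
have gNt : g != - t.
  apply/eqP => gE; have := coefz z s sC; rewrite -/g gE zs1 -scaleN1r crdZ crd_id //.
  by rewrite (negPf ts) mulr0 => /eqP; rewrite eq_sym oner_eq0.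
have gtR := root_add R_root gR (CR _ tC) gt gNt.
case: (IH (shift z 1 t)).
- apply: leq_trans wz; apply: (weight_lt (s := t)) => //.
    by rewrite shift_id; move: zt1; clear; lia.
  by move=> u uC'; exact: shift_ne.
- by rewrite sum_shift // scale1r.
- move=> h; have gE : g = s - t.
    rewrite -[s]scale1r -[RHS]addrC -[- t]scaleN1r.
    have -> : g = \sum_(u <- C) (shift (shift (fun=> 0) 1 s) (-1) t u)%:~R *: u.
      rewrite /g !big_seq; apply: eq_bigr => u uC'; congr (_%:~R *: _).
      have [->|ut] := eqVneq u t.
        have := h t tC; rewrite !shift_id shift_ne //; move: zt1; clear; lia.
      rewrite shift_ne //; have [->|us] := eqVneq u s; first by rewrite shift_id zs1.
      have := h u uC'; have := zt u uC' us; rewrite !shift_ne //; clear; lia.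
    by rewrite !sum_shift // big1 ?add0r 1?addrC // => u _; rewrite scale0r.
  by move: gR; rewrite gE; apply/negP; exact: dC.
- by move=> /(_ s sC); rewrite shift_ne ?zs1 // eq_sym.
Qed.

End Extension.

(** * Extension to a basis *)

Section Bases.
Variables (K : realType) (V : vectType K) (dot : {dot V for (@idfun K)}).
Variables (R : seq V) (R_root : root_system dot R).
Implicit Types (S C B : seq V) (a b c u v w x y z : V).

Lemma seq_argmin (A : seq V) (P : V -> Prop) (f : V -> K) :
  (exists2 x, x \in A & P x) ->
  exists x, [/\ x \in A, P x & forall y, y \in A -> P y -> f x <= f y].
Proof.
elim: A => [|a A IH] [x]; first by rewrite in_nil.
move=> xaA Px; have [[y yA Py]|none] := pselect (exists2 y, y \in A & P y); last first.
  move: xaA; rewrite inE => /predU1P[xa|xA]; last by case: none; exists x.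
  subst x; exists a; split; rewrite ?mem_head // => y.
  by rewrite inE => /predU1P[->//|yA Py]; case: none; exists y.
have [{xaA Px}x [xA Px xmin]] := IH (ex_intro2 _ _ y yA Py).
have [[Pa ax]|h] := pselect (P a /\ f a <= f x).
  exists a; split; rewrite ?mem_head // => z; rewrite inE => /predU1P[->//|zA Pz].
  by rewrite (le_trans ax) // xmin.
exists x; split; rewrite ?inE ?xA ?orbT // => z; rewrite inE => /predU1P[->|]; last exact: xmin.
by move=> Pa; case: (lerP (f a) (f x)) => [ax|/ltW//]; case: h.
Qed.

Lemma seq_arglexmin (A : seq V) (P : V -> Prop) (f g : V -> K) :
  (exists2 x, x \in A & P x) ->
  exists x, [/\ x \in A, P x
    & forall y, y \in A -> P y -> f x <= f y /\ (f y = f x -> g x <= g y)].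
Proof.
move=> /(@seq_argmin _ _ f)[x0 [x0A Px0 min0]].
have [|x [xA [Px xx0] xmin]] := @seq_argmin A (fun x => P x /\ f x = f x0) g.
  by exists x0.
exists x; split=> // y yA Py; rewrite xx0; split; first exact: min0.
by move=> yx; exact: xmin.
Qed.

(** A pi-system that is a basis of the parabolic subsystem it spans. *)
Definition primitive C := pi_system R C /\
  forall a, a \in R -> a \in <<C>>%VS -> int_span C a.

Lemma root_outside (U : {vspace V}) : U != fullv -> exists2 a, a \in R & a \notin U.
Proof.
move=> UT; apply: contrapT => none; case/negP: UT.
rewrite eqEsubv subvf /=; case: R_root => <- _ _ _ _; apply/span_subvP => a aR; apply/negPn/negP => aU.
by apply: none; exists a.
Qed.

(** The new element is a root outside of the span which is lowest for a
    linear form vanishing on [C], and then for the height. Any other root in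
    the new span makes an acute angle with an element of the new system,
    whose subtraction lowers the root. *)
Lemma primitive_extend C : primitive C -> <<C>>%VS != fullv ->
  exists b, primitive (b :: C).
Proof.
move=> [piC primC] /root_outside[g gR gC]; have [CR fC dC] := piC.
pose X := g :: C; pose G v := crd X v g; pose h v := height X v.
have fX : free X by rewrite free_cons gC.
have GD u v : G (u + v) = G u + G v by exact: crdD.
have GZ k v : G (k *: v) = k * G v by exact: crdZ.
have GN v : G (- v) = - G v by rewrite -scaleN1r GZ mulN1r.
have hD u v : h (u + v) = h u + h v by exact: heightD.
have hN v : h (- v) = - h v by rewrite -scaleN1r /h heightZ mulN1r.
have gX : g \in X by exact: mem_head.
have CX r : r \in C -> r \in X by rewrite inE orbC => ->.
have g_r r : r \in C -> r != g.
  by move=> rC; apply: contraNneq gC => <-; exact: memv_span.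
have Gr r : r \in C -> G r = 0.
  by move=> rC; rewrite /G (crd_id fX (CX _ rC) gX) (negPf (g_r r rC)).
have hr r : r \in C -> h r = 1 by move=> rC; rewrite /h height_id ?CX.
have GC v : v \in <<C>>%VS -> G v = 0.
  move/(crd_sum fC)->; rewrite /G big_seq.
  apply: (big_ind (fun v => G v = 0)) => [|u w Gu Gw|r rC].
  - by rewrite -(scale0r 0) GZ mul0r.
  - by rewrite GD Gu Gw addr0.
  - by rewrite GZ Gr // mulr0.
pose A v := v \in <<X>>%VS /\ 0 < G v.
have [|b [bR [bX Gb] bmin]] := @seq_arglexmin R A G h.
  by exists g => //; split; rewrite ?memv_span // /G crd_id // eqxx ltr01.
have bC : b \notin <<C>>%VS by apply: contraTN Gb => /GC->; rewrite ltxx.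
have CXs v : v \in <<C>>%VS -> v \in <<X>>%VS.
  by apply: subvP; apply: sub_span => r; exact: CX.
have b_r r : r \in C -> b - r \notin R.
  move=> rC; apply/negP => brR.
  have Gbr : G (b - r) = G b by rewrite GD GN (Gr _ rC) subr0.
  have [|_] := bmin _ brR.
    by split; [apply: rpredB => //; exact/CXs/memv_span | rewrite Gbr].
  by move=> /(_ Gbr); rewrite hD hN (hr _ rC); lra.
have piB : pi_system R (b :: C).
  split; first by move=> r; rewrite inE => /predU1P[->//|]; exact: CR.
    by rewrite free_cons bC.
  have R0 : 0 \notin R by case: R_root.
  move=> r s; rewrite !inE => /predU1P[->|rC] /predU1P[->|sC].
  - by rewrite subrr.
  - exact: b_r.
  - by apply: contra (b_r r rC) => /(root_opp R_root); rewrite opprB.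
  - exact: dC.
have [BR fB dB] := piB.
exists b; split=> //.
have BX v : v \in <<b :: C>>%VS -> v \in <<X>>%VS.
  apply: subvP; apply/span_subvP => r; rewrite inE => /predU1P[->//|rC].
  by rewrite CXs ?memv_span.
have intC v : int_span C v -> int_span (b :: C) v.
  move=> [z ->]; apply: int_span_sum => r rC; apply: int_span_id.
    exact: free_uniq.
  by rewrite inE rC orbT.
have crdb v : v \in <<b :: C>>%VS -> G v = crd (b :: C) v b * G b.
  move=> vB; rewrite {1}(crd_sum fB vB) big_cons GD GZ.
  by rewrite [G (\sum_(_ <- _) _)]GC ?addr0 // sum_in_span.
have G0 v : v \in <<b :: C>>%VS -> G v = 0 -> v \in <<C>>%VS.
  move=> vB Gv; rewrite (crd_sum fB vB) big_cons.
  have /eqP : crd (b :: C) v b * G b = 0 by rewrite -crdb.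
  by rewrite mulf_eq0 (gt_eqF Gb) orbF => /eqP->; rewrite scale0r add0r sum_in_span.
suff pos a : a \in R -> a \in <<b :: C>>%VS -> 0 < G a -> int_span (b :: C) a.
  move=> a aR aB; have [Ga|Ga|Ga] := ltrgt0P (G a); first exact: pos.
    rewrite -[a]opprK; apply: int_spanN; apply: pos.
    - exact: (root_opp R_root).
    - by rewrite rpredN.
    - by rewrite GN oppr_gt0.
  by apply: intC; apply: primC => //; exact: G0.
move=> aR aB Ga; apply: contrapT => nint.
pose P v := [/\ v \in <<b :: C>>%VS, 0 < G v & ~ int_span (b :: C) v].
have [|{aR aB Ga nint}a [aR [aB Ga nint] amin]] := @seq_arglexmin R P G h.
  by exists a.
have [s sB as_] : exists2 s, s \in b :: C & 0 < dot a s.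
  apply: contrapT => none.
  have : crd (b :: C) a b <= 0.
    apply: (@obtuse_crd_le0 _ _ dot (b :: C) (crd (b :: C) a)) => //.
    - exact: (pi_obtuse R_root piB).
    - move=> s sB; rewrite -crd_sum // leNgt; apply/negP => as_.
      by apply: none; exists s.
    - exact: mem_head.
  by rewrite -(pmulr_lle0 _ Gb) -crdb // leNgt Ga.
have [as0|as0] := eqVneq a s.
  by apply: nint; rewrite as0; apply: int_span_id => //; exact: free_uniq.
have asR := root_sub R_root aR (BR _ sB) as_ as0.
have asB : a - s \in <<b :: C>>%VS by apply: rpredB => //; exact: memv_span.
have nint' : ~ int_span (b :: C) (a - s).
  move=> h'; apply: nint; rewrite -[a](subrK s); apply: int_spanD => //.
  by apply: int_span_id => //; exact: free_uniq.
move: sB; rewrite inE => /predU1P[sb|sC]; last first.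
  have Gas : G (a - s) = G a by rewrite GD GN (Gr _ sC) subr0.
  have [|_] := amin _ asR; first by split; rewrite ?Gas.
  by move=> /(_ Gas); rewrite hD hN (hr _ sC); lra.
subst s; have [Gab|Gab] := eqVneq (G a) (G b).
  apply: nint'; apply: intC; apply: primC => //; apply: G0 => //.
  by rewrite GD GN Gab subrr.
have [|ba _] := bmin a aR; first by split=> //; exact: BX.
have Gab' : 0 < G (a - b) by rewrite GD GN subr_gt0 lt_neqAle eq_sym Gab.
have [|] := amin _ asR; first by split.
by rewrite GD GN; lra.
Qed.

Lemma primitive_root_basis B : primitive B -> <<B>>%VS = fullv -> root_basis R B.
Proof.
move=> [piB primB] BT; have [BR fB dB] := piB.
split=> //; first by rewrite /basis_of BT eqxx.
move=> a aR; have [|z aE] := primB a aR; first by rewrite BT memvf.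
exists z; split=> //; apply: (pi_system_homogeneous R_root piB).
by rewrite -aE.
Qed.

Lemma primitive_extends C : primitive C -> extends_to_basis R C.
Proof.
move: {2}(\dim (@fullv _ V) - size C).+1 (leqnn (\dim (@fullv _ V) - size C).+1) => n.
elim: n C => // n IH C le primC; have [piC _] := primC; have [CR fC _] := piC.
have [CT|/(primitive_extend primC)[b primB]] := eqVneq <<C>>%VS fullv.
  by exists C; split=> //; exact: primitive_root_basis.
have [_ fB _] : pi_system R (b :: C) by case: primB.
have leB : (size (b :: C) <= \dim (@fullv _ V))%N.
  by move: (fB); rewrite /free => /eqP<-; rewrite dimvS // subvf.
have [|B [BB sub]] := IH (b :: C) _ primB.
  by move: le leB => /=; clear; lia.
by exists B; split=> // r rC; apply: sub; rewrite inE rC orbT.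
Qed.

Lemma root_basis_free B : root_basis R B -> free B.
Proof. by case=> _ /basis_free. Qed.

Lemma root_basis_span B : root_basis R B -> <<B>>%VS = fullv.
Proof. by case=> _ /span_basis. Qed.

Lemma root_basis_int B a : root_basis R B -> a \in R -> int_span B a.
Proof. by case=> _ _ h /h[c [-> _]]; exists c. Qed.

Lemma root_basis_pi B : root_basis R B -> pi_system R B.
Proof.
move=> BB; have fB := root_basis_free BB; have [BR _ h] := BB; split=> // a b aB bB.
have [->|ab] := eqVneq a b; first by rewrite subrr; case: R_root.
apply/negP => /h[c [e sgn]].
have ca t : t \in B -> (c t)%:~R = (a == t)%:R - (b == t)%:R :> K.
  move=> tB; rewrite -(crdP (fun t => (c t)%:~R) fB tB) -e -[- b]scaleN1r.
  by rewrite crdD crdZ !crd_id // mulN1r.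
have {}ca t : t \in B -> c t = (a == t)%:R - (b == t)%:R.
  move=> tB; apply/eqP; rewrite -(eqr_int K) ca // rmorphB /=.
  by case: (a == t); case: (b == t).
case: sgn => sgn.
  by have := sgn b bB; rewrite ca // eqxx (negPf ab).
by have := sgn a aB; rewrite ca // eqxx eq_sym (negPf ab).
Qed.

Lemma root_basis_size B : root_basis R B -> size B = \dim (@fullv _ V).
Proof.
by move=> BB; rewrite -(root_basis_span BB); apply/esym/eqP; exact: root_basis_free.
Qed.

End Bases.

(** * Indecomposable root systems *)

Section Irreducible.
Variables (K : realType) (V : vectType K) (dot : {dot V for (@idfun K)}).
Variables (R : seq V) (R_root : root_system dot R).
Variable (R_indec : indecomposable_root_system dot R).
Implicit Types (S C B : seq V) (a b c u v w x y z : V).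

(** The form in which indecomposability is used: a property of a root that
    passes to all roots which are not orthogonal to it holds for all roots. *)
Lemma root_propagate (P : V -> Prop) a : a \in R -> P a ->
  (forall b c, b \in R -> c \in R -> P b -> ~ P c -> dot b c = 0) ->
  forall b, b \in R -> P b.
Proof.
move=> aR Pa orth b bR; apply: contrapT => Pb; case: R_indec => _; apply.
exists [seq x <- R | `[< P x >]], [seq x <- R | ~~ `[< P x >]]; split.
- apply/eqP => e; have : a \in [::] by rewrite -e mem_filter aR andbT; apply/asboolP.
  by rewrite in_nil.
- apply/eqP => e; have : b \in [::] by rewrite -e mem_filter bR andbT; apply/asboolPn.
  by rewrite in_nil.
- by move=> x; rewrite mem_cat !mem_filter; case: `[< _ >]; rewrite ?orbF.
- move=> x y; rewrite !mem_filter => /andP[/asboolP Px xR] /andP[/asboolPn Py yR].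
  exact: orth.
Qed.

(** If [d] is orthogonal to [c] then its reflection in a root [b] which is
    orthogonal to neither of them is not. This is the argument that the orbit of
    [a] under the Weyl group spans the space. *)
Lemma norm_linked a b : a \in R -> b \in R ->
  exists c, [/\ c \in R, dot c c = dot a a & dot c b != 0].
Proof.
move=> aR; move: b; apply: (@root_propagate _ a) => //.
  by exists a; split; rewrite // gt_eqF // (root_gt0 R_root).
move=> b c bR cR [d [dR dd db]] none; apply/eqP/negPn/negP => bc.
case: none; have [dc|dc] := eqVneq (dot d c) 0; last by exists d.
exists (d - cartan dot d b *: b); split; first exact: (reflection_root R_root).
  by rewrite (reflection_dot R_root).
rewrite dotDl dotNl dotZl dc sub0r oppr_eq0 !mulf_neq0 ?pnatr_eq0 //.
by rewrite invr_eq0 gt_eqF // (root_gt0 R_root).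
Qed.

Lemma bond_norms a b : a \in R -> b \in R -> dot a b < 0 -> a != - b ->
  exists m n : nat, [/\ 2 * dot a b = - m%:R * dot b b, 2 * dot a b = - n%:R * dot a a
    & (m, n) \in [:: (1, 1); (1, 2); (2, 1); (1, 3); (3, 1)]%N].
Proof.
move=> aR bR ab nab; have [m [n [mE nE mn]]] := cartan_lt0_cases R_root aR bR ab nab.
exists m, n; split=> //; first by rewrite -mE (cartanE R_root).
by rewrite -nE (cartanE R_root) // dotC.
Qed.

Lemma norm_ratio a b : a \in R -> b \in R ->
  [\/ dot a a = dot b b, dot a a = 2 * dot b b, dot b b = 2 * dot a a
    | (dot a a = 3 * dot b b \/ dot b b = 3 * dot a a)].
Proof.
move=> aR bR; have [c [cR <- cb]] := norm_linked aR bR.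
wlog cb0 : c cR cb / dot c b < 0.
  move=> wl; move: (cb); rewrite neq_lt => /orP[|cb0]; first exact: wl.
  have := wl (- c); rewrite !dotE opprK oppr_eq0 oppr_lt0; apply=> //.
  exact: (root_opp R_root).
have [->|ncb] := eqVneq c (- b); first by rewrite !dotE opprK; constructor 1.
have [m [n []]] := bond_norms cR bR cb0 ncb.
move=> e1 e2; have {e1 e2} : m%:R * dot b b = n%:R * dot c c by lra.
rewrite !inE !xpair_eqE => e /or4P[|||/orP[]] /andP[/eqP m1 /eqP n1];
  move: e; rewrite m1 n1 => e.
- by constructor 1; lra.
- by constructor 3; lra.
- by constructor 2; lra.
- by constructor 4; right; lra.
- by constructor 4; left; lra.
Qed.

(** The squared lengths of two roots have a ratio of at most 3, but two steps of
    at least 2 have a product of at least 4. *)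
Lemma two_lengths a b c : a \in R -> b \in R -> c \in R ->
  dot a a < dot b b -> dot b b < dot c c -> False.
Proof.
move=> aR bR cR ab bc; have := root_gt0 R_root aR; have := root_gt0 R_root bR.
move=> b0 a0.
have ab2 : 2 * dot a a <= dot b b.
  by have [||| []] := norm_ratio bR aR; move: ab a0; clear; lra.
have bc2 : 2 * dot b b <= dot c c.
  by have [||| []] := norm_ratio cR bR; move: bc b0; clear; lra.
by have [||| []] := norm_ratio cR aR; move: ab2 bc2 a0; clear; lra.
Qed.

Lemma short_root_norm a b : a \in R -> b \in R ->
  short_root dot R a = short_root dot R b -> dot a a = dot b b.
Proof.
wlog ab : a b / dot a a < dot b b => [wl aR bR|].
  have [ab|ab|//] := ltrgtP (dot a a) (dot b b); first exact: wl.
  by move=> e; apply/esym/wl.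
move=> aR bR; rewrite /short_root; have -> : has (fun b => dot a a < dot b b) R.
  by apply/hasP; exists b.
move=> /esym/hasP[c cR bc]; case: (two_lengths aR bR cR ab bc).
Qed.

(** The quadratic form is the squared length of the weight with Cartan integers
    [p] and [q], in units of that of a short root. *)
Let g2_form (p q : int) : let F := p ^+ 2 + 3 * p * q + 3 * q ^+ 2 in
  (p != 0 -> F < `|p|) -> (q != 0 -> F < 3 * `|q|) ->
  [\/ p = 0 /\ q = 0, p = 2 /\ q = -1 | p = -2 /\ q = 1].
Proof.
move=> F hp hq; have [p0|np] := eqVneq p 0.
  have [->|nq] := eqVneq q 0; first by constructor 1.
  by have := hq nq; move: nq; rewrite /F p0; clear; nia.
have [q0|nq] := eqVneq q 0; first by have := hp np; move: np; rewrite /F q0; clear; nia.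
have {}hp := hp np; have {}hq := hq nq.
have qb : `|q| < 4 by move: hq nq (sqr_ge0 (2 * p + 3 * q)); rewrite /F; clear; nia.
have pb : `|p| < 4 by move: hp np (sqr_ge0 (p + 2 * q)); rewrite /F; clear; nia.
move: hp hq {np nq} qb pb; rewrite {}/F.
by case: p => [[|[|[|[|n]]]]|[|[|[|n]]]]; case: q => [[|[|[|[|m]]]]|[|[|[|m]]]] //;
   try (by clear; lia); move=> *; [constructor 2|constructor 3].
Qed.

(** In the plane of a triple bond the weight lattice is the root lattice, so
    that the projection of a root [b] to the plane is an integral combination of
    [s] and [t]; it is shorter than [b] if [b] is not in the plane. The Cartan
    integers of [b] with [s] and [t] only allow the projections 0, [s] and
    [- s], and in the last two cases [b] would not be longer than [s]. *)
Lemma triple_bond s t : s \in R -> t \in R ->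
  cartan dot s t = -1 -> cartan dot t s = - 3 ->
  forall b, b \in R -> b \in <<[:: s; t]>>%VS.
Proof.
move=> sR tR st ts; set U := <<_>>%VS.
have sU : s \in U by rewrite memv_span ?mem_head.
have tU : t \in U by rewrite memv_span ?inE ?eqxx ?orbT.
apply: (root_propagate sR) => // a b aR bR aU bU; have {aR} := aU.
rewrite /U span_cons span_seq1 => /memv_addP[_ /vlineP[k ->] [_ /vlineP[l ->] ->]].
suff [bs bt] : dot b s = 0 /\ dot b t = 0.
  by rewrite dotDl !dotZl ![dot _ b]dotC bs bt !mulr0 addr0.
have N0 := root_gt0 R_root sR; have M0 := root_gt0 R_root bR.
have tt : dot t t = 3 * dot s s.
  by have := cartanE R_root s tR; have := cartanE R_root t sR; rewrite st ts dotC; lra.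
have std : dot s t = - 3 / 2 * dot s s.
  by have := cartanE R_root t sR; rewrite ts dotC; lra.
have [p pE] := cartan_int R_root bR sR; have [p' p'E] := cartan_int R_root sR bR.
have [q qE] := cartan_int R_root bR tR; have [q' q'E] := cartan_int R_root tR bR.
have := cartanE R_root b sR; have := cartanE R_root b tR; rewrite pE qE tt => e1 e2.
have := cartanE R_root s bR; have := cartanE R_root t bR; rewrite p'E q'E => e3 e4.
pose x := (2 * p + 3 * q)%:~R *: s + (p + 2 * q)%:~R *: t.
have xU : x \in U by rewrite rpredD ?rpredZ.
have bx : b - x != 0 by apply/negP; rewrite subr_eq0 => /eqP e; case: bU; rewrite e.
have {bx xU} := dot_gt0 dot bx; rewrite /x.
set P := p%:~R : K in e2; set Q := q%:~R : K in e1.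
have -> : (2 * p + 3 * q)%:~R = 2 * P + 3 * Q :> K by rewrite rmorphD !rmorphM.
have -> : (p + 2 * q)%:~R = P + 2 * Q :> K by rewrite rmorphD !rmorphM.
rewrite !dotE (dotC _ s b) (dotC _ t b) (dotC _ t s) std tt.
have -> : dot b t = 3 / 2 * Q * dot s s by lra.
have -> : dot b s = 1 / 2 * P * dot s s by lra.
move=> F.
have {F} F : (P ^+ 2 + 3 * P * Q + 3 * Q ^+ 2) * dot s s < dot b b by lra.
have {}e3 : q'%:~R * dot b b = (3 * Q) * dot s s.
  by move: e1 e3; rewrite (dotC _ t b); clear; lra.
have {}e4 : p'%:~R * dot b b = P * dot s s by rewrite e4 dotC; move: e2; clear; lra.
have b1 (m m' : int) : m'%:~R * dot b b = m%:~R * dot s s -> m != 0 ->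
  p ^+ 2 + 3 * p * q + 3 * q ^+ 2 < `|m|.
  move=> e m0; rewrite -(ltr_int K) intr_norm.
  have -> : (p ^+ 2 + 3 * p * q + 3 * q ^+ 2)%:~R = P ^+ 2 + 3 * P * Q + 3 * Q ^+ 2.
    by rewrite /P /Q; ring.
  rewrite -(ltr_pM2r N0); apply: lt_le_trans F _.
  rewrite -{1}(gtr0_norm N0) -normrM -e normrM (gtr0_norm M0) ler_peMl ?(ltW M0) //.
  have m'0 : m' != 0.
    apply/eqP => z; move: e; rewrite z mul0r => /esym/eqP.
    by rewrite mulf_eq0 (gt_eqF N0) orbF intr_eq0 (negPf m0).
  have : 1 <= `|m'|%:~R :> K by rewrite ler1z -gtz0_ge1 normr_gt0.
  by rewrite intr_norm.
have e' : q' * p = p' * (3 * q).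
  apply/eqP; rewrite -(eqr_int K) !rmorphM /=; apply/eqP.
  apply: (mulIf (lt0r_neq0 M0)).
  by rewrite [LHS]mulrAC [RHS]mulrAC e3 e4 /P /Q; clear; ring.
have [||[p0 q0]|[p2 q1]|[p2 q1]] := @g2_form p q.
- exact: b1 e4.
- move=> q0; have -> : 3 * `|q| = `|3 * q| by rewrite normrM.
  apply: (b1 _ q'); last by rewrite mulf_neq0.
  by rewrite e3 /Q rmorphM.
- by rewrite /P /Q p0 q0 !mulr0 !mul0r.
- have kE : p' = 2 * - (p' + q') by move: e'; rewrite p2 q1; clear; lia.
  have k1 : (- (p' + q'))%:~R * dot b b = 1%:~R * dot s s.
    by move: e4; rewrite {1}kE rmorphM /= /P p2; clear; lra.
  by have := b1 _ _ k1 isT; rewrite p2 q1.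
- have kE : p' = 2 * - (p' + q') by move: e'; rewrite p2 q1; clear; lia.
  have k1 : (- (p' + q'))%:~R * dot b b = (-1)%:~R * dot s s.
    by move: e4; rewrite {1}kE rmorphM /= /P p2; clear; lra.
  by have := b1 _ _ k1 isT; rewrite p2 q1.
Qed.

Lemma root_bond a b : (forall s t, s \in R -> t \in R ->
    cartan dot s t = -1 -> cartan dot t s = - 3 -> False) ->
  a \in R -> b \in R -> dot a b < 0 -> a != - b ->
  [\/ dot a a = dot b b /\ 2 * dot a b = - dot b b,
      dot a a = 2 * dot b b /\ dot a b = - dot b b
    | dot b b = 2 * dot a a /\ dot a b = - dot a a].
Proof.
move=> no3 aR bR ab nab; have [m [n [mE nE]]] := cartan_lt0_cases R_root aR bR ab nab.
have := cartanE R_root a bR; have := cartanE R_root b aR; rewrite mE nE (dotC _ b a).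
rewrite !inE !xpair_eqE => e1 e2 /or4P[|||/orP[]] /andP[/eqP m1 /eqP n1].
- by constructor 1; move: e1 e2; rewrite m1 n1; lra.
- by constructor 3; move: e1 e2; rewrite m1 n1; lra.
- by constructor 2; move: e1 e2; rewrite m1 n1; lra.
- by case: (no3 a b); rewrite // ?mE ?nE ?m1 ?n1.
- by case: (no3 b a); rewrite // ?mE ?nE ?m1 ?n1.
Qed.

(** A root with the given property of least height with respect to [C]: the
    reflection in [c] lowers the height if [dot a c > 0]. *)
Lemma obtuse_representative C (P : V -> Prop) : free C -> {subset C <= R} ->
  (exists2 a, a \in R & P a) ->
  (forall a c, a \in R -> c \in C -> P a -> 0 < dot a c ->
     P (a - cartan dot a c *: c)) ->
  exists a, [/\ a \in R, P a & forall c, c \in C -> dot a c <= 0].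
Proof.
move=> fC CR exP stable; have [a [aR Pa amin]] := seq_argmin (height C) exP.
exists a; split=> // c cC; rewrite leNgt; apply/negP => ac.
have := amin _ (reflection_root R_root (CR _ cC) aR) (stable a c aR cC Pa ac).
rewrite -scaleNr heightD heightZ (height_id fC cC) mulr1 => h.
have : 0 < cartan dot a c by rewrite /cartan divr_gt0 ?mulr_gt0 // (root_gt0 R_root) ?CR.
by move: h; clear; lra.
Qed.

Lemma imprimitive_root C : pi_system R C -> ~ primitive R C ->
  exists a, [/\ a \in R, a \in <<C>>%VS, ~ int_span C a
    & forall c, c \in C -> dot a c <= 0].
Proof.
move=> piC nprim; have [CR fC _] := piC.
have [||a [aR [aC na] obt]] :=
    @obtuse_representative C (fun a => a \in <<C>>%VS /\ ~ int_span C a) fC CR.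
- apply: contrapT => none; apply: nprim; split=> // a aR aC; apply: contrapT => na.
  by apply: none; exists a.
- move=> a c aR cC [aC na] _; split.
    by apply: rpredB => //; rewrite memvZ ?memv_span.
  have [m ->] := cartan_int R_root aR (CR _ cC) => h; apply: na.
  rewrite -[a](subrK (m%:~R *: c)); apply: int_spanD => //; apply: int_spanZ.
  by apply: int_span_id => //; exact: free_uniq.
by exists a.
Qed.

(** The property to be preserved by the reflections is that the root is outside
    of the span and not orthogonal to it; by indecomposability there is such a
    root. *)
Lemma linked_outside C : pi_system R C -> C != [::] -> <<C>>%VS != fullv ->
  exists b, [/\ b \in R, b \notin <<C>>%VS, forall c, c \in C -> dot b c <= 0
    & exists2 c, c \in C & dot b c < 0].
Proof.
move=> [CR fC _] C0 CT.
have [||b [bR [bC [x xC bx]] obt]] := @obtuse_representative C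
    (fun b => b \notin <<C>>%VS /\ exists2 x, x \in <<C>>%VS & dot b x != 0) fC CR.
- apply: contrapT => none; have [c cC] : exists c, c \in C.
    by case: (C) C0 => // c s _; exists c; rewrite mem_head.
  have [b bR] := root_outside R_root CT; apply/negP; rewrite negbK.
  apply: (root_propagate (P := fun b => b \in <<C>>%VS) (CR _ cC)) => //.
    exact: memv_span.
  move=> x y xR yR xC /negP yC; apply/eqP/negPn/negP => xy; apply: none.
  by exists y => //; split=> //; exists x => //; rewrite dotC.
- move=> b c bR cC [bC [x xC bx]] _; have cC' := memv_span cC; split.
    by apply: contra bC => h; rewrite -[b](subrK (cartan dot b c *: c)) rpredD ?memvZ.
  exists (x - cartan dot x c *: c); first by rewrite rpredB ?memvZ.
  by rewrite (reflection_dot R_root) ?CR.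
exists b; split=> //; apply: contrapT => none; case/eqP: bx.
rewrite (crd_sum fC xC) dot_sumr big_seq big1 // => c cC; rewrite dotZr.
suff -> : dot b c = 0 by rewrite mulr0.
by apply/eqP; rewrite eq_le obt //= leNgt; apply/negP => bc; apply: none; exists c.
Qed.

End Irreducible.

(** * Connected diagrams and isometries *)

Section Diagrams.
Variables (K : realType) (V : vectType K) (dot : {dot V for (@idfun K)}).
Variables (R : seq V) (R_root : root_system dot R).
Variable (R_indec : indecomposable_root_system dot R).
Implicit Types (S C B : seq V) (a b c u v w x y z : V).

(** Connectedness of the graph of the pairs at an obtuse angle, in the form of
    an induction principle. *)
Definition linked S := forall (P : V -> Prop) a, a \in S -> P a ->
  (forall x y, x \in S -> y \in S -> P x -> dot x y < 0 -> P y) ->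
  forall y, y \in S -> P y.

Lemma linked_path S a b : linked S -> a \in S -> b \in S ->
  exists p, [/\ path (fun x y => dot x y < 0) a p, last a p = b,
    uniq (a :: p) & {subset p <= S}].
Proof.
move=> lS aS; move: b; apply: (lS _ a aS); first by exists [::].
move=> x y xS yS [p [pp pl pu ps]] xy.
have := last_rcons a p y.
have /shortenP[q qp qu qs] : path (fun x y => dot x y < 0) a (rcons p y).
  by rewrite rcons_path pp pl.
move=> ql; exists q; split=> // t /qs.
by rewrite mem_rcons inE => /predU1P[->|/ps].
Qed.

Lemma pi_linked C : pi_system R C -> connected_diagram (dynkin_diagram dot C) ->
  linked C.
Proof.
move=> piC conn P a aC Pa step y yC.
have /connectP[p] := conn (SeqSub aC : node (dynkin_diagram dot C)) (SeqSub yC).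
elim: p a aC Pa => [|q p IH] a aC Pa /=; first by move=> _ [->].
case/andP => aq pq yl; apply: (IH (val q) (valP q)) => //; last first.
- by rewrite yl; congr last; exact: val_inj.
- by have -> : SeqSub (valP q) = q by exact: val_inj.
apply: (step a) => //; first exact: (valP q).
move: aq; have [e|nq] := eqVneq (SeqSub aC) q; first by rewrite ltnn.
have aq : a != val q by apply: contraNneq nq => aq; apply/eqP/val_inj.
rewrite lt_neqAle (pi_obtuse R_root piC) ?(valP q) // andbT.
by apply: contraTneq => e; rewrite /cartan e mulr0 !mul0r truncn0.
Qed.

(** Each root has its coordinates in one component of [B]. Otherwise a reflected
    positive root of least height, with coordinates in different components,
    would be obtuse to [B] and have nonnegative coordinates, which only holds
    for 0. So the components of [B] decompose [R]. *)
Lemma root_basis_linked B : root_basis R B -> linked B.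
Proof.
move=> BB P a aB Pa step; have piB := root_basis_pi R_root BB.
have [BR fB _] := piB; have spanB := root_basis_span BB.
have orth x y : x \in B -> y \in B -> P x -> ~ P y -> dot x y = 0.
  move=> xB yB Px Py; have xy : x != y by apply: contra_notN Py => /eqP<-.
  apply/eqP; rewrite eq_le (pi_obtuse R_root piB) //= leNgt; apply/negP => xy0.
  by apply: Py; apply: (step x).
pose in1 x := forall b, b \in B -> ~ P b -> crd B x b = 0.
pose in2 x := forall b, b \in B -> P b -> crd B x b = 0.
have xsum x : x = \sum_(b <- B) crd B x b *: b by apply: crd_sum; rewrite ?spanB ?memvf.
have in12 x y : in1 x -> in2 y -> dot x y = 0.
  move=> x1 y2; rewrite (xsum x) dot_suml big_seq big1 // => b bB; rewrite dotZl.
  have [Pb|Pb] := pselect (P b); last by rewrite x1 ?mul0r.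
  rewrite (xsum y) dot_sumr big_seq big1 ?mulr0 // => c cB; rewrite dotZr.
  have [Pc|Pc] := pselect (P c); first by rewrite y2 ?mul0r.
  by rewrite orth ?mulr0.
have crdB x b c : b \in B -> c \in B -> crd B (x - cartan dot x b *: b) c =
    crd B x c - cartan dot x b * (b == c)%:R.
  by move=> bB cB; rewrite -scaleNr crdD crdZ (crd_id fB bB cB) mulNr.
have crd_refl x b c : b \in B -> c \in B -> b != c ->
    crd B (x - cartan dot x b *: b) c = crd B x c.
  by move=> bB cB /negPf bc; rewrite crdB // bc mulr0 subr0.
have dot_refl x b : b \in B -> dot (x - cartan dot x b *: b) b = - dot x b.
  move=> bB; rewrite dotDl dotNl dotZl /cartan divfK; last first.
    by rewrite gt_eqF // (root_gt0 R_root) ?BR.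
  by ring.
have in1_id b : b \in B -> P b -> in1 b.
  move=> bB Pb c cB Pc; rewrite crd_id //; case: eqP => // bc.
  by case: Pc; rewrite -bc.
have in2_id b : b \in B -> ~ P b -> in2 b.
  move=> bB Pb c cB Pc; rewrite crd_id //; case: eqP => // bc.
  by case: Pb; rewrite bc.
have split x : x \in R -> in1 x \/ in2 x.
  move=> xR; apply: contrapT => /not_orP nx.
  pose Q x := (~ in1 x /\ ~ in2 x) /\ forall b, b \in B -> 0 <= crd B x b.
  have sgn y : y \in R -> (forall b, b \in B -> 0 <= crd B y b) \/
      (forall b, b \in B -> crd B y b <= 0).
    move=> yR; have [z [yE [z0|z0]]] : exists z : V -> int,
        y = \sum_(b <- B) (z b)%:~R *: b /\ ((forall b, b \in B -> 0 <= z b) \/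
        (forall b, b \in B -> z b <= 0)) by case: BB => _ _ /(_ y yR).
      by left => b bB; rewrite yE (crdP (fun b => (z b)%:~R)) // ler0z z0.
    by right => b bB; rewrite yE (crdP (fun b => (z b)%:~R)) // lerz0 z0.
  have [||y [yR [ny y0] obt]] := @obtuse_representative _ _ dot R R_root B Q fB BR.
  - have [x0|x0] := sgn x xR; first by exists x.
    exists (- x); first exact: (root_opp R_root).
    have crdN b : crd B (- x) b = - crd B x b by rewrite -scaleN1r crdZ mulN1r.
    split; last by move=> b bB; rewrite crdN oppr_ge0 x0.
    case: nx => n1 n2; split=> h; [apply: n1|apply: n2] => b bB Pb;
      by have := h b bB Pb; rewrite crdN => /eqP; rewrite oppr_eq0 => /eqP.
  - move=> y b yR bB [[n1 n2] y0] yb.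
    have syR := reflection_root R_root (BR _ bB) yR.
    have fix0 : dot (y - cartan dot y b *: b) b <> 0.
      by rewrite dot_refl // => /eqP; rewrite oppr_eq0 gt_eqF.
    have [Pb|Pb] := pselect (P b).
      have h1 : ~ in1 (y - cartan dot y b *: b).
        move=> h; apply: n1 => c cB Pc; rewrite -(h c cB Pc) crd_refl //.
        by apply: contra_notN Pc => /eqP<-.
      split; first split=> // h2; first by apply: fix0; rewrite dotC; apply: in12 => //; exact: in1_id.
      have [//|neg] := sgn _ syR; case: h1 => c cB Pc.
      apply/eqP; rewrite eq_le neg //= crd_refl ?y0 //.
      by apply: contra_notN Pc => /eqP<-.
    have h2 : ~ in2 (y - cartan dot y b *: b).
      move=> h; apply: n2 => c cB Pc; rewrite -(h c cB Pc) crd_refl //.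
      by apply: contra_notN Pb => /eqP->.
    split; first split=> // h1; first by apply: fix0; apply: in12 => //; exact: in2_id.
    have [//|neg] := sgn _ syR; case: h2 => c cB Pc.
    apply/eqP; rewrite eq_le neg //= crd_refl ?y0 //.
    by apply: contra_notN Pb => /eqP->.
  - case: ny => n1 _; apply: n1 => b bB _; apply/eqP; rewrite eq_le y0 // andbT.
    apply: (@obtuse_crd_le0 _ _ dot B) => //; first exact: (pi_obtuse R_root piB).
    by move=> c cB; rewrite -xsum obt.
move=> b bB; apply: contrapT => Pb.
have : in1 b.
  apply: (root_propagate R_indec (P := in1) (BR _ aB)); rewrite ?BR //; first exact: in1_id.
  by move=> x y xR yR x1 ny; apply: in12 => //; case: (split y yR).
by move=> /(_ b bB Pb)/eqP; rewrite crd_id // eqxx oner_eq0.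
Qed.

Lemma dot_isometric (g : V -> V) C : {in C &, forall x y, dot (g x) (g y) = dot x y} ->
  {in C &, injective g}.
Proof.
move=> iso x y xC yC e; apply/eqP; rewrite -subr_eq0; apply/eqP/(@dot_le0 _ _ dot).
by rewrite !dotE -(iso _ _ xC xC) -(iso _ _ xC yC) -(iso _ _ yC xC) -(iso _ _ yC yC) e; lra.
Qed.

Lemma truncn_eq (r s : K) m n : r = m%:R -> s = n%:R ->
  Num.truncn r = Num.truncn s -> r = s.
Proof. by move=> -> ->; rewrite !natrK => ->. Qed.

Lemma cartan_prod_nat C a b : pi_system R C -> a \in C -> b \in C -> a != b ->
  exists m : nat, cartan dot a b * cartan dot b a = m%:R.
Proof.
move=> piC aC bC ab; have [CR fC _] := piC.
have := pi_obtuse R_root piC aC bC ab; rewrite le_eqVlt => /predU1P[ab0|ab0].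
  by exists 0%N; rewrite /cartan ab0 mulr0 !mul0r.
have anb : a != - b by exact: free_neq_opp fC aC bC.
have [m [n [-> -> _]]] := cartan_lt0_cases R_root (CR _ aC) (CR _ bC) ab0 anb.
by exists (m * n)%N; rewrite mulrNN natrM.
Qed.

(** The marking determines the lengths, since there are at most two, and the
    numbers of links then determine the scalar products. *)
Lemma embedding_isometry B C (f : node (dynkin_diagram dot C) -> node (dynkin_diagram dot B)) :
  pi_system R C -> pi_system R B -> embedding f ->
  (forall i, short_root dot R (val (f i)) = short_root dot R (val i)) ->
  exists g : V -> V, {in C, forall x, g x \in B} /\
    {in C &, forall x y, dot (g x) (g y) = dot x y}.
Proof.
move=> piC piB [injf bondf _] markf; have [CR _ _] := piC; have [BR _ _] := piB.
have normf i : dot (val (f i)) (val (f i)) = dot (val i) (val i).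
  by apply: (short_root_norm R_root R_indec) => //; [exact/BR/valP|exact/CR/valP].
have dotf i j : dot (val (f i)) (val (f j)) = dot (val i) (val j).
  have [<-|ij] := eqVneq i j; first exact: normf.
  have fij : f i != f j by rewrite (inj_eq injf).
  have := bondf i j; rewrite /= (negPf ij) (negPf fij).
  have xyv : val i != val j by rewrite (inj_eq val_inj).
  have fxyv : val (f i) != val (f j) by rewrite (inj_eq val_inj).
  have [m mE] := cartan_prod_nat piB (valP (f i)) (valP (f j)) fxyv.
  have [n nE] := cartan_prod_nat piC (valP i) (valP j) xyv.
  move/(truncn_eq mE nE); rewrite /cartan !normf.
  rewrite [dot (val (f j)) (val (f i))]dotC [dot (val j) (val i)]dotC.
  have x0 := root_gt0 R_root (CR _ (valP i)); have y0 := root_gt0 R_root (CR _ (valP j)).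
  have le1 := pi_obtuse R_root piB (valP (f i)) (valP (f j)) fxyv.
  have le2 := pi_obtuse R_root piC (valP i) (valP j) xyv.
  set r := dot (val (f i)) _ in le1 *; set s := dot (val i) (val j) in le2 *.
  set p := dot (val i) (val i) in x0 *; set q := dot (val j) (val j) in y0 *.
  have k t : 2 * t / q * (2 * t / p) = 4 / (p * q) * t ^+ 2.
    by field; rewrite !gt_eqF.
  rewrite !k => /(mulfI _) e; have {}e : r ^+ 2 = s ^+ 2.
    by apply: e; rewrite mulf_neq0 ?invr_eq0 ?mulf_neq0 ?gt_eqF // ltr0n.
  by apply/eqP; rewrite -eqr_opp -(@eqrXn2 _ 2) ?oppr_ge0 // !sqrrN e.
exists (fun x => if insub x is Some u then val (f u) else 0); split.
  by move=> x xC; rewrite insubT; exact: valP.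
by move=> x y xC yC; rewrite !insubT dotf.
Qed.

(** Expressing an isometric pi-system in the basis gives an integral matrix
    which preserves the Gram matrix, so that its determinant is 1 or -1. *)
Lemma full_rank_int_span B C (g : V -> V) : root_basis R B -> pi_system R C ->
  size C = size B -> {in C, forall x, g x \in B} ->
  {in C &, forall x y, dot (g x) (g y) = dot x y} ->
  forall a, a \in R -> int_span C a.
Proof.
move=> BB [CR fC _] sz gB iso; have fB := root_basis_free BB.
have uC := free_uniq fC; have uB := free_uniq fB; have injg := dot_isometric iso.
have ug : uniq (map g C) by rewrite map_inj_in_uniq.
have permB : perm_eq (map g C) B.
  apply: uniq_perm => //.
  have sub : {subset map g C <= B} by move=> _ /mapP[x xC ->]; exact: gB.
  by have [|_ e] := uniq_min_size ug sub; rewrite ?size_map ?sz.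
pose n := size C; pose c (i : 'I_n) := C`_i.
have cC i : c i \in C by exact: mem_nth.
have big_C (F : V -> V) : \sum_(x <- C) F x = \sum_(i < n) F (c i).
  by rewrite (big_nth 0) big_mkord.
have /choice[z zE] (i : 'I_n) : exists z : V -> int, c i = \sum_(j < n) (z (g (c j)))%:~R *: g (c j).
  have [z e] := root_basis_int BB (CR _ (cC i)); exists z.
  by rewrite {1}e -(perm_big _ permB) big_map big_C.
pose M : 'M[int]_n := \matrix_(i, j) z i (g (c j)).
pose G : 'M[K]_n := \matrix_(i, j) dot (c i) (c j).
pose MK := map_mx (intr : int -> K) M.
have GE : MK *m G *m MK^T = G.
  apply/matrixP => i j; rewrite !mxE [in RHS](zE i) [in RHS](zE j) dot_sumr.
  apply: eq_bigr => k _; rewrite !mxE dotZr mulrC; congr (_ * _).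
  rewrite dot_suml; apply: eq_bigr => l _; rewrite !mxE dotZl; congr (_ * _).
  by rewrite iso.
have detG : \det G != 0.
  apply/negP => /det0P[v v0 vG]; case/eqP: v0; apply/rowP => i; rewrite mxE.
  have : \sum_(k < n) v 0 k *: c k = 0.
    apply: (@dot_le0 _ _ dot); rewrite dot_sumr big1 // => k _; rewrite dotZr.
    suff -> : dot (\sum_(l < n) v 0 l *: c l) (c k) = 0 by rewrite mulr0.
    have := congr1 (fun A : 'rV_n => A 0 k) vG; rewrite !mxE => <-.
    by rewrite dot_suml; apply: eq_bigr => l _; rewrite !mxE dotZl.
  move: fC; rewrite -[C]/(tval (in_tuple C)) => /freeP/(_ (fun k => v 0 k))h e.
  exact: h.
have : \det M * \det M == 1.
  rewrite -(eqr_int K) rmorphM /= -det_map_mx -/MK; apply/eqP/(mulfI detG).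
  by rewrite mulr1 -{2}GE !det_mulmx det_tr; ring.
move=> /eqP detM; have unitM : M \in unitmx.
  by rewrite unitmxE; apply/unitrP; exists (\det M).
have gc j : g (c j) = \sum_(i < n) (invmx M j i)%:~R *: c i.
  under eq_bigr do rewrite zE scaler_sumr.
  rewrite exchange_big /= (bigD1 j) //= [X in _ = _ + X]big1 ?addr0.
    under eq_bigr do rewrite scalerA; rewrite -scaler_suml.
    suff -> : \sum_(i < n) (invmx M j i)%:~R * (z i (g (c j)))%:~R = ((invmx M *m M) j j)%:~R :> K.
      by rewrite mulVmx // mxE eqxx scale1r.
    by rewrite mxE rmorph_sum; apply: eq_bigr => i _; rewrite rmorphM /= mxE.
  move=> k kj; under eq_bigr do rewrite scalerA; rewrite -scaler_suml.
  suff -> : \sum_(i < n) (invmx M j i)%:~R * (z i (g (c k)))%:~R = ((invmx M *m M) j k)%:~R :> K.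
    by rewrite mulVmx // mxE eq_sym (negPf kj) scale0r.
  by rewrite mxE rmorph_sum; apply: eq_bigr => i _; rewrite rmorphM /= mxE.
move=> a aR; have [y ->] := root_basis_int BB aR; apply: int_span_sum => b.
rewrite -(perm_mem permB) => /mapP[x xC ->].
have -> : x = c (Ordinal (n := n) (m := index x C) ltac:(by rewrite index_mem)).
  by rewrite /c /= nth_index.
rewrite gc; elim/big_ind: _ => [||i _]; [exact: int_span0|exact: int_spanD|].
by apply: int_spanZ; exact: int_span_id.
Qed.

End Diagrams.

(** * Cycles and Gram matrices *)

Section UnitChains.
Variables (K : realType) (V : vectType K) (dot : {dot V for (@idfun K)}).
Implicit Types (S C : seq V) (a b c u v w x y z : V).

Definition unit_of x : V := (Num.sqrt (dot x x))^-1 *: x.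

Lemma sqrt_dot_gt0 x : x != 0 -> 0 < Num.sqrt (dot x x).
Proof. by move=> x0; rewrite sqrtr_gt0 dot_gt0. Qed.

Lemma unit_norm x : x != 0 -> dot (unit_of x) (unit_of x) = 1.
Proof.
move=> x0; rewrite /unit_of !dotE mulrA -invfM -expr2 sqr_sqrtr ?dot_ge0 //.
by rewrite mulVf // gt_eqF // dot_gt0.
Qed.

Lemma unit_obtuse x y : dot x y <= 0 -> dot (unit_of x) (unit_of y) <= 0.
Proof.
move=> xy; rewrite /unit_of !dotE mulrA mulr_ge0_le0 // mulr_ge0 // invr_ge0 sqrtr_ge0 //.
Qed.

(** A new first vertex does not increase the norm: it adds 1, and its scalar
    product with the others, which counts twice, is at most [- 1 / 2]. *)
Lemma unit_path_norm x p : uniq (x :: p) -> {in x :: p, forall y, y != 0} ->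
  {in x :: p &, forall y z, y != z -> dot y z <= 0} ->
  path (fun y z => dot (unit_of y) (unit_of z) <= - 2^-1) x p ->
  dot (\sum_(y <- x :: p) unit_of y) (\sum_(y <- x :: p) unit_of y) <= 1.
Proof.
elim: p x => [|z p IH] x; first by move=> _ n0 _ _; rewrite big_seq1 unit_norm ?n0 ?mem_head.
rewrite cons_uniq => /andP[xp uzp] n0 obt /andP[xz zp].
have sub : {subset z :: p <= [:: x, z & p]} by move=> y yp; rewrite inE yp orbT.
have {}IH := IH z uzp (sub_in1 sub n0) (sub_in2 sub obt) zp.
rewrite big_cons !dotDl !dotDr unit_norm ?n0 ?mem_head // (dotC _ (\sum_(_ <- _) _) (unit_of x)).
set P := \sum_(y <- _) _ in IH *.
have : dot (unit_of x) P <= - 2^-1.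
  rewrite /P big_cons dotDr -[leRHS]addr0 lerD // dot_sumr big_seq.
  apply: sumr_le0 => y yp; apply: unit_obtuse; apply: obt; rewrite ?inE ?eqxx ?yp ?orbT //.
  by apply: contraNneq xp => ->; rewrite inE yp orbT.
by move: IH; lra.
Qed.

End UnitChains.

Section Cycles.
Variables (K : realType) (V : vectType K) (dot : {dot V for (@idfun K)}).
Variables (R : seq V) (R_root : root_system dot R).
Implicit Types (S C B : seq V) (a b c u v w x y z : V).

Lemma unit_bond a b : a \in R -> b \in R -> dot a b < 0 -> a != - b ->
  dot (unit_of dot a) (unit_of dot b) <= - 2^-1.
Proof.
move=> aR bR ab nab; have [m [n [e1 e2 mn]]] := bond_norms R_root aR bR ab nab.
have a0 := root_gt0 R_root aR; have b0 := root_gt0 R_root bR.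
have mn1 : 1 <= (m * n)%:R :> K.
  by rewrite ler1n; move: mn; rewrite !inE !xpair_eqE => /or4P[|||/orP[]] /andP[/eqP-> /eqP->].
have sab : Num.sqrt (dot a a) * Num.sqrt (dot b b) <= - (2 * dot a b).
  have h0 : 0 <= - (2 * dot a b) by move: ab; lra.
  rewrite -sqrtrM ?dot_ge0 // -[leRHS](ger0_norm h0) -sqrtr_sqr ler_sqrt ?sqr_ge0 //.
  have -> : (- (2 * dot a b)) ^+ 2 = (m * n)%:R * (dot a a * dot b b).
    by rewrite sqrrN expr2 {1}e1 e2 natrM; ring.
  by rewrite ler_peMl // mulr_ge0 ?ltW.
rewrite /unit_of !dotE mulrA -invfM ler_pdivrMl; last by rewrite mulr_gt0 ?sqrtr_gt0.
by rewrite mulrC; move: sab; rewrite [X in X <= _]mulrC; lra.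
Qed.

(** The path in [C] from [x] to [y] is closed by [e], which is linked to both
    ends: the scalar product of its unit vector with the sum of the path is at
    most -1, and the norm of the total sum is at most [1 - 2 + 1]. *)
Lemma cycle_sum C e x y : pi_system R C -> linked dot C -> e \in R -> e \notin C ->
  (forall c, c \in C -> e != - c) -> (forall c, c \in C -> dot e c <= 0) ->
  x \in C -> y \in C -> x != y -> dot e x < 0 -> dot e y < 0 ->
  exists p, [/\ uniq p, {subset p <= C}
    & unit_of dot e + \sum_(c <- p) unit_of dot c = 0].
Proof.
move=> piC lC eR eC eN obt xC yC xy ex ey; have [CR fC _] := piC.
have [p [pp pl pu ps]] := linked_path lC xC yC.
have pC : {subset x :: p <= C} by move=> c; rewrite inE => /predU1P[->//|/ps].
exists (x :: p); split=> //; apply: (@dot_le0 _ _ dot).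
have cN c d : c \in C -> d \in C -> c != - d by exact: free_neq_opp.
have np : dot (\sum_(c <- x :: p) unit_of dot c) (\sum_(c <- x :: p) unit_of dot c) <= 1.
  apply: unit_path_norm => //.
  - by move=> c /pC/CR/(root_neq0 R_root).
  - by move=> c d /pC cC /pC dC; exact: (pi_obtuse R_root piC).
  - elim: p x {pl pu xC xy ex} pC pp {ps} => //= z p IH x pC /andP[xz zp].
    have xC := pC x (mem_head _ _); have zC : z \in C by rewrite pC // !inE eqxx orbT.
    by rewrite unit_bond ?CR ?cN //= IH // => c cp; rewrite pC // inE cp orbT.
set P := \sum_(c <- _) _ in np *.
rewrite !dotDl !dotDr unit_norm ?(root_neq0 R_root) // (dotC _ P).
suff : dot (unit_of dot e) P <= -1 by move: np; lra.
have yp : y \in p.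
  by have := mem_last x p; rewrite pl inE eq_sym (negPf xy).
rewrite /P big_cons dotDr (big_rem y) //= dotDr.
have := unit_bond eR (CR _ xC) ex (eN x xC); have := unit_bond eR (CR _ yC) ey (eN y yC).
suff : dot (unit_of dot e) (\sum_(c <- rem y p) unit_of dot c) <= 0 by lra.
rewrite dot_sumr big_seq; apply: sumr_le0 => c /mem_rem cp; apply: unit_obtuse.
by apply: obt; exact: ps.
Qed.

End Cycles.

Lemma count_lt (T : eqType) (p q : pred T) (s : seq T) t : subpred p q ->
  t \in s -> q t -> ~~ p t -> (count p s < count q s)%N.
Proof.
move=> pq + qt pt; elim: s => //= x s IH; rewrite inE => /predU1P[<-|/IH lt].
  by rewrite qt (negPf pt) add0n add1n ltnS sub_count.
rewrite -addnS leq_add //.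
by case px: (p x) => //; rewrite (pq _ px).
Qed.

Section Gram.
Variables (K : realType) (V : vectType K) (dot : {dot V for (@idfun K)}).

(** Integral linear combinations and their scalar products, in a form which can
    be evaluated when the Gram matrix [N / 2 * G] is explicit. *)
Definition lin (es : seq V) (xs : seq int) : V :=
  \sum_(i < size es) (xs`_i)%:~R *: es`_i.

Definition zsum (n : nat) (F : nat -> int) : int :=
  foldr (fun i acc => F i + acc) 0 (iota 0 n).

Lemma zsumE n F : zsum n F = \sum_(i < n) F i.
Proof. by rewrite /zsum -(big_mkord xpredT F) unlock /index_iota subn0. Qed.

Definition zform (n : nat) (G : nat -> nat -> int) (xs ys : seq int) : int :=
  zsum n (fun i => zsum n (fun j => xs`_i * ys`_j * G i j)).

Definition is_gram (N : K) (G : nat -> nat -> int) (es : seq V) :=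
  forall i j, (i < size es)%N -> (j < size es)%N ->
    dot es`_i es`_j = N / 2 * (G i j)%:~R.

Lemma dot_lin N G es xs ys : is_gram N G es ->
  dot (lin es xs) (lin es ys) = N / 2 * (zform (size es) G xs ys)%:~R.
Proof.
move=> gr; rewrite /zform zsumE rmorph_sum /= mulr_sumr dot_suml.
apply: eq_bigr => i _; rewrite zsumE rmorph_sum /= mulr_sumr dot_sumr.
apply: eq_bigr => j _; rewrite dotZl dotZr gr // !rmorphM /=; ring.
Qed.

Lemma lin_nth es xs (c : V -> K) : uniq es ->
  (forall i, (i < size es)%N -> c es`_i = (xs`_i)%:~R) ->
  \sum_(e <- es) c e *: e = lin es xs.
Proof.
by move=> ues h; rewrite (big_nth 0) big_mkord; apply: eq_bigr => i _; rewrite h.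
Qed.

Lemma dot_lin_single es xs v i : (i < size es)%N ->
  (forall j, (j < size es)%N -> j != i -> xs`_j != 0 -> dot v es`_j = 0) ->
  dot v (lin es xs) = (xs`_i)%:~R * dot v es`_i.
Proof.
move=> ilt h; rewrite dot_sumr (bigD1 (Ordinal ilt)) //= dotZr big1 ?addr0 // => j ji.
rewrite dotZr; have [->|xj] := eqVneq xs`_j 0; first by rewrite mul0r.
by rewrite h ?mulr0.
Qed.

(** As in [unit_path_norm], a new first vertex does not increase the norm: it
    adds at most [N], and the link to the next vertex subtracts at least [N]. *)
Lemma chain_norm N x l : uniq (x :: l) -> {in x :: l, forall y, dot y y <= N} ->
  {in x :: l &, forall y z, y != z -> dot y z <= 0} ->
  path (fun y z => 2 * dot y z <= - N) x l ->
  dot (\sum_(y <- x :: l) y) (\sum_(y <- x :: l) y) <= dot (last x l) (last x l).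
Proof.
elim: l x => [|z l IH] x; first by rewrite big_seq1.
rewrite cons_uniq => /andP[xl uzl] n0 obt /andP[xz zl].
have sub : {subset z :: l <= [:: x, z & l]} by move=> y yl; rewrite inE yl orbT.
have {}IH := IH z uzl (sub_in1 sub n0) (sub_in2 sub obt) zl.
rewrite big_cons dotDl !dotDr (dotC _ (\sum_(_ <- _) _) x) /=.
set P := \sum_(y <- _) _ in IH *.
have : 2 * dot x P <= - N.
  rewrite /P big_cons dotDr mulrDr -[leRHS]addr0 lerD // mulr_ge0_le0 // dot_sumr.
  rewrite big_seq; apply: sumr_le0 => y yl; apply: obt; rewrite ?inE ?eqxx ?yl ?orbT //.
  by apply: contraNneq xl => ->; rewrite inE yl orbT.
by have := n0 x (mem_head _ _); move: IH; rewrite /=; lra.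
Qed.

End Gram.

(** * The root system of type E8 *)

Section Labels.
Variables (K : realType) (V : vectType K) (dot : {dot V for (@idfun K)}).

Lemma labels_isomorphism (D : diagram) (B : seq V) (r : node D -> V) :
  injective r -> (forall i, r i \in B) -> (forall b, b \in B -> exists i, r i = b) ->
  (forall i j, i != j ->
    Num.truncn (cartan dot (r i) (r j) * cartan dot (r j) (r i)) = bond i j) ->
  (forall i : node D, bond i i = 0%N) ->
  (forall i j : node D,
    arrow i j = (0 < bond i j)%N && (dot (r j) (r j) < dot (r i) (r i))) ->
  exists f : node D -> node (dynkin_diagram dot B),
    isomorphism f /\ forall i, r i = val (f i).
Proof.
move=> injr rB surj bondr bond0 arrowr.
pose f i : node (dynkin_diagram dot B) := SeqSub (rB i).
have injf : injective f by move=> i j /(congr1 val) /= /injr.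
have linkE i j : @bond (dynkin_diagram dot B) (f i) (f j) = bond i j.
  rewrite /=; have [e|nij] := eqVneq (f i) (f j); first by rewrite (injf _ _ e) bond0.
  by rewrite bondr //; apply: contraNneq nij => ->.
exists f; split=> //; split.
  have /choice[g gK] (u : node (dynkin_diagram dot B)) : exists i, f i = u.
    by have [i ri] := surj (val u) (valP u); exists i; exact: val_inj.
  by exists g => [i|u]; [apply: injf|]; rewrite gK.
split=> // i j; rewrite arrowr -linkE.
by [].
Qed.

Lemma simple_bond x y (N : K) : 0 < N -> dot x x = N -> dot y y = N ->
  (dot x y = 0 -> Num.truncn (cartan dot x y * cartan dot y x) = 0%N) /\
  (dot x y = N / 2 * (-1)%:~R ->
    Num.truncn (cartan dot x y * cartan dot y x) = 1%N).
Proof.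
move=> N0 xN yN; rewrite /cartan xN yN (dotC _ y x); split=> ->.
  by rewrite mulr0 !mul0r truncn0.
by rewrite (_ : _ * _ = 1%:R) ?natrK //; field; rewrite gt_eqF.
Qed.

Lemma type_A_labels n (t : n.-tuple V) (C : seq V) (N : K) : 0 < N -> uniq t ->
  C =i t -> (forall i j, (i < n)%N -> (j < n)%N -> dot t`_i t`_j =
     N / 2 * (if i == j then 2 else if consecutive i j then -1 else 0 : int)%:~R) ->
  @labelled_by K V dot (type_A n) C (tnth t).
Proof.
move=> N0 ut Ct gt.
have tE (i : 'I_n) : tnth t i = t`_i by rewrite (tnth_nth 0).
have tN (i : 'I_n) : dot (tnth t i) (tnth t i) = N by rewrite tE gt // eqxx; field.
apply: labels_isomorphism.
- by move=> i j /eqP; rewrite !tE nth_uniq ?size_tuple // => /eqP/val_inj.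
- by move=> i; rewrite Ct mem_tnth.
- by move=> b; rewrite Ct => /tnthP[i ->]; exists i.
- move=> i j ij; have [h0 h1] := simple_bond N0 (tN i) (tN j).
  have := gt i j (ltn_ord i) (ltn_ord j); rewrite -!tE (negPf (ij : (i : nat) != j)) /=.
  by case: (consecutive i j) => e; [exact: h1|apply: h0; rewrite e mulr0].
- by move=> i /=; rewrite /consecutive gtn_eqF ?ltnSn.
- by move=> i j; rewrite !tN ltxx andbF.
Qed.

End Labels.

Section Unimodular.
Variables (K : realType) (V : vectType K) (dot : {dot V for (@idfun K)}).
Variables (R : seq V) (R_root : root_system dot R).
Variable (R_indec : indecomposable_root_system dot R).
Local Notation q x := (dot x x).

(** The Gram matrix of the vectors [a], [r2], ..., [r7], [b], where the [ri] are
    a path, [a] is linked to [r4], [b] is linked to [r2] and at an acute angle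
    to [a]. It has an integral inverse and even diagonal entries, so that these
    vectors generate a lattice of type E8. *)
Definition gram8 : seq (seq int) :=
  [:: [:: 2; 0; 0; -1; 0; 0; 0; 1]; [:: 0; 2; -1; 0; 0; 0; 0; -1];
      [:: 0; -1; 2; -1; 0; 0; 0; 0]; [:: -1; 0; -1; 2; -1; 0; 0; 0];
      [:: 0; 0; 0; -1; 2; -1; 0; 0]; [:: 0; 0; 0; 0; -1; 2; -1; 0];
      [:: 0; 0; 0; 0; 0; -1; 2; 0]; [:: 1; -1; 0; 0; 0; 0; 0; 2]].

Definition gram8_inv : seq (seq int) :=
  [:: [:: 8; 2; 7; 12; 9; 6; 3; -3]; [:: 2; 2; 3; 4; 3; 2; 1; 0];
      [:: 7; 3; 8; 12; 9; 6; 3; -2]; [:: 12; 4; 12; 20; 15; 10; 5; -4];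
      [:: 9; 3; 9; 15; 12; 8; 4; -3]; [:: 6; 2; 6; 10; 8; 6; 3; -2];
      [:: 3; 1; 3; 5; 4; 3; 2; -1]; [:: -3; 0; -2; -4; -3; -2; -1; 2]].

Definition entry (A : seq (seq int)) (i j : nat) : int := (nth [::] A i)`_j.

Let gram8_invP j k : (j < 8)%N -> (k < 8)%N ->
  zsum 8 (fun i => entry gram8_inv i j * entry gram8 i k) = (j == k)%:R.
Proof.
move=> j8 k8; have : all (fun j => all (fun k => zsum 8 (fun i => entry gram8_inv i j * entry gram8 i k) == (j == k)%:R) (iota 0 8)) (iota 0 8).
  by vm_compute.
by move=> /allP/(_ j)/[!mem_iota]/(_ j8)/allP/(_ k)/[!mem_iota]/(_ k8)/eqP.
Qed.

Let zform8_even m : exists k, zform 8 (entry gram8) m m = 2 * k.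
Proof.
rewrite /zform /zsum /entry /=; set m0 := m`_0; set m1 := m`_1; set m2 := m`_2.
set m3 := m`_3; set m4 := m`_4; set m5 := m`_5; set m6 := m`_6; set m7 := m`_7.
exists (m0 ^+ 2 + m1 ^+ 2 + m2 ^+ 2 + m3 ^+ 2 + m4 ^+ 2 + m5 ^+ 2 + m6 ^+ 2 + m7 ^+ 2
  - m0 * m3 + m0 * m7 - m1 * m2 - m1 * m7 - m2 * m3 - m3 * m4 - m4 * m5 - m5 * m6).
by ring.
Qed.

Variables (N : K) (f : seq V).
Hypotheses (N0 : 0 < N) (fR : {subset f <= R}) (f8 : size f = 8%N).
Hypothesis gramf : is_gram dot N (entry gram8) f.

(** As the inverse of the Gram matrix is integral, the projection of [v] is in
    the lattice, and its norm is an even multiple of [N / 2]. *)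
Lemma unimodular_projection v :
  (forall j, (j < 8)%N -> exists n : int, dot v f`_j = N / 2 * n%:~R) ->
  exists m (k : int), (forall j, (j < 8)%N -> dot (v - lin f m) f`_j = 0) /\
    q v = q (v - lin f m) + N * k%:~R.
Proof.
move=> vf; have /choice[n nE] (j : 'I_8) : exists n : int, dot v f`_j = N / 2 * n%:~R.
  exact: vf.
pose m := mkseq (fun i => \sum_(j < 8) entry gram8_inv i j * n j) 8.
have mf k : (k < 8)%N -> dot (lin f m) f`_k = dot v f`_k.
  move=> k8; rewrite dot_suml (nE (Ordinal k8)).
  have kf : (k < size f)%N by rewrite f8.
  have i8 (i : 'I_(size f)) : (i < 8)%N by case: i => i /=; rewrite f8.
  transitivity (\sum_(i < size f)
      N / 2 * ((\sum_(j < 8) entry gram8_inv i j * n j) * entry gram8 i k)%:~R).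
    apply: eq_bigr => i _; rewrite dotZl (gramf (ltn_ord i) kf) nth_mkseq //.
    by rewrite mulrCA rmorphM.
  rewrite -mulr_sumr -rmorph_sum /=; congr (_ * _%:~R).
  rewrite f8; under [LHS]eq_bigr do rewrite mulr_suml.
  rewrite exchange_big (bigD1 (Ordinal k8)) //= [X in _ + X]big1 ?addr0 => [|j jk].
    transitivity (n (Ordinal k8) * zsum 8 (fun i => entry gram8_inv i k * entry gram8 i k)).
      by rewrite zsumE mulr_sumr; apply: eq_bigr => i _; ring.
    by rewrite gram8_invP // eqxx mulr1.
  transitivity (n j * zsum 8 (fun i => entry gram8_inv i j * entry gram8 i k)).
    by rewrite zsumE mulr_sumr; apply: eq_bigr => i _; ring.
  by rewrite gram8_invP // (_ : (j : nat) == k = false) ?mulr0 //; apply/negbTE: jk.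
have [k kE] := zform8_even m; exists m, k.
have orth j : (j < 8)%N -> dot (v - lin f m) f`_j = 0.
  by move=> j8; rewrite dotDl dotNl mf // subrr.
split=> //; have ol : dot (v - lin f m) (lin f m) = 0.
  by rewrite dot_sumr big1 // => i _; rewrite dotZr orth ?mulr0 // -f8.
have ql : q (lin f m) = N * k%:~R.
  by rewrite (dot_lin m m gramf) f8 kE rmorphM /=; field.
have -> : q v = q (v - lin f m + lin f m) by rewrite subrK.
move: (v - lin f m) ol => w ol.
by rewrite dotDl !dotDr (dotC _ (lin f m) w) ol ql; ring.
Qed.

Let orth_lin v m : (forall j, (j < 8)%N -> dot v f`_j = 0) -> dot v (lin f m) = 0.
Proof. by move=> h; rewrite dot_sumr big1 // => i _; rewrite dotZr h ?mulr0 // -f8. Qed.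

Let f_norm j : (j < 8)%N -> q f`_j = N.
Proof.
move=> j8; rewrite gramf ?f8 // (_ : entry gram8 j j = 2) //; first by field.
by move: j j8; do 8! [case=> //].
Qed.

(** A root, or its coroot scaled to the shorter length, has its projection in
    the lattice. A projection other than 0 has at least norm [N], so that the
    root is orthogonal to the lattice or in the lattice, and then of norm [N].
    Indecomposability excludes the former. *)
Lemma unimodular_roots x : x \in R -> q x = N /\ exists m, x = lin f m.
Proof.
have fj j : (j < 8)%N -> f`_j \in R by move=> j8; rewrite fR ?mem_nth ?f8.
have small v c : (forall j, (j < 8)%N -> exists n : int, dot v f`_j = N / 2 * n%:~R) ->
    q v = c * N -> c < 1 -> forall j, (j < 8)%N -> dot v f`_j = 0.
  move=> vf qv c1; have [m [k [orth e]]] := unimodular_projection vf.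
  have ge := dot_ge0 dot (v - lin f m).
  have p0 : q (lin f m) = N * k%:~R.
    have : dot (v - lin f m) (lin f m) = 0 by exact: orth_lin.
    by move: e; rewrite !dotE (dotC _ (lin f m) v); lra.
  have k0 : k = 0.
    have : (0 : K) <= k%:~R by rewrite -(pmulr_rge0 _ N0) -p0 dot_ge0.
    have : (k%:~R : K) < 1 by rewrite -(ltr_pM2l N0); move: e ge c1 N0; nra.
    by rewrite ltrz1 ler0z; clear; lia.
  have l0 : lin f m = 0 by apply: (@dot_le0 _ _ dot); rewrite p0 k0 mulr0.
  by move=> j j8; rewrite -(orth j j8) l0 subr0.
have dich y : y \in R -> (forall j, (j < 8)%N -> dot y f`_j = 0) \/
    (q y = N /\ exists m, y = lin f m).
  move=> yR.
  have intN j : (j < 8)%N -> exists n : int, dot y f`_j = N / 2 * n%:~R.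
    move=> j8; have [n nE] := cartan_int R_root yR (fj j j8); exists n.
    by have := cartanE R_root y (fj j j8); rewrite nE f_norm //; lra.
  have scaled (c : K) : 1 < c -> q y = c * N -> forall j, (j < 8)%N -> dot y f`_j = 0.
    move=> c1 qy j j8; have c0 : 0 < c by apply: lt_trans c1.
    have cn : c != 0 by rewrite gt_eqF.
    suff : dot (c^-1 *: y) f`_j = 0.
      by rewrite dotZl => /eqP; rewrite mulf_eq0 invr_eq0 (negPf cn) => /eqP.
    apply: (small _ c^-1) j8.
    - move=> i i8; have [n nE] := cartan_int R_root (fj i i8) yR; exists n.
      have := cartanE R_root f`_i yR; rewrite nE qy dotZl (dotC _ _ y) => e.
      by apply: (mulfI cn); rewrite mulrA mulfV // mul1r; lra.
    - by rewrite dotZl dotZr qy mulKf.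
    - by rewrite invf_lt1.
  have N1 : 0 < N / 2 by rewrite divr_gt0.
  have [||| []] := norm_ratio R_root R_indec yR (fj 0%N isT); rewrite f_norm // => e.
  - have [m [k [orth qe]]] := unimodular_projection intN.
    have ge := dot_ge0 dot (y - lin f m).
    have [k1|k1] := eqVneq k 1.
      right; split=> //; exists m; apply/eqP; rewrite -subr_eq0; apply/eqP.
      by apply: (@dot_le0 _ _ dot); move: qe; rewrite e k1; lra.
    left; have l0 : lin f m = 0.
      apply: (@dot_le0 _ _ dot).
      have : q (lin f m) = N * k%:~R.
        have : dot (y - lin f m) (lin f m) = 0 by exact: orth_lin.
        by move: qe; rewrite !dotE (dotC _ (lin f m) y); lra.
      move=> ->; rewrite pmulr_rle0 // lerz0.
      have : (k%:~R : K) <= 1%:~R by rewrite -(ler_pM2l N0); move: qe ge e; lra.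
      by rewrite ler_int; move: k1; clear; lia.
    by move=> j j8; rewrite -(orth j j8) l0 subr0.
  - by left; apply: (scaled 2) => //; lra.
  - by left; apply: (small y 2^-1 intN); lra.
  - by left; apply: (scaled 3) => //; lra.
  - by left; apply: (small y 3^-1 intN); lra.
apply: (root_propagate R_indec (P := fun x => q x = N /\ exists m, x = lin f m) (fj 0%N isT)).
  split; first exact: f_norm.
  exists [:: 1]; rewrite /lin f8 big_ord_recl /= big1 ?addr0 ?scale1r // => i _.
  by rewrite /= nth_nil scale0r.
move=> y z yR zR [_ [m ->]] nz; have [h|//] := dich z zR.
by rewrite dotC; exact: orth_lin.
Qed.

(** The lattice generated by the roots is its own dual. *)
Lemma unimodular_int_span B v : root_basis R B ->
  (forall b, b \in B -> exists n : int, dot v b = N / 2 * n%:~R) -> int_span B v.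
Proof.
move=> BB vB; have fB := root_basis_free BB.
have fj j : (j < 8)%N -> f`_j \in R by move=> j8; rewrite fR ?mem_nth ?f8.
have [j j8|m [k [orth _]]] := @unimodular_projection v.
  have [z ->] := root_basis_int BB (fj j j8); rewrite dot_sumr big_seq.
  apply: (big_ind (fun r => exists n : int, r = N / 2 * n%:~R)).
  - by exists 0; rewrite mulr0.
  - by move=> _ _ [n ->] [n' ->]; exists (n + n'); rewrite rmorphD mulrDr.
  - move=> b bB; have [n nE] := vB b bB; exists (z b * n).
    by rewrite dotZr nE rmorphM mulrCA.
have w0 : v - lin f m = 0.
  apply: (@dot_le0 _ _ dot); set w := v - lin f m in orth *.
  have wB : w \in <<B>>%VS by rewrite (root_basis_span BB) memvf.
  rewrite {2}(crd_sum fB wB) dot_sumr big_seq big1 // => b bB; rewrite dotZr.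
  have [BR _ _] := BB; have [_ [m' ->]] := unimodular_roots (BR _ bB).
  by rewrite orth_lin ?mulr0.
have -> : v = lin f m by apply/eqP; rewrite -subr_eq0 w0.
rewrite /lin; elim/big_ind: _ => [||i _]; [exact: int_span0|exact: int_spanD|].
by apply: int_spanZ; apply: (root_basis_int BB); apply: fR; rewrite mem_nth.
Qed.

(** The Gram matrix of a path of seven nodes, preceded by a node which is linked
    to the nodes in the mask [n]. *)
Let star_gram (n : seq bool) (i j : nat) : int :=
  match i, j with
  | 0, 0 => 2
  | 0, k.+1 | k.+1, 0 => - (nat_of_bool (nth false n k))%:Z
  | i.+1, j.+1 => if i == j then 2 else if consecutive i j then -1 else 0
  end.

(** Up to the factor 8, the projection of the first node to the span of the
    path, by the inverse of the Gram matrix of type A7. *)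
Let star_dual (n : seq bool) : seq int := 8 :: mkseq (fun i =>
  zsum 7 (fun j => (nat_of_bool (nth false n j) * (minn i.+1 j.+1 * (8 - maxn i.+1 j.+1)))%N%:Z)) 7.

Fixpoint masks (k : nat) : seq (seq bool) :=
  if k is k'.+1 then [seq true :: m | m <- masks k'] ++ [seq false :: m | m <- masks k']
  else [:: [::]].

Let mem_masks n : n \in masks (size n).
Proof.
elim: n => // b n IH; rewrite mem_cat.
by case: b; rewrite (map_f (cons _)) ?orbT.
Qed.

(** The enumeration in [unimodular_type_E8]: an entry [col 0] which is positive
    and divides the coefficients only occurs if the first node is linked exactly
    to the third node from one end of the path, as in the diagram of type E8. *)
Let star_check (n : seq bool) : bool :=
  let xs := star_dual n in
  let col k := zsum 8 (fun i => xs`_i * star_gram n i k) in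
  all (fun k => col k == 0) (iota 1 7) &&
  (((0 < col 0%N) && all (fun i => col 0%N %| xs`_i)%Z (iota 0 8)) ==>
   ((n == [:: false; false; true; false; false; false; false])
    || (n == [:: false; false; false; false; true; false; false]))).

Let star_checked n : size n = 7%N -> star_check n.
Proof.
move=> n7; have := mem_masks n; rewrite n7.
have /allP h : all star_check (masks 7) by vm_compute.
exact: h.
Qed.

(** The basis consists of the path [d] and one more root [e], and it remains to
    find the nodes linked to [e]. With [z] orthogonal to the path and
    [dot z e = N / 2 * t], the vector [z / t] has integral scalar products with
    the basis. By unimodularity it is in the lattice, so that [t] divides the
    coefficients of [z]; this only holds for the diagram of type E8, as an
    enumeration of the masks shows. *)
Lemma unimodular_type_E8 B d : root_basis R B -> size B = 8%N -> uniq d ->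
  size d = 7%N -> {subset d <= B} ->
  (forall i j, (i < 7)%N -> (j < 7)%N -> dot d`_i d`_j =
     N / 2 * (if i == j then 2 else if consecutive i j then -1 else 0 : int)%:~R) ->
  root_system_of_type dot R type_E8.
Proof.
move=> BB B8 ud d7 dB gd; have fB := root_basis_free BB; have uB := free_uniq fB.
have [BR _ _] := BB; have piB := root_basis_pi R_root BB.
have [e eB ed] : exists2 e, e \in B & e \notin d.
  apply: contrapT => none; have : (size B <= size d)%N.
    apply: uniq_leq_size => // x xB; apply: contrapT => /negP xd.
    by apply: none; exists x.
  by rewrite B8 d7.
pose es := e :: d.
have ues : uniq es by rewrite /= ed.
have s8 : size es = 8%N by rewrite /= d7.
have permB : perm_eq B es.
  apply: uniq_perm => // x; apply/esym.
  have sub : {subset es <= B} by move=> y; rewrite inE => /predU1P[->//|/dB].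
  by have [|_ ->//] := uniq_min_size ues sub; rewrite s8 B8.
have esB i : (i < 8)%N -> es`_i \in B by move=> i8; rewrite (perm_mem permB) mem_nth ?s8.
pose n := mkseq (fun i => dot e d`_i != 0) 7.
have n7 : size n = 7%N by rewrite size_mkseq.
have ede i : (i < 7)%N -> dot e d`_i = N / 2 * (- (nat_of_bool (nth false n i))%:Z)%:~R.
  move=> i7; rewrite nth_mkseq //; have [->|ne0] := eqVneq; first by rewrite mulr0.
  have diB : d`_i \in B by apply/dB/mem_nth; rewrite d7.
  have edi : e != d`_i by apply: contraNneq ed => ->; apply: mem_nth; rewrite d7.
  have lt0 : dot e d`_i < 0 by rewrite lt_neqAle ne0 (pi_obtuse R_root piB).
  have [m [m' []]] := bond_norms R_root (BR _ eB) (BR _ diB) lt0 (free_neq_opp fB eB diB).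
  have [-> _] := unimodular_roots (BR _ eB); have [-> _] := unimodular_roots (BR _ diB).
  move=> h h'; have mm' : m = m'.
    apply/eqP; rewrite -(eqr_nat K); apply/eqP; apply: (mulIf (lt0r_neq0 N0)); lra.
  rewrite !inE !xpair_eqE mm' => /or4P[|||/orP[]] /andP[/eqP m1 /eqP m2]; try by move: m2; rewrite m1.
  by move: h; rewrite mm' m1 /= mulrN1z; lra.
have gr : is_gram dot N (star_gram n) es.
  move=> [|i] [|j]; rewrite s8 => i8 j8 /=.
  - by have [-> _] := unimodular_roots (BR _ eB); field.
  - exact: ede.
  - by rewrite dotC; exact: ede.
  - by rewrite gd.
have dot_col xs k : (k < 8)%N ->
    dot (lin es xs) es`_k = N / 2 * (zsum 8 (fun i => xs`_i * star_gram n i k))%:~R.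
  move=> k8; rewrite dot_suml s8 zsumE rmorph_sum mulr_sumr.
  apply: eq_bigr => i _; rewrite dotZl gr ?s8 // rmorphM /=; ring.
have /andP[/allP col0 /implyP fin] := star_checked n7.
set t := zsum 8 _ in fin; pose z := lin es (star_dual n).
have ze : dot z e = N / 2 * t%:~R by exact: (dot_col _ 0%N).
have zd k : (0 < k < 8)%N -> dot z es`_k = 0.
  case/andP=> k0 k8; have kin : k \in iota 1 7 by rewrite mem_iota k0.
  by rewrite dot_col // (eqP (col0 _ kin)) mulr0.
have crdz k : (k < 8)%N -> crd B z es`_k = ((star_dual n)`_k)%:~R.
  move=> k8; pose c x : K := ((star_dual n)`_(index x es))%:~R.
  have -> : z = \sum_(x <- B) c x *: x.
    rewrite (perm_big _ permB) (@lin_nth _ _ es (star_dual n)) // => i i8.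
    by rewrite /c index_uniq.
  by rewrite crdP ?esB // /c index_uniq ?s8.
have t0 : 0 < t.
  have : z != 0.
    apply/eqP => z0; have := crdz 0%N isT; rewrite z0 -(scale0r 0) crdZ mul0r /=.
    by move/eqP; rewrite eq_sym intr_eq0.
  move/(dot_gt0 dot); have -> : dot z z = 8 * dot z e.
    apply: (@dot_lin_single _ _ dot es (star_dual n) z 0); first by rewrite s8.
    by move=> j; rewrite s8 => j8 j0 _; rewrite zd // lt0n j0.
  by rewrite ze -(ltr0z K) mulrA pmulr_rgt0 // mulr_gt0 // divr_gt0.
have tn0 : t%:~R != 0 :> K by rewrite intr_eq0 gt_eqF.
have zt : int_span B (t%:~R^-1 *: z).
  apply: (unimodular_int_span BB) => b; rewrite (perm_mem permB) inE.
  move=> /predU1P[->|/(nthP 0)[i i7 <-]]; rewrite dotZl.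
    by exists 1; rewrite ze; field.
  by exists 0; rewrite -[d`_i]/(es`_(i.+1)) zd ?mulr0 //; rewrite d7 in i7.
have div k : (k < 8)%N -> (t %| (star_dual n)`_k)%Z.
  move=> k8; have := crd_int fB (esB k k8) zt; rewrite crdZ crdz // => /intrP[j jE].
  apply/dvdzP; exists j; apply/eqP; rewrite -(eqr_int K) rmorphM /= -jE.
  by apply/eqP; field.
move: fin; rewrite t0; have -> : all (fun i => t %| (star_dual n)`_i)%Z (iota 0 8).
  by apply/allP => i; rewrite mem_iota => /andP[_]; exact: div.
move=> /(_ isT) nE.
pose edge i j := ((i, j) \in E8_edges) || ((j, i) \in E8_edges).
have [sg [psg chk]] : exists sg : seq nat, perm_eq sg (iota 0 8) /\
    all (fun i => all (fun j => (i == j) || (star_gram n (nth 0%N sg i) (nth 0%N sg j) ==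
      - (nat_of_bool (edge i j))%:Z)) (iota 0 8)) (iota 0 8).
  case/orP: nE => /eqP->; [exists [:: 1; 0; 2; 3; 4; 5; 6; 7]%N | exists [:: 7; 0; 6; 5; 4; 3; 2; 1]%N];
  by split; vm_compute.
have ssg : size sg = 8%N by rewrite (perm_size psg).
have usg : uniq sg by rewrite (perm_uniq psg) iota_uniq.
have sg8 i : (i < 8)%N -> (nth 0%N sg i < 8)%N.
  move=> i8; have : nth 0%N sg i \in sg by rewrite mem_nth ?ssg.
  by rewrite (perm_mem psg) mem_iota.
pose r (i : 'I_8) := es`_(nth 0%N sg i).
have [||||||g [iso _]] := @labels_isomorphism _ _ dot type_E8 B r.
- move=> i j /eqP; rewrite /r nth_uniq ?s8 ?sg8 // nth_uniq ?ssg // => /eqP.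
  exact: val_inj.
- by move=> i; apply/esB/sg8.
- move=> b; rewrite (perm_mem permB) => bes.
  have : index b es \in sg by rewrite (perm_mem psg) mem_iota -s8 index_mem.
  move=> /(nthP 0%N)[i]; rewrite ssg => i8 e'; exists (Ordinal i8).
  by rewrite /r /= e' nth_index.
- move=> i j ij; have ij' : (i : nat) != j by [].
  have rB k : r k \in B by apply/esB/sg8.
  have [qi _] := unimodular_roots (BR _ (rB i)); have [qj _] := unimodular_roots (BR _ (rB j)).
  have [h0 h1] := simple_bond N0 qi qj.
  have : dot (r i) (r j) = N / 2 * (- (nat_of_bool (edge i j))%:Z)%:~R.
    rewrite /r gr ?s8 ?sg8 //; congr (_ * _%:~R).
    move: chk => /allP/(_ i)/[!mem_iota]/(_ (ltn_ord i))/allP/(_ j)/[!mem_iota]/(_ (ltn_ord j)).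
    by rewrite (negPf ij') => /eqP.
  rewrite /= -/(edge i j); case: (edge i j) => /= e'; first exact: h1.
  by apply: h0; rewrite e' mulr0.
- move=> i /=; have : all (fun i => ~~ edge i i) (iota 0 8) by vm_compute.
  move=> /allP/(_ i)/[!mem_iota]/(_ (ltn_ord i)).
  by rewrite /edge => /negbTE->.
- move=> i j /=; have rB k : r k \in B by apply/esB/sg8.
  have [-> _] := unimodular_roots (BR _ (rB i)); have [-> _] := unimodular_roots (BR _ (rB j)).
  by rewrite ltxx andbF.
by exists B, g.
Qed.

End Unimodular.

(** * Extended Dynkin diagrams *)

Section Walk.
Variables (K : realType) (V : vectType K) (dot : {dot V for (@idfun K)}).
Variables (R : seq V) (R_root : root_system dot R).
Variable (R_indec : indecomposable_root_system dot R).
Hypothesis no3 : forall s t, s \in R -> t \in R ->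
  cartan dot s t = -1 -> cartan dot t s = - 3 -> False.
Variables (C : seq V) (a : V).
Hypotheses (piC : pi_system R C) (lC : linked dot C).
Hypotheses (aR : a \in R) (aC : a \in <<C>>%VS) (aZ : ~ int_span C a).
Hypothesis aobt : forall c, c \in C -> dot a c <= 0.
Implicit Types (s t u v w x y z : V) (l : seq V).

Local Notation S := (a :: C).
Local Notation q x := (dot x x).

(** The linear relation between [a] and the elements of [C], normalized to have
    coefficient 1 at [a]. Up to a factor, these are the marks of an extended
    Dynkin diagram. *)
Definition mu x : K := if x == a then 1 else - crd C a x.

Definition nbrs s := [seq t <- S | dot s t < 0].

(** The contribution of [t] in the scalar product of the relation with [s]; see
    [node_eq]. *)
Definition con t s : K := - (2 * dot t s) / q s * mu t.

Let CR : {subset C <= R}. Proof. by case: piC. Qed.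

Let fC : free C. Proof. by case: piC. Qed.

Let uC : uniq C. Proof. exact: free_uniq. Qed.

Lemma aNC : a \notin C.
Proof. by apply/negP => h; apply: aZ; exact: int_span_id. Qed.

Lemma aNopp c : c \in C -> a != - c.
Proof.
by move=> cC; apply/eqP => e; apply: aZ; rewrite e; apply/int_spanN/int_span_id.
Qed.

Lemma SR : {subset S <= R}.
Proof. by move=> x; rewrite inE => /predU1P[->//|/CR]. Qed.

Lemma q_gt0 s : s \in S -> 0 < q s.
Proof. by move/SR/(root_gt0 R_root). Qed.

Lemma S_obtuse : {in S &, forall s t, s != t -> dot s t <= 0}.
Proof.
move=> s t; rewrite !inE => /predU1P[->|sC] /predU1P[->|tC]; rewrite ?eqxx //.
- by rewrite aobt.
- by rewrite dotC aobt.
- exact: (pi_obtuse R_root piC).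
Qed.

Lemma S_neq_opp s t : s \in S -> t \in S -> s != - t.
Proof.
rewrite !inE => /predU1P[->|sC] /predU1P[->|tC].
- apply/eqP => e; have := root_gt0 R_root aR; rewrite {1}e dotNl oppr_gt0.
  by rewrite ltNge dot_ge0.
- exact: aNopp.
- by rewrite eq_sym eqr_oppLR aNopp.
- exact: free_neq_opp fC sC tC.
Qed.

Lemma uniq_S : uniq S. Proof. by rewrite /= aNC. Qed.

Lemma mu_a : mu a = 1. Proof. by rewrite /mu eqxx. Qed.

Lemma mu_C c : c \in C -> mu c = - crd C a c.
Proof. by rewrite /mu; case: eqP => // -> /negPn; rewrite aNC. Qed.

Lemma mu_sum : \sum_(s <- S) mu s *: s = 0.
Proof.
rewrite big_cons mu_a scale1r {1}(crd_sum fC aC) big_seq [X in _ + X]big_seq -big_split.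
by rewrite big1 // => c cC /=; rewrite mu_C // scaleNr subrr.
Qed.

Lemma mem_nbrs s t : (t \in nbrs s) = (t \in S) && (dot s t < 0).
Proof. by rewrite mem_filter andbC. Qed.

Lemma nbrs_S s t : t \in nbrs s -> t \in S.
Proof. by rewrite mem_nbrs => /andP[]. Qed.

Lemma nbrs_sym s t : s \in S -> t \in nbrs s -> s \in nbrs t.
Proof. by move=> sS; rewrite !mem_nbrs sS dotC => /andP[]. Qed.

Lemma uniq_nbrs s : uniq (nbrs s). Proof. exact/filter_uniq/uniq_S. Qed.

Lemma node_eq s : s \in S -> \sum_(t <- nbrs s) con t s = 2 * mu s.
Proof.
move=> sS; have qs := q_gt0 sS.
have := congr1 (dot s) mu_sum; rewrite dot0r dot_sumr (bigD1_seq s) ?uniq_S //=.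
have -> : \sum_(t <- S | t != s) dot s (mu t *: t) = \sum_(t <- nbrs s) dot s (mu t *: t).
  rewrite big_filter big_mkcond [RHS]big_mkcond !big_seq; apply: eq_bigr => t tS /=.
  have [->|ts] := eqVneq t s; first by rewrite ltNge dot_ge0.
  have := S_obtuse sS tS; rewrite eq_sym ts le_eqVlt dotZr => /(_ isT)/predU1P[->|->//].
  by rewrite ltxx mulr0.
rewrite dotZr => e.
have -> : \sum_(t <- nbrs s) con t s = - 2 / q s * \sum_(t <- nbrs s) dot s (mu t *: t).
  rewrite mulr_sumr; apply: eq_bigr => t _; rewrite /con dotZr (dotC _ t).
  by field; rewrite gt_eqF.
have -> : \sum_(t <- nbrs s) dot s (mu t *: t) = - (mu s * q s) by move: e; lra.
by field; rewrite gt_eqF.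
Qed.

Lemma mu_ge0 s : s \in S -> 0 <= mu s.
Proof.
rewrite inE => /predU1P[->|]; first by rewrite mu_a ler01.
move=> sC; rewrite mu_C // oppr_ge0; move: s sC.
apply: (@obtuse_crd_le0 _ _ dot C) => //; first exact: (pi_obtuse R_root piC).
by move=> c cC; rewrite -crd_sum // aobt.
Qed.

Lemma con_ge0 s t : s \in S -> t \in nbrs s -> 0 <= con t s.
Proof.
move=> sS; rewrite mem_nbrs => /andP[tS st]; rewrite /con mulr_ge0 ?mu_ge0 //.
by rewrite divr_ge0 ?dot_ge0 // dotC; move: st; lra.
Qed.

(** If a mark is 0 then so are those of the neighbours, by the equation at this
    node, and hence all marks of [C]. *)
Lemma mu_gt0 s : s \in S -> 0 < mu s.
Proof.
rewrite inE => /predU1P[->|sC]; first by rewrite mu_a ltr01.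
rewrite lt_neqAle mu_ge0 ?inE ?sC ?orbT // andbT eq_sym; apply/negP => /eqP s0.
suff all0 c : c \in C -> mu c = 0.
  have := root_neq0 R_root aR; rewrite (crd_sum fC aC) big_seq big1 ?eqxx // => c cC.
  by rewrite -[crd _ _ _]opprK -mu_C // all0 // oppr0 scale0r.
move: c; apply: (lC sC s0) => x y xC yC x0 xy.
have xS : x \in S by rewrite inE xC orbT.
have yn : y \in nbrs x by rewrite mem_nbrs inE yC orbT.
have := node_eq xS; rewrite x0 mulr0 (big_rem y) //= => e.
have c0 : con y x = 0.
  have : 0 <= \sum_(t <- rem y (nbrs x)) con t x.
    by rewrite big_seq; apply: sumr_ge0 => t /mem_rem; exact: con_ge0.
  by have := con_ge0 xS yn; move: e; lra.
move/eqP: c0; rewrite /con !mulf_eq0 oppr_eq0 mulf_eq0 pnatr_eq0 invr_eq0.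
by rewrite dotC (lt_eqF xy) (gt_eqF (q_gt0 xS)) => /eqP.
Qed.

(** At a double bond, the shorter root receives twice the mark of the longer
    one. *)
Lemma con_bond s t : s \in S -> t \in nbrs s ->
  [\/ [/\ q t = q s, con t s = mu t, con s t = mu s & 2 * dot s t = - q s],
      [/\ q t = 2 * q s, con t s = 2 * mu t, con s t = mu s & dot s t = - q s]
    | [/\ q s = 2 * q t, con t s = mu t, con s t = 2 * mu s & dot s t = - q t]].
Proof.
move=> sS; rewrite mem_nbrs => /andP[tS st]; have qs := q_gt0 sS; have qt := q_gt0 tS.
rewrite /con (dotC _ t s).
have [[e1 e2]|[e1 e2]|[e1 e2]] :=
  root_bond R_root no3 (SR sS) (SR tS) st (S_neq_opp sS tS).
- constructor 1; rewrite -e1 in qt *; have -> : dot s t = - q s / 2 by move: e2; lra.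
  by split=> //; field; rewrite ?gt_eqF.
- constructor 3; rewrite e1 e2; by split=> //; field; rewrite ?gt_eqF.
- by constructor 2; rewrite e1 e2; split=> //; field; rewrite ?gt_eqF.
Qed.

Lemma nbrs_split s u : s \in S -> u \in nbrs s ->
  exists l, [/\ perm_eq (nbrs s) (u :: l),
    \sum_(t <- l) con t s = 2 * mu s - con u s & {subset l <= nbrs s}].
Proof.
move=> sS un; exists (rem u (nbrs s)); split; first exact: perm_to_rem.
  by rewrite -node_eq // [in RHS](big_rem u) //= addrAC subrr add0r.
by move=> t /mem_rem.
Qed.

Lemma con_le s t : s \in S -> t \in nbrs s -> con s t <= 2 * mu t.
Proof.
move=> sS tn; have tS := nbrs_S tn; have [l [_ e ln]] := nbrs_split tS (nbrs_sym sS tn).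
rewrite -subr_ge0 -e big_seq; apply: sumr_ge0 => r /ln; exact: con_ge0.
Qed.

Lemma con_gt0 s t : s \in S -> t \in nbrs s -> 0 < con t s.
Proof.
move=> sS tn; have := mu_gt0 (nbrs_S tn).
by case: (con_bond sS tn) => -[_ -> _ _]; lra.
Qed.

(** The contribution of [s] to [t] is at most twice the mark of [t]. *)
Lemma con_ge s t : s \in S -> t \in nbrs s -> mu s / 2 <= con t s.
Proof.
move=> sS tn; have := con_le sS tn; have := mu_gt0 sS.
by case: (con_bond sS tn) => -[_ -> -> _]; lra.
Qed.

Lemma leaf_of_con s t : s \in S -> t \in nbrs s -> con s t = 2 * mu t -> nbrs t = [:: s].
Proof.
move=> sS tn e; have tS := nbrs_S tn.
have [[|r l] [pl el ln]] := nbrs_split tS (nbrs_sym sS tn).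
  by apply: perm_small_eq => //.
have := con_gt0 tS (ln r (mem_head _ _)); move: el; rewrite e big_cons => el r0.
suff h : 0 <= \sum_(x <- l) con x t by exfalso; move: el r0 h; lra.
rewrite big_seq; apply: sumr_ge0 => x xl; apply: con_ge0 => //.
by apply: ln; rewrite inE xl orbT.
Qed.

(** On [C] the marks are the coordinates of [- a]. *)
Lemma not_all_int : ~ (forall c, c \in C -> mu c \is a Num.int).
Proof.
move=> h; apply: aZ; apply: int_span_crd => // c cC.
by rewrite -[crd _ _ _]opprK -mu_C // rpredN h.
Qed.

(** Along a cycle the marks are inversely proportional to the lengths, the cycle
    exhausts [C], and the node equations then force all lengths to be equal,
    that is, all marks to be 1. *)
Lemma a_one_nbr x y : x \in nbrs a -> y \in nbrs a -> x = y.
Proof.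
rewrite !mem_nbrs !inE => /andP[/predU1P[->|xC] ax]; first by rewrite ltNge dot_ge0 in ax.
move=> /andP[/predU1P[->|yC] ay]; first by rewrite ltNge dot_ge0 in ay.
apply: contrapT => /eqP xy.
have [p [up pC e]] := cycle_sum R_root piC lC aR aNC aNopp aobt xC yC xy ax ay.
have ra := sqrt_dot_gt0 dot (root_neq0 R_root aR).
pose r c : K := if c \in p then Num.sqrt (q a) / Num.sqrt (q c) else 0.
have rE : a = \sum_(c <- C) (- r c) *: c.
  have -> : a = Num.sqrt (q a) *: unit_of dot a.
    by rewrite /unit_of scalerA mulfV ?scale1r ?gt_eqF.
  have -> : unit_of dot a = - \sum_(c <- p) unit_of dot c.
    by apply/eqP; rewrite -addr_eq0 e.
  rewrite scalerN scaler_sumr -sumrN.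
  have -> : \sum_(c <- C) (- r c) *: c = \sum_(c <- C | c \in p) (- r c) *: c.
    rewrite [RHS]big_mkcond; apply: eq_bigr => c _; rewrite /r.
    by case: (c \in p) => //; rewrite oppr0 scale0r.
  have perm : perm_eq [seq c <- C | c \in p] p.
    apply: uniq_perm; rewrite ?filter_uniq // => c; rewrite mem_filter.
    by case cp : (c \in p) => //=; rewrite pC.
  rewrite -[RHS]big_filter (perm_big _ perm) !big_seq; apply: eq_bigr => c cp.
  by rewrite /r cp scaleNr /unit_of scalerA.
have muE c : c \in C -> mu c ^+ 2 * q c = q a.
  move=> cC; have c0 := root_gt0 R_root (CR cC); have := mu_gt0 (s := c).
  rewrite inE cC orbT mu_C // {1 2}rE (crdP (fun c => - r c)) // opprK /r.
  case: (c \in p) => [_|/(_ isT)]; last by rewrite ltxx.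
  by rewrite expr_div_n !sqr_sqrtr ?dot_ge0 // divfK // gt_eqF.
have {}muE c : c \in S -> mu c ^+ 2 * q c = q a.
  by rewrite inE => /predU1P[->|/muE//]; rewrite mu_a expr1n mul1r.
have eqlen s t : s \in S -> t \in nbrs s -> q t = q s -> mu t = mu s.
  move=> sS tn e'; have tS := nbrs_S tn; have := muE s sS; rewrite -(muE t tS) e'.
  move/(mulIf (lt0r_neq0 (q_gt0 sS)))/eqP; rewrite eqrXn2 ?(ltW (mu_gt0 _)) //.
  by move/eqP.
have sq14 (k m : K) : 0 < k -> 0 < m -> m ^+ 2 = 2 * k ^+ 2 -> 7 / 5 * k < m by nra.
have ge1 s t : s \in S -> t \in nbrs s -> mu s <= con t s.
  move=> sS tn; have tS := nbrs_S tn; have s0 := mu_gt0 sS; have t0 := mu_gt0 tS.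
  have qs := q_gt0 sS; have qt := q_gt0 tS; have := muE t tS; rewrite -(muE s sS).
  case: (con_bond sS tn) => -[eq -> _ _].
  - by rewrite (eqlen s t sS tn eq).
  - rewrite eq mulrA => /(mulIf (lt0r_neq0 qs)) h; have := sq14 (mu s) (2 * mu t).
    rewrite exprMn; have -> : 2 ^+ 2 * mu t ^+ 2 = 2 * mu s ^+ 2 by move: h; lra.
    by move=> /(_ s0); lra.
  - rewrite eq mulrA => /(mulIf (lt0r_neq0 qt)) h; have := sq14 (mu s) (mu t) s0 t0.
    by rewrite h; lra.
have eq2 s t : s \in S -> t \in nbrs s -> q t = q s.
  move=> sS tn; have tS := nbrs_S tn; have s0 := mu_gt0 sS; have t0 := mu_gt0 tS.
  have qs := q_gt0 sS; have qt := q_gt0 tS.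
  suff hi : q t != q s -> 7 / 5 * mu s < con t s /\ con t s < 2 * mu s.
    apply/eqP/negPn/negP => /hi[hi1 hi2].
    have [[|t' l] [_ el ln]] := nbrs_split sS tn.
      by move: el; rewrite big_nil; lra.
    have := ge1 s t' sS (ln t' (mem_head _ _)); move: el; rewrite big_cons.
    suff : 0 <= \sum_(j <- l) con j s by lra.
    rewrite big_seq; apply: sumr_ge0 => j jl; apply: con_ge0 => //.
    by apply: ln; rewrite inE jl orbT.
  have := muE t tS; rewrite -(muE s sS).
  case: (con_bond sS tn) => -[eq -> _ _]; first by rewrite eq eqxx.
  - rewrite eq mulrA => /(mulIf (lt0r_neq0 qs)) h _.
    split; last by nra.
    by apply: sq14 => //; [lra|move: h; rewrite exprMn; lra].
  - rewrite eq mulrA => /(mulIf (lt0r_neq0 qt)) h _.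
    by split; [apply: sq14 => //; move: h; lra|nra].
have step s t : s \in S -> t \in nbrs s -> mu t = mu s.
  by move=> sS tn; apply: eqlen => //; exact: eq2.
apply: not_all_int; apply: (lC (P := fun c => mu c \is a Num.int) xC).
  by rewrite (step a x) ?mu_a ?rpred1 ?mem_head // mem_nbrs inE xC orbT.
move=> s t sC tC sint st; rewrite (step s t) // ?mem_nbrs ?inE ?sC ?tC ?orbT //.
Qed.

(** The branch of the diagram behind [s], seen from [u], is the path [s :: l] of
    roots of equal length, along which the marks decrease by [d], down to [d]. *)
Fixpoint descent u s (d : K) l : Prop :=
  if l is t :: l' then
    [/\ perm_eq (nbrs s) [:: u; t], q t = q s, mu t = mu s - d & descent s t d l']
  else nbrs s = [:: u] /\ mu s = d.

(** A contribution larger than the mark leaves less for the other neighbours of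
    [s] than the lower bound [mu s / 2] for each would need, unless there is at
    most one other neighbour; and this one is in the same situation. *)
Lemma descentP u s : s \in S -> u \in nbrs s -> mu s < con u s ->
  exists l, descent u s (con u s - mu s) l.
Proof.
move: {2}(count (fun t => mu t < mu s) S).+1 (leqnn (count (fun t => mu t < mu s) S).+1) => n.
elim: n u s => // n IH u s; rewrite ltnS => cnt sS un us.
have [l [pl el ln]] := nbrs_split sS un.
case: l pl el ln => [|t [|t' l]] pl el ln.
- exists [::]; split; first exact: perm_small_eq.
  by move: el; rewrite big_nil; lra.
- have tn := ln t (mem_head _ _); have tS := nbrs_S tn.
  have lest := con_le sS tn; move: el; rewrite big_seq1 => el.
  have [[qt ct cs _]|[_ ct cs _]|[_ ct cs _]] := con_bond sS tn; try by move: lest us; lra.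
  have tu : mu t = mu s - (con u s - mu s) by move: el; lra.
  have [||||l dl] := IH s t.
  + apply: leq_trans cnt; apply: (count_lt (t := t)) => //.
    * by move=> r /= rt; apply: lt_trans rt _; rewrite tu; lra.
    * by rewrite tu; lra.
    * by rewrite ltxx.
  + exact: tS.
  + exact: nbrs_sym.
  + by rewrite cs tu; lra.
  exists (t :: l); split=> //; congr (descent _ _ _ _): dl.
  by rewrite cs tu; ring.
- have tn := ln t (mem_head _ _); have t'n : t' \in nbrs s by rewrite ln // !inE eqxx orbT.
  have := con_ge sS tn; have := con_ge sS t'n.
  suff : 0 <= \sum_(r <- l) con r s by move: el; rewrite !big_cons; lra.
  rewrite big_seq; apply: sumr_ge0 => r rl; apply: con_ge0 => //.
  by rewrite ln // !inE rl !orbT.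
Qed.

Lemma descent_size u s d l : descent u s d l -> mu s = (size l).+1%:R * d.
Proof.
elim: l u s => [|t l IH] u s /=; first by case=> _ ->; rewrite mul1r.
by case=> _ _ e /IH h; rewrite -natr1 mulrDl mul1r -h e; ring.
Qed.

(** The set [X] contains the nodes behind [s], seen from [u]: it can only be
    left by the link from [s] to [u]. *)
Definition integral_branch u s := exists X : V -> Prop,
  [/\ X s, forall x, X x -> mu x \is a Num.int
    & forall x y, X x -> y \in nbrs x -> X y \/ x = s /\ y = u].

Lemma integral_branch_node u s : mu s \is a Num.int ->
  (forall t, t \in nbrs s -> t = u \/ integral_branch s t) -> integral_branch u s.
Proof.
move=> sint br; exists (fun x => x = s \/ exists t, [/\ t \in nbrs s, t <> u
  & exists X : V -> Prop, [/\ X t, forall x, X x -> mu x \is a Num.int,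
      forall x y, X x -> y \in nbrs x -> X y \/ x = t /\ y = s & X x]]).
split; first by left.
- by move=> x [->//|[t [_ _ [X [_ Xint _ Xx]]]]]; exact: Xint.
- move=> x y [->|[t [tn tu [X [Xt Xint Xcl Xx]]]]] yn.
    have [//|nyu] := pselect (y = u); first by right.
    left; right; exists y; split=> //; case: (br y yn) => // -[X [Xy Xint Xcl]].
    by exists X.
  case: (Xcl x y Xx yn) => [Xy|[_ ->]]; last by left; left.
  by left; right; exists t; split=> //; exists X.
Qed.

Lemma descent_integral u s d l : descent u s d l -> mu s \is a Num.int ->
  d \is a Num.int -> integral_branch u s.
Proof.
move=> + + dint; elim: l u s => [|t l IH] u s /=.
  move=> [e _] sint; apply: integral_branch_node => // t.
  by rewrite e inE => /eqP; left.
move=> [e _ tE dl] sint; apply: integral_branch_node => // r.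
rewrite (perm_mem e) !inE => /orP[/eqP|/eqP->]; first by left.
by right; apply: IH dl _; rewrite tE rpredB.
Qed.

Lemma no_integral_branch p : p \in nbrs a -> ~ integral_branch a p.
Proof.
move=> pn [X [Xp Xint Xcl]]; apply: not_all_int => c cC; apply: Xint; move: c cC.
have pC : p \in C.
  by move: pn; rewrite mem_nbrs inE => /andP[/predU1P[->|//]]; rewrite ltNge dot_ge0.
apply: (lC pC Xp) => x y xC yC Xx xy.
have yn : y \in nbrs x by rewrite mem_nbrs inE yC orbT.
case: (Xcl x y Xx yn) => // -[_ ya].
by move: aNC; rewrite -ya yC.
Qed.

(** By connectedness the set [X] would contain [C]. *)
Lemma no_integral_set (X : V -> Prop) c : c \in C -> X c ->
  (forall x, X x -> mu x \is a Num.int) ->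
  ~ (forall x y, x \in S -> X x -> y \in nbrs x -> X y).
Proof.
move=> cC Xc Xint Xcl; apply: not_all_int => d dC; apply: Xint; move: d dC.
apply: (lC cC Xc) => x y xC yC Xx xy; apply: (Xcl x) => //; first by rewrite inE xC orbT.
by rewrite mem_nbrs inE yC orbT.
Qed.

(** If the mark equals the contribution of the previous node then it is passed
    on unchanged along a path, up to an end with a double bond or with two
    leaves of half that mark. *)
Lemma constant_node u s : s \in S -> u \in nbrs s -> con u s = mu s ->
  [\/ exists2 t, perm_eq (nbrs s) [:: u; t] & [/\ q t = q s, con s t = mu s & mu t = mu s],
      exists2 t, perm_eq (nbrs s) [:: u; t]
        & nbrs t = [:: s] /\ (q s = 2 * q t /\ mu t = mu s \/ q t = 2 * q s /\ 2 * mu t = mu s)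
    | exists x y, [/\ perm_eq (nbrs s) [:: u; x; y], nbrs x = [:: s] /\ nbrs y = [:: s],
        q x = q s /\ q y = q s & 2 * mu x = mu s /\ 2 * mu y = mu s]].
Proof.
move=> sS un us; have s0 := mu_gt0 sS.
have [l [pl el ln]] := nbrs_split sS un; rewrite us in el.
case: l pl el ln => [|t [|t' [|t'' l]]] pl el ln.
- by move: el; rewrite big_nil; lra.
- have tn := ln t (mem_head _ _); have lest := con_le sS tn.
  move: el; rewrite big_seq1 => el.
  have [[qt ct cs _]|[qt ct cs _]|[qt ct cs _]] := con_bond sS tn.
  + by constructor 1; exists t => //; split=> //; move: el; lra.
  + constructor 2; exists t => //; split; first by apply: leaf_of_con => //; move: el; lra.
    by right; split=> //; move: el; lra.
  + constructor 2; exists t => //; split; first by apply: leaf_of_con => //; move: el; lra.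
    by left; split=> //; move: el; lra.
- have tn := ln t (mem_head _ _); have t'n : t' \in nbrs s by rewrite ln // !inE eqxx orbT.
  have g1 := con_ge sS tn; have g2 := con_ge sS t'n.
  move: el; rewrite big_cons big_seq1 => el.
  have le1 := con_le sS tn; have le2 := con_le sS t'n.
  have [[qt ct cs _]|[qt ct cs _]|[qt ct cs _]] := con_bond sS tn; try by exfalso; move: le1 g2 el s0; lra.
  have [[qt' ct' cs' _]|[qt' ct' cs' _]|[qt' ct' cs' _]] := con_bond sS t'n;
    try by exfalso; move: le2 g1 el s0; lra.
  constructor 3; exists t, t'; split=> //.
  + by split; apply: leaf_of_con => //; move: el le1 le2; lra.
  + by split; move: el le1 le2; lra.
- exfalso; have tn := ln t (mem_head _ _).
  have t'n : t' \in nbrs s by rewrite ln // !inE eqxx orbT.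
  have t''n : t'' \in nbrs s by rewrite ln // !inE eqxx !orbT.
  have := con_ge sS tn; have := con_ge sS t'n; have := con_ge sS t''n.
  suff : 0 <= \sum_(r <- l) con r s by move: el s0; rewrite !big_cons; lra.
  rewrite big_seq; apply: sumr_ge0 => r rl; apply: con_ge0 => //.
  by rewrite ln // !inE rl !orbT.
Qed.

(** The marks would be 2 along the path, and 2 or 1 at its ends. *)
Lemma no_constant_two u s : s \in S -> u \in nbrs s -> con u s = 2 -> mu s <> 2.
Proof.
move=> sS un us s2.
have sC : s \in C.
  by move: sS s2; rewrite inE => /predU1P[->|//]; rewrite mu_a; lra.
pose A x := x \in S /\ mu x = 2 /\ exists2 y, y \in nbrs x & con y x = 2.
apply: (@no_integral_set (fun x => A x \/ (mu x \is a Num.int /\ exists2 y, A y & nbrs x = [:: y])) s) => //.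
- by left; split=> //; split=> //; exists u.
- by move=> x [[_ [-> _]]|[]//]; exact: rpred_nat.
move=> x y xS [[_ [x2 [v vn vx]]]|[_ [z Az ->]]] yn; last first.
  by left; move: yn; rewrite inE => /eqP->.
have Ax : A x by split=> //; split=> //; exists v.
have int1 t : 2 * mu t = 2 -> mu t \is a Num.int.
  by move=> e; have -> : mu t = 1 by lra.
have back : A v \/ mu v \is a Num.int /\ exists2 y, A y & nbrs v = [:: y].
  have vS := nbrs_S vn; have [[_ ct cs _]|[_ ct cs _]|[_ ct cs _]] := con_bond xS vn.
  - left; split=> //; split; first by rewrite -ct.
    by exists x; [exact: nbrs_sym|rewrite cs].
  - right; split; first by apply: int1; rewrite -ct.
    by exists x => //; apply: leaf_of_con => //; move: ct cs vx x2; lra.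
  - right; split; first by rewrite -ct vx rpred_nat.
    by exists x => //; apply: leaf_of_con => //; move: ct cs vx x2; lra.
have [] := constant_node xS vn (etrans vx (esym x2)).
- move=> [t e [_ ct ut]]; move: yn; rewrite (perm_mem e) !inE => /orP[/eqP->//|/eqP->].
  left; have tn : t \in nbrs x by rewrite (perm_mem e) !inE eqxx orbT.
  split; first exact: nbrs_S tn.
  by split; [rewrite ut|exists x; [exact: nbrs_sym|rewrite ct]].
- move=> [t e [lt ut]]; move: yn; rewrite (perm_mem e) !inE => /orP[/eqP->//|/eqP->].
  right; split; last by exists x.
  by case: ut => -[_]; [move->; rewrite x2 rpred_nat|rewrite x2; exact: int1].
- move=> [t [t' [e [lt lt'] _ [ut ut']]]]; move: yn; rewrite (perm_mem e) !inE.
  by case/or3P=> /eqP->; [|right; split; [apply: int1; lra|exists x]..].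
Qed.

Lemma nbrs_a p : p \in nbrs a -> nbrs a = [:: p].
Proof.
move=> pn; have aS := mem_head a C; have [[|r l] [pl _ ln]] := nbrs_split aS pn.
  exact: perm_small_eq.
have rp := a_one_nbr pn (ln r (mem_head _ _)).
by have := uniq_nbrs a; rewrite (perm_uniq pl) /= rp mem_head.
Qed.

Lemma con_a p : p \in nbrs a -> con p a = 2.
Proof.
move=> pn; have := node_eq (mem_head a C).
by rewrite (nbrs_a pn) big_seq1 mu_a mulr1.
Qed.

Lemma nbr_a_C p : p \in nbrs a -> p \in C.
Proof.
rewrite mem_nbrs inE => /andP[/predU1P[->|//]].
by rewrite ltNge dot_ge0.
Qed.

Lemma a_has_nbr : exists p, p \in nbrs a.
Proof.
have := node_eq (mem_head a C); rewrite mu_a.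
case: (nbrs a) => [|p l _]; last by exists p; exact: mem_head.
by rewrite big_nil; lra.
Qed.

(** If [a] is shorter than its neighbour then the marks are 1 along a path of
    long roots which ends in a fork with two leaves of mark 1/2: this is the
    extended diagram of type B, and [a] is its short root. A double bond at the
    other end would lead to integral marks or to a third length. *)
Lemma short_end p : p \in nbrs a -> q p = 2 * q a ->
  exists u v x y, [/\ perm_eq (nbrs v) [:: u; x; y],
    v \in C /\ (q v = 2 * q a /\ mu v = 1),
    nbrs x = [:: v] /\ nbrs y = [:: v],
    [/\ q x = q v, q y = q v, 2 * mu x = 1 & 2 * mu y = 1]
    & u = a \/ u \in C /\ q u = q v].
Proof.
move=> pn qp; have aS := mem_head a C; have pC := nbr_a_C pn.
have pS := nbrs_S pn; have a0 := q_gt0 aS.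
apply: contrapT => none.
have ap := nbrs_sym aS pn.
have [p1 cap] : mu p = 1 /\ con a p = 1.
  have := con_a pn; case: (con_bond aS pn) => -[qe cp ca _]; try by exfalso; move: qe qp a0; lra.
  by rewrite cp ca mu_a; split=> //; lra.
pose A x := [/\ x \in S, mu x = 1, q x = 2 * q a
  & exists2 y, y \in nbrs x & con y x = 1 /\ (y = a \/ q y = q x)].
apply: (@no_integral_set (fun x => A x \/ (mu x \is a Num.int /\
    (x = a \/ exists2 y, A y & nbrs x = [:: y]))) p) => //.
- by left; split=> //; exists a => //; split=> //; left.
- by move=> x [[_ -> _ _]|[]//]; exact: rpred1.
have Ap : A p by split=> //; exists a => //; split=> //; left.
move=> x y xS [Ax|[_ [->|[z Az ->]]]] yn; last first.
- by left; move: yn; rewrite inE => /eqP->.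
- by left; move: yn; rewrite (nbrs_a pn) inE => /eqP->.
have [_ x1 qx [v vn [vx va]]] := Ax.
have xC : x \in C.
  by move: xS qx; rewrite inE => /predU1P[->|//]; move: a0; lra.
have back : A v \/ mu v \is a Num.int /\ (v = a \/ exists2 y, A y & nbrs v = [:: y]).
  case: va => [->|qv]; first by right; rewrite mu_a; split; [exact: rpred1|left].
  have vS := nbrs_S vn; have x0 := q_gt0 xS.
  have [[_ ct cs _]|[e _ _ _]|[e _ _ _]] := con_bond xS vn; try by exfalso; move: e qv x0; lra.
  left; split; rewrite ?qv // -?ct //; exists x; first exact: nbrs_sym.
  by rewrite cs; split=> //; right.
have [] := constant_node xS vn (etrans vx (esym x1)).
- move=> [t e [qt ct ut]]; move: yn; rewrite (perm_mem e) !inE => /orP[/eqP->//|/eqP->].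
  left; have tn : t \in nbrs x by rewrite (perm_mem e) !inE eqxx orbT.
  split; rewrite ?qt ?ut //; first exact: nbrs_S tn.
  by exists x; [exact: nbrs_sym|rewrite ct; split=> //; right].
- move=> [t e [lt ut]]; move: yn; rewrite (perm_mem e) !inE => /orP[/eqP->//|/eqP->].
  have tn : t \in nbrs x by rewrite (perm_mem e) !inE eqxx orbT.
  right; split; last by right; exists x.
  case: ut => -[qt ut]; first by rewrite ut x1 rpred1.
  have x0 := q_gt0 xS; exfalso.
  apply: (two_lengths R_root R_indec aR (SR xS) (SR (nbrs_S tn))).
    by rewrite qx; move: a0; lra.
  by rewrite qt; move: x0; lra.
- move=> [t [t' [e lt [qt qt'] [ut ut']]]]; case: none; exists v, x, t, t'; split=> //.
    by split; rewrite ?ut ?ut'.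
  case: va => [->|qv]; first by left.
  right; split=> //; move: (nbrs_S vn); rewrite inE => /predU1P[va|//].
  by move: qv; rewrite va qx; move: a0; lra.
Qed.

(** A step along the path whose marks are 1, 2, 3 and so on from [a]. *)
Lemma ascent_node u s (k : nat) : (2 <= k)%N -> s \in S -> u \in nbrs s ->
  mu s = k%:R -> con u s = k%:R - 1 -> [\/
    exists2 t, perm_eq (nbrs s) [:: u; t] & [/\ q t = q s, mu t = k%:R + 1 & con s t = k%:R],
    exists2 t, perm_eq (nbrs s) [:: u; t]
      & [/\ q s = 2 * q t, mu t = k%:R + 1 & con s t = 2 * k%:R],
    exists2 t, perm_eq (nbrs s) [:: u; t]
      & [/\ q t = 2 * q s, mu t = (k%:R + 1) / 2 & con s t = k%:R]
  | (exists x y, [/\ perm_eq (nbrs s) [:: u; x; y], q x = q s, q y = q s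
      & [/\ mu x + mu y = k%:R + 1, con s x = k%:R, con s y = k%:R, k%:R <= 2 * mu x & k%:R <= 2 * mu y]])
    \/ integral_branch u s ].
Proof.
move=> k2 sS un sk us.
have k2' : 2 <= k%:R :> K by rewrite ler_nat.
have sint : mu s \is a Num.int by rewrite sk rpred_nat.
have leaf_br t : nbrs t = [:: s] -> mu t \is a Num.int -> integral_branch s t.
  by move=> e ti; apply: integral_branch_node => // r; rewrite e inE => /eqP; left.
have [l [pl el ln]] := nbrs_split sS un; rewrite us sk in el.
have int1 t : mu t = 1 -> mu t \is a Num.int by move=> ->; exact: rpred1.
have int2 t : mu t = 2 -> mu t \is a Num.int by move=> ->; exact: rpred_nat.
case: l pl el ln => [|t [|t' [|t'' l]]] pl el ln.
- by move: el; rewrite big_nil; lra.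
- have tn := ln t (mem_head _ _); move: el; rewrite big_seq1 => el.
  have [[qt ct cs _]|[qt ct cs _]|[qt ct cs _]] := con_bond sS tn.
  + by constructor 1; exists t => //; split=> //; rewrite ?cs // -ct el; ring.
  + by constructor 3; exists t => //; split; rewrite ?cs //; move: el; rewrite ct; lra.
  + by constructor 2; exists t => //; split; rewrite ?cs ?sk // -ct el; ring.
- have tn := ln t (mem_head _ _); have t'n : t' \in nbrs s by rewrite ln // !inE eqxx orbT.
  have g1 := con_ge sS tn; have g2 := con_ge sS t'n; rewrite sk in g1 g2.
  move: el; rewrite big_cons big_seq1 => el.
  have le1 := con_le sS tn; have le2 := con_le sS t'n.
  have both : 2 * mu t = con s t -> 2 * mu t' = con s t' -> mu t = 1 \/ mu t = 2 ->
      mu t' = 1 \/ mu t' = 2 -> integral_branch u s.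
    move=> e e' i i'; apply: integral_branch_node => // r.
    rewrite (perm_mem pl) !inE => /or3P[]/eqP->; [by left|right|right].
    - by apply: leaf_br; [exact: leaf_of_con|case: i; [exact: int1|exact: int2]].
    - by apply: leaf_br; [exact: leaf_of_con|case: i'; [exact: int1|exact: int2]].
  have [[qt ct cs _]|[qt ct cs _]|[qt ct cs _]] := con_bond sS tn;
  have [[qt' ct' cs' _]|[qt' ct' cs' _]|[qt' ct' cs' _]] := con_bond sS t'n;
    rewrite sk in cs cs'; constructor 4;
    (try by exfalso; move: ct ct' cs cs' el g1 g2 le1 le2 k2'; lra);
    first [by left; exists t, t'; split=> //; split; rewrite ?cs ?cs' //;
              move: ct ct' cs cs' el le1 le2; lra
          |right; apply: both; (try by move: ct ct' cs cs' el g1 g2 le1 le2 k2'; lra);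
           first [by left; move: ct ct' cs cs' el g1 g2 le1 le2 k2'; lra
                 |by right; move: ct ct' cs cs' el g1 g2 le1 le2 k2'; lra]].
- have tn := ln t (mem_head _ _).
  have t'n : t' \in nbrs s by rewrite ln // !inE eqxx orbT.
  have t''n : t'' \in nbrs s by rewrite ln // !inE eqxx !orbT.
  have g := con_ge sS tn; have g' := con_ge sS t'n; have g'' := con_ge sS t''n.
  have le := con_le sS tn; have le' := con_le sS t'n; have le'' := con_le sS t''n.
  rewrite sk in g g' g''.
  case: l pl el ln => [|r l] pl el ln; last first.
    exfalso; have rn : r \in nbrs s by rewrite ln // !inE eqxx !orbT.
    have g3 := con_ge sS rn; rewrite sk in g3.
    suff : 0 <= \sum_(r <- l) con r s by move: el k2'; rewrite !big_cons; lra.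
    rewrite big_seq; apply: sumr_ge0 => x xl; apply: con_ge0 => //.
    by rewrite ln // !inE xl !orbT.
  move: el; rewrite !big_cons big_nil => el; constructor 4; right.
  apply: integral_branch_node => // r; rewrite (perm_mem pl) !inE => rin.
  have kk : con t s = 1 /\ con t' s = 1 /\ con t'' s = 1 /\ (k%:R = 2 :> K).
    by move: el k2'; do !split; lra.
  case: kk => t1 [t'1 [t''1 k22]].
  have leaf r' : r' \in nbrs s -> con r' s = 1 -> con s r' <= 2 * mu r' -> integral_branch s r'.
    move=> rn r1 ler; have [[_ ct cs _]|[_ ct cs _]|[_ ct cs _]] := con_bond sS rn;
    rewrite sk in cs; try by exfalso; move: ct cs r1 ler k22; lra.
    apply: leaf_br; first by apply: leaf_of_con => //; move: ct cs r1 k22; lra.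
    by apply: int1; move: ct r1; lra.
  by case/or4P: rin => /eqP->; [left|right; exact: leaf..].
Qed.

(** The solutions of [1 / k + 1 / m + 1 / n = 1] are the permutations of
    [(3, 3, 3)], [(2, 4, 4)] and [(2, 3, 6)], the lengths of the arms of the
    extended diagrams of type E6, E7 and E8. *)
Let unit_fractions (k m n : nat) : (2 <= k)%N -> (2 <= m)%N -> (2 <= n)%N ->
  (k * (m + n) = (k - 1) * (m * n))%N ->
  [\/ (m %| k)%N && (n %| k)%N, k = 2 /\ ((m, n) \in [:: (4, 4); (3, 6); (6, 3)])%N
    | k = 3 /\ ((m, n) \in [:: (2, 6); (6, 2)])%N].
Proof.
wlog mn : m n / (m <= n)%N => [wl k2 m2 n2 e|k2 m2 n2 e].
  have [mn|/ltnW nm] := leqP m n; first exact: wl.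
  have [|nk|[kE mnE]|[kE mnE]] := wl n m nm k2 n2 m2; first by move: e; clear; nia.
  - by constructor 1; rewrite andbC.
  - by constructor 2; split=> //; move: mnE; rewrite !inE !xpair_eqE; clear; lia.
  - by constructor 3; split=> //; move: mnE; rewrite !inE !xpair_eqE; clear; lia.
have m4 : (m <= 4)%N.
  rewrite leqNgt; apply/negP => m5.
  have h1 : ((k - 1) * (5 * n) <= (k - 1) * (m * n))%N by rewrite leq_mul2l leq_mul2r m5 !orbT.
  have h2 : (k * (m + n) <= k * (2 * n))%N by rewrite leq_mul2l; apply/orP; right; lia.
  by move: e h1 h2 k2 n2; clear; nia.
have : [|| m == 2, m == 3 | m == 4]%N by move: m2 m4; clear; lia.
case/or3P => /eqP mE; move: mn e; rewrite mE => mn e.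
- have k3 : (3 <= k)%N by move: k2 e; clear; nia.
  have k6 : (k <= 6)%N.
    rewrite leqNgt; apply/negP => k7.
    have nlt3 : (n < 3)%N by move: e k7; clear; nia.
    by move: e mn k7 nlt3; clear; nia.
  have : [|| k == 3, k == 4, k == 5 | k == 6]%N by move: k3 k6; clear; lia.
  case/or4P => /eqP kE; move: e; rewrite kE => e.
  + by constructor 3; split=> //; rewrite (_ : n = 6) //; move: e; clear; lia.
  + by constructor 1; rewrite (_ : n = 4) //; move: e; clear; lia.
  + by exfalso; move: e; clear; lia.
  + by constructor 1; rewrite (_ : n = 3) //; move: e; clear; lia.
- have k3 : (k <= 3)%N by move: e mn; clear; nia.
  have /orP[] : (k == 2)%N || (k == 3)%N by move: k2 k3; clear; lia.
    move=> /eqP kE; move: e; rewrite kE => e.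
    by constructor 2; split=> //; rewrite (_ : n = 6) //; move: e; clear; lia.
  move=> /eqP kE; move: e; rewrite kE => e.
  by constructor 1; rewrite (_ : n = 3) //; move: e; clear; lia.
- have kE : k = 2 by move: e mn k2; clear; nia.
  constructor 2; split=> //; rewrite (_ : n = 4) //; move: e; rewrite kE; clear; lia.
Qed.

(** The diagram branches at [s] into two paths of [m] and [n] nodes, both
    counted with [s], along which the marks decrease by constant steps. *)
Definition fork u s (m n : nat) := exists x y lx ly,
  [/\ perm_eq (nbrs s) [:: u; x; y], q x = q s /\ q y = q s,
      size lx = m.-2 /\ size ly = n.-2,
      mu x = mu s - mu s / m%:R /\ mu y = mu s - mu s / n%:R
    & descent s x (mu s / m%:R) lx /\ descent s y (mu s / n%:R) ly].

Lemma forkC u s m n : fork u s m n -> fork u s n m.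
Proof.
move=> [x [y [lx [ly [e [qx qy] [sx sy] [mx my] [dx dy]]]]]].
exists y, x, ly, lx; split=> //; rewrite (perm_trans e) //.
by rewrite perm_cons (perm_catC [:: x] [:: y]).
Qed.

(** Both branches descend, by steps of [k / m] and [k / n], so that the equation
    at [s] is [1 / k + 1 / m + 1 / n = 1]. *)
Lemma fork_node u s (k : nat) x y : (2 <= k)%N -> s \in S -> mu s = k%:R ->
  perm_eq (nbrs s) [:: u; x; y] -> q x = q s -> q y = q s ->
  mu x + mu y = k%:R + 1 -> con s x = k%:R -> con s y = k%:R ->
  k%:R <= 2 * mu x -> k%:R <= 2 * mu y ->
  [\/ integral_branch u s, k = 2 /\ (fork u s 4 4 \/ fork u s 3 6)
    | k = 3 /\ fork u s 2 6].
Proof.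
move=> k2 sS sk e qx qy xy cx cy hx hy; have k2' : 2 <= k%:R :> K by rewrite ler_nat.
have xn : x \in nbrs s by rewrite (perm_mem e) !inE eqxx orbT.
have yn : y \in nbrs s by rewrite (perm_mem e) !inE eqxx !orbT.
have xS := nbrs_S xn; have yS := nbrs_S yn.
have sx := nbrs_sym sS xn; have sy := nbrs_sym sS yn.
have lt z w : z \in S -> s \in nbrs z -> con s z = k%:R -> mu z + mu w = k%:R + 1 ->
    k%:R <= 2 * mu w -> mu z < k%:R.
  move=> zS sz cz zw hw; rewrite ltNge; apply/negP => kz.
  have [z2 kk] : mu z = 2 /\ k%:R = 2 :> K by move: k2' kz zw hw; split; lra.
  by apply: (no_constant_two zS sz) => //; rewrite cz.
have ltx := lt x y xS sx cx xy hy.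
have lty : mu y < k%:R by apply: (lt y x) => //; rewrite addrC.
have := descentP xS sx; rewrite cx => /(_ ltx)[lx dx].
have := descentP yS sy; rewrite cy => /(_ lty)[ly dy].
have arm z l : descent s z (k%:R - mu z) l -> mu z < k%:R ->
    k%:R - mu z = k%:R / (size l).+2%:R.
  move=> /descent_size ez zk; rewrite -natr1; have n0 : (size l).+1%:R + 1 != 0 :> K.
    by rewrite natr1 pnatr_eq0.
  by apply: (mulIf n0); rewrite divfK // mulrDr mulr1 mulrC -ez; ring.
have ex := arm x lx dx ltx; have ey := arm y ly dy lty.
set m := (size lx).+2 in ex; set n := (size ly).+2 in ey.
have m0 : (m%:R != 0 :> K) by rewrite pnatr_eq0.
have n0 : (n%:R != 0 :> K) by rewrite pnatr_eq0.
have forkE : fork u s m n.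
  exists x, y, lx, ly; split=> //; rewrite sk -ex -ey //.
  by split; ring.
have eqn : (k * (m + n) = (k - 1) * (m * n))%N.
  apply/eqP; rewrite -(eqr_nat K) !natrM natrD natrB ?(ltnW k2) //.
  have : k%:R / m%:R + k%:R / n%:R = k%:R - 1 :> K by rewrite -ex -ey; move: xy; lra.
  by move=> h; rewrite -h; apply/eqP; field; rewrite m0 n0.
have [] := @unit_fractions k m n k2 isT isT eqn.
- case/andP => mk nk; constructor 1; apply: integral_branch_node; first by rewrite sk rpred_nat.
  have int_div (j : nat) : (j %| k)%N -> (j%:R != 0 :> K) -> k%:R / j%:R \is a @Num.int K.
    by move=> /dvdnP[i ->] j0; rewrite natrM mulfK // rpred_nat.
  have xi := int_div m mk m0; have yi := int_div n nk n0.
  move=> r; rewrite (perm_mem e) !inE => /or3P[]/eqP->; [by left|right|right].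
  + apply: descent_integral dx _ _; rewrite ?ex //.
    by rewrite (_ : mu x = k%:R - k%:R / m%:R) ?rpredB ?rpred_nat //; move: ex; lra.
  + apply: descent_integral dy _ _; rewrite ?ey //.
    by rewrite (_ : mu y = k%:R - k%:R / n%:R) ?rpredB ?rpred_nat //; move: ey; lra.
- move=> [kE]; rewrite !inE !xpair_eqE => mn; constructor 2; split=> //.
  move: mn forkE => /or3P[] /andP[/eqP-> /eqP->] h; [by left|by right|right].
  exact: forkC.
- move=> [kE]; rewrite !inE !xpair_eqE => mn; constructor 3; split=> //.
  by move: mn forkE => /orP[] /andP[/eqP-> /eqP->] h; [|exact: forkC].
Qed.

(** The increasing path ends, as there are finitely many nodes. From the mark 3
    on, a double bond at its end gives integral marks. *)
Lemma ascent u s (k : nat) : (3 <= k)%N -> s \in S -> u \in nbrs s ->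
  mu s = k%:R -> con u s = k%:R - 1 -> integral_branch u s \/ (k = 3 /\ fork u s 2 6).
Proof.
move: {2}(count (fun t => mu s < mu t) S).+1 (leqnn (count (fun t => mu s < mu t) S).+1) => n.
elim: n u s k => // n IH u s k; rewrite ltnS => cnt k3 sS un sk us.
have k2 : (2 <= k)%N by exact: ltnW.
have k3' : 3 <= k%:R :> K by rewrite ler_nat.
have sint : mu s \is a Num.int by rewrite sk rpred_nat.
have one t : perm_eq (nbrs s) [:: u; t] -> integral_branch s t -> integral_branch u s.
  move=> e br; apply: integral_branch_node => // r.
  by rewrite (perm_mem e) !inE => /orP[]/eqP->; [left|right].
have mem t : perm_eq (nbrs s) [:: u; t] -> t \in nbrs s.
  by move=> e; rewrite (perm_mem e) !inE eqxx orbT.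
have [[t e [qt mt ct]]|[t e [qt mt ct]]|[t e [qt mt ct]]|] := ascent_node k2 sS un sk us.
- have tn := mem t e; have tS := nbrs_S tn.
  have [||||||br|[kE _]] := IH s t k.+1.
  + apply: leq_trans cnt; apply: (count_lt (t := t)) => //; rewrite ?ltxx //.
      by move=> r /= rt; apply: lt_trans rt; rewrite mt sk; lra.
    by rewrite mt sk; lra.
  + exact: leqW.
  + exact: tS.
  + exact: nbrs_sym.
  + by rewrite mt natr1.
  + by rewrite ct -natr1; ring.
  + by left; apply: one br.
  + by move: kE k3; clear; lia.
- have tn := mem t e; have tS := nbrs_S tn; have st := nbrs_sym sS tn.
  have := descentP tS st; rewrite ct mt => /(_ _)[|l dl]; first by move: k3'; lra.
  left; apply: (one t e); apply: descent_integral dl _ _.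
    by rewrite mt rpredD ?rpred_nat ?rpred1.
  by rewrite rpredB ?rpredM ?rpredD ?rpred_nat ?rpred1.
- have tn := mem t e; have tS := nbrs_S tn; have st := nbrs_sym sS tn.
  have := descentP tS st; rewrite ct mt => /(_ _)[|l dl]; first by move: k3'; lra.
  have sz := descent_size dl; rewrite mt in sz.
  have {}sz : (k + 1 = (size l).+1 * (k - 1))%N.
    apply/eqP; rewrite -(eqr_nat K) natrM natrD natrB ?(ltnW k2) //.
    by apply/eqP; move: sz; lra.
  have kE : k = 3 by move: sz k3; case: (size l) => [|[|j]]; clear; nia.
  left; apply: (one t e); apply: descent_integral dl _ _; rewrite ?mt kE.
    by rewrite (_ : _ / 2 = 2%:R) ?rpred_nat //; lra.
  by rewrite (_ : _ - _ = 1) ?rpred1 //; lra.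
- move=> [[x [y [e qx qy [xy cx cy hx hy]]]]|]; last by left.
  have [|[kE _]|] := fork_node k2 sS sk e qx qy xy cx cy hx hy; [by left| |by right].
  by move: k3; rewrite kE.
Qed.

(** Apart from the case of [short_end], the diagrams of [a :: C] with marks that
    are not all integral are the extended diagrams of type E7, E8, E8 and F4,
    where [a] is an end node of mark 2, 3, 2 and 2, respectively. So the type of
    [C] is A7, A8, D8 or B4. *)
Lemma affine_shapes p : p \in nbrs a -> q p = 2 * q a \/
  [/\ q p = q a, mu p = 2 & [\/ fork a p 4 4, fork a p 3 6,
    exists2 v, perm_eq (nbrs p) [:: a; v] & [/\ q v = q p, mu v = 3 & fork p v 2 6]
  | exists t u z, [/\ perm_eq (nbrs p) [:: a; t], perm_eq (nbrs t) [:: p; u],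
      perm_eq (nbrs u) [:: t; z] /\ nbrs z = [:: u],
      [/\ q t = 2 * q p, q u = q t & q z = q u]
      & [/\ mu t = 3 / 2, mu u = 1 & mu z = 1 / 2]]]].
Proof.
move=> pn; have aS := mem_head a C; have pS := nbrs_S pn.
have ap := nbrs_sym aS pn; have ca := con_a pn.
have [[qp cp cap _]|[qp _ _ _]|[qp cp cap _]] := con_bond aS pn; [right|by left|]; last first.
  by exfalso; apply: (no_constant_two pS ap); rewrite ?cap ?mu_a ?mulr1 // -cp.
have p2 : mu p = 2 by rewrite -cp.
have cap1 : con a p = 2%:R - 1 by rewrite cap mu_a; lra.
have no_br : ~ integral_branch a p by exact: no_integral_branch.
have pint : mu p \is a Num.int by rewrite p2 rpred_nat.
have one t : perm_eq (nbrs p) [:: a; t] -> integral_branch p t -> False.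
  move=> e br; apply: no_br; apply: integral_branch_node => // r.
  by rewrite (perm_mem e) !inE => /orP[]/eqP->; [left|right].
have mem t : perm_eq (nbrs p) [:: a; t] -> t \in nbrs p.
  by move=> e; rewrite (perm_mem e) !inE eqxx orbT.
split=> //.
have [[t e [qt mt ct]]|[t e [qt mt ct]]|[t e [qt mt ct]]|] := @ascent_node a p 2 isT pS ap p2 cap1.
- have tn := mem t e; have tS := nbrs_S tn.
  have [||||br|[_ fk]] := @ascent p t 3 isT.
  + exact: tS.
  + exact: nbrs_sym.
  + by rewrite mt; lra.
  + by rewrite ct; lra.
  + by case: (one t).
  + by constructor 3; exists t => //; split=> //; rewrite mt; lra.
- have tn := mem t e; have tS := nbrs_S tn; have st := nbrs_sym pS tn.
  have := descentP tS st; rewrite ct mt => /(_ _)[|l dl]; first by lra.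
  case: (one t e); apply: descent_integral dl _ _.
    by rewrite mt rpredD ?rpred_nat ?rpred1.
  by rewrite rpredB ?rpredM ?rpredD ?rpred_nat ?rpred1.
- have tn := mem t e; have tS := nbrs_S tn; have st := nbrs_sym pS tn.
  have := descentP tS st; rewrite ct mt => /(_ _)[|l dl]; first by lra.
  have sz := descent_size dl; rewrite mt in sz.
  have {}sz : size l = 2.
    have e1 : (size l).+1%:R = (size l)%:R + 1 :> K by rewrite natr1.
    by apply/eqP; rewrite -(eqr_nat K); apply/eqP; move: sz; rewrite e1; lra.
  constructor 4; case: l sz dl => [|u [|z []]] // _ /= [e1 qu mu_u [e2 qz mu_z [e3 _]]].
  by exists t, u, z; split=> //; split=> //; move: mt mu_u mu_z; lra.
- move=> [[x [y [e qx qy [xy cx cy hx hy]]]]|//].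
  have [//|[_ [fk|fk]]|[//]] := @fork_node a p 2 x y isT pS p2 e qx qy xy cx cy hx hy.
    by constructor 1.
  by constructor 2.
Qed.

(** An explicit list [es] of nodes with the positions of their neighbours, to
    obtain the Gram matrix by computation. *)
Definition table (es : seq V) (adj : seq (seq nat)) :=
  [/\ uniq es, {subset es <= S}, all (all (fun j => j < size es)%N) adj,
    size adj = size es
  & forall i, (i < size es)%N ->
      perm_eq (nbrs es`_i) [seq es`_j | j <- nth [::] adj i]].

Definition table_gram (adj : seq (seq nat)) (i j : nat) : int :=
  if i == j then 2 else if j \in nth [::] adj i then -1 else 0.

Lemma table_cover es adj c : table es adj -> c \in C -> c \in es -> {subset C <= es}.
Proof.
move=> [_ _ lt sz nb] cC ces d dC; move: d dC.
apply: (lC (P := fun d => d \in es) cC) => // x y xC yC xes xy.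
have yn : y \in nbrs x by rewrite mem_nbrs inE yC orbT.
have ix : (index x es < size es)%N by rewrite index_mem.
move: yn; rewrite -(nth_index 0 xes) (perm_mem (nb _ ix)) => /mapP[j jadj ->].
rewrite mem_nth //; move/allP: lt => /(_ (nth [::] adj (index x es))).
by rewrite mem_nth ?sz // => /(_ isT)/allP/(_ j jadj).
Qed.

Lemma table_is_gram es adj N : table es adj ->
  (forall i, (i < size es)%N -> q es`_i = N) -> is_gram dot N (table_gram adj) es.
Proof.
move=> [ues sub lt sz nb] qN i j ilt jlt; rewrite /table_gram.
have [<-|ij] := eqVneq i j; first by rewrite qN //; field.
have eS k : (k < size es)%N -> es`_k \in S by move=> klt; exact/sub/mem_nth.
have nij : es`_i != es`_j by rewrite nth_uniq.
have memE : (es`_j \in nbrs es`_i) = (j \in nth [::] adj i).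
  rewrite (perm_mem (nb i ilt)); apply/mapP/idP => [[k kadj e]|]; last by exists j.
  have klt : (k < size es)%N.
    move/allP: lt => /(_ (nth [::] adj i)); rewrite mem_nth ?sz // => /(_ isT).
    by move/allP/(_ k kadj).
  by move/eqP: e; rewrite nth_uniq // => /eqP->.
rewrite -memE; case jn : (es`_j \in nbrs es`_i).
  have := q_gt0 (eS i ilt); case: (con_bond (eS i ilt) jn) => -[e _ _ d] i0.
  - by move: d; rewrite qN //; lra.
  - by move: e i0; rewrite !qN //; lra.
  - by move: e i0; rewrite !qN //; lra.
rewrite mulr0; apply/eqP; rewrite eq_le (S_obtuse (eS i ilt) (eS j jlt) nij) /=.
by rewrite leNgt; apply/negP => ijlt; move: jn; rewrite mem_nbrs eS // ijlt.
Qed.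

Lemma dot_same s t : s \in S -> t \in nbrs s -> q t = q s -> 2 * dot s t = - q s.
Proof.
move=> sS tn ts; have := q_gt0 sS; have := q_gt0 (nbrs_S tn); move: ts.
by case: (con_bond sS tn) => -[]; lra.
Qed.

Lemma dot_longer s t : s \in S -> t \in nbrs s -> q t = 2 * q s -> dot s t = - q s.
Proof.
move=> sS tn ts; have := q_gt0 sS; have := q_gt0 (nbrs_S tn); move: ts.
by case: (con_bond sS tn) => -[]; lra.
Qed.

Section Outside.
Variable b : V.
Hypotheses (bR : b \in R) (bC : b \notin <<C>>%VS).
Hypothesis bobt : forall c, c \in C -> dot b c <= 0.
Hypothesis blink : exists2 c, c \in C & dot b c < 0.

Lemma bNopp c : c \in C -> b != - c.
Proof.
by move=> cC; apply: contraNneq bC => ->; rewrite rpredN memv_span.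
Qed.

(** If [b] were linked to two nodes then it would be in the span of a cycle. *)
Lemma b_node : exists r, [/\ r \in C, dot b r < 0
  & forall c, c \in C -> c != r -> dot b c = 0].
Proof.
have [r rC br] := blink; exists r; split=> // c cC cr.
apply/eqP; rewrite eq_le bobt //= leNgt; apply/negP => bc.
have bNC : b \notin C by apply: contra bC; exact: memv_span.
have [p [_ pC e]] := cycle_sum R_root piC lC bR bNC bNopp bobt cC rC cr bc br.
have rb := sqrt_dot_gt0 dot (root_neq0 R_root bR).
case/negP: bC; have -> : b = Num.sqrt (q b) *: unit_of dot b.
  by rewrite /unit_of scalerA mulfV ?scale1r ?gt_eqF.
have -> : unit_of dot b = - \sum_(c <- p) unit_of dot c.
  by apply/eqP; rewrite -addr_eq0 e.
rewrite scalerN rpredN rpredZ // big_seq; apply: memv_suml => d dp.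
by rewrite /unit_of memvZ // memv_span // pC.
Qed.

Section Node.
Variable r : V.
Hypotheses (rC : r \in C) (br : dot b r < 0).
Hypothesis bother : forall c, c \in C -> c != r -> dot b c = 0.

(** The scalar product of the relation with [b]. *)
Lemma dot_b_a : dot b a = - (mu r * dot b r).
Proof.
have := congr1 (dot b) mu_sum; rewrite dot0r big_cons mu_a scale1r dotDr dot_sumr.
rewrite (bigD1_seq r) //= dotZr big_seq_cond big1 ?addr0; first by lra.
by move=> c /andP[cC cr]; rewrite dotZr bother // mulr0.
Qed.

Let bond_r : [\/ q b = q r /\ 2 * dot b r = - q r,
    q b = 2 * q r /\ dot b r = - q r | q r = 2 * q b /\ dot b r = - q b].
Proof. by have := root_bond R_root no3 bR (CR rC) br (bNopp rC). Qed.

Let bond_a : [\/ q b = q a /\ 2 * dot b a = q a,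
    q b = 2 * q a /\ dot b a = q a | q a = 2 * q b /\ dot b a = q b].
Proof.
have ba : b != - - a by rewrite opprK; apply: contraNneq bC => ->.
have neg : dot b (- a) < 0.
  by rewrite dotNr dot_b_a opprK pmulr_rlt0 // mu_gt0 // inE rC orbT.
have := root_bond R_root no3 bR (root_opp R_root aR) neg ba.
rewrite dotNr dotNl dotNr opprK.
case=> -[e1 e2]; [constructor 1|constructor 2|constructor 3]; split=> //; lra.
Qed.

(** By [dot_b_a] the mark of [r] is the ratio of the scalar products of [b] with
    [- a] and [r]. Both are determined by the length of [b] if [- a] and [r]
    have the same length. *)
Lemma b_bond_same : q r = q a -> mu r = 1 /\
  [\/ q b = q r /\ 2 * dot b r = - q r,
    q b = 2 * q r /\ dot b r = - q r | q r = 2 * q b /\ dot b r = - q b].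
Proof.
move=> ra; split=> //; have a0 := q_gt0 (mem_head a C); have b0 := root_gt0 R_root bR.
have e := dot_b_a; apply: (mulIf (x := dot b r)); first by rewrite lt_eqF.
by case: bond_r => -[e1 e2]; case: bond_a => -[e3 e4]; lra.
Qed.

(** The same comparison when [r] is longer than [a]. *)
Lemma b_bond_long : q r = 2 * q a ->
  [/\ q b = q r, 2 * dot b r = - q r & mu r = 1] \/
  [/\ q b = q a, dot b r = - q b & mu r = 2^-1].
Proof.
move=> ra; have a0 := q_gt0 (mem_head a C); have b0 := root_gt0 R_root bR.
have e := dot_b_a; have d0 : dot b r != 0 by rewrite lt_eqF.
case: bond_r => -[e1 e2]; case: bond_a => -[e3 e4]; try by exfalso; lra.
- by left; split=> //; apply: (mulIf d0); lra.
- by right; split=> //; apply: (mulIf d0); lra.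
Qed.

(** A vector of the span which is orthogonal to all nodes except [r] is a
    multiple of the projection of [b], which must be shorter than [b]. *)
Lemma no_outside w (k m : K) : w \in <<C>>%VS -> q r = q a ->
  dot b w = k * dot b r -> q w = m * q r -> 0 < m -> 4 * m <= k ^+ 2 -> False.
Proof.
move=> wC ra bw qw m0 km; have r0 := root_gt0 R_root (CR rC).
have [_ h] := b_bond_same ra.
pose v := m *: b - (k * dot b r / q r) *: w.
have v0 : v != 0.
  apply: contraNneq bC => /eqP; rewrite subr_eq0 => /eqP e.
  by rewrite -[b]scale1r -(mulVf (lt0r_neq0 m0)) -scalerA e !rpredZ.
have := dot_gt0 dot v0; rewrite /v !dotE (dotC _ w b) bw qw.
set t := k * dot b r; set X := (X in 0 < X -> _).
have -> : X = m * (m * q b - t ^+ 2 / q r) by rewrite /X; field; rewrite gt_eqF.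
rewrite pmulr_rgt0 // subr_gt0 ltr_pdivrMr // /t.
suff : m * q b * q r <= (k * dot b r) ^+ 2 by lra.
have rr : 0 <= q r ^+ 2 by rewrite exprn_ge0 // ltW.
have mr : 0 <= (k ^+ 2 - 4 * m) * q r ^+ 2 by rewrite mulr_ge0 // subr_ge0.
have mm : 0 <= m * q r ^+ 2 by rewrite mulr_ge0 // ltW.
case: h => -[e1 e2]; rewrite exprMn.
- by rewrite e1 (_ : dot b r = - q r / 2) //; lra.
- by rewrite e1 e2 sqrrN; lra.
- by rewrite e2 (_ : q b = q r / 2) ?sqrrN //; lra.
Qed.

Lemma table_no_outside es adj xs j (m : int) : table es adj ->
  (forall i, (i < size es)%N -> q es`_i = q a) -> es`_0 = a -> (j < size es)%N ->
  es`_j = r -> xs`_0 = 0 ->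
  zform (size es) (table_gram adj) xs xs = 2 * m -> 0 < m -> 4 * m <= xs`_j ^+ 2 ->
  False.
Proof.
move=> tab qa e0 jlt ej x0 xx m0 mx; have [ues sub _ _ _] := tab.
have gr := table_is_gram tab qa.
have esC i : (i < size es)%N -> i != 0%N -> es`_i \in C.
  move=> ilt i0; have := sub _ (mem_nth 0 ilt); rewrite inE -{1}e0 nth_uniq //.
    by rewrite (negPf i0).
  by apply: leq_trans ilt.
apply: (@no_outside (lin es xs) (xs`_j)%:~R m%:~R).
- apply: memv_suml => i _; have [i0|i0] := eqVneq (i : nat) 0%N.
    by rewrite i0 x0 scale0r mem0v.
  by rewrite memvZ // memv_span // esC.
- by rewrite -ej qa.
- rewrite (dot_lin_single (i := j)) ?ej // => i ilt ij xi.
  apply: bother; last by rewrite -ej nth_uniq.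
  by apply: esC => //; apply: contraNneq xi => ->; rewrite x0.
- by rewrite (dot_lin xs xs gr) xx rmorphM /= -ej qa //; field.
- by rewrite ltr0z.
- by rewrite -rmorphXn /= -(intrM K 4 m) ler_int.
Qed.

End Node.

Let marks_neq (c : K) s t m n : c * mu s = m%:R -> c * mu t = n%:R ->
  (m != n)%N -> s != t.
Proof.
by move=> sm tn; apply: contraNneq => st; rewrite -(eqr_nat K) -sm -tn st.
Qed.

(** The only node with mark 1 is [y3], so [b] is linked to it. The coefficients
    in the last step are proportional to those of the projection of [b] to the
    span of [C]. *)
Lemma exclude_A8 p : p \in nbrs a -> q p = q a -> mu p = 2 -> fork a p 3 6 -> False.
Proof.
move=> pn qp p2 [x1 [y1 [lx [ly [e [qx1 qy1] [sx sy] [mx1 my1] [dx dy]]]]]].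
rewrite p2 in mx1 my1 dx dy.
case: lx sx dx => [|x2 []] // _ /= [ex1 qx2 mx2 [ex2 _]].
case: ly sy dy => [|y2 [|y3 [|y4 [|y5 []]]]] // _ /=.
move=> [ey1 qy2 my2 [ey2 qy3 my3 [ey3 qy4 my4 [ey4 qy5 my5 [ey5 _]]]]].
have aS := mem_head a C; have pS := nbrs_S pn.
have mem s l : perm_eq (nbrs s) l -> {subset l <= S}.
  by move=> el t; rewrite -(perm_mem el) => /nbrs_S.
have [x1S y1S] : x1 \in S /\ y1 \in S by split; apply: (mem _ _ e); rewrite !inE eqxx ?orbT.
have x2S : x2 \in S by apply: (mem _ _ ex1); rewrite !inE eqxx ?orbT.
have y2S : y2 \in S by apply: (mem _ _ ey1); rewrite !inE eqxx ?orbT.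
have y3S : y3 \in S by apply: (mem _ _ ey2); rewrite !inE eqxx ?orbT.
have y4S : y4 \in S by apply: (mem _ _ ey3); rewrite !inE eqxx ?orbT.
have y5S : y5 \in S by apply: (mem _ _ ey4); rewrite !inE eqxx ?orbT.
have va : 6 * mu a = 6%:R by rewrite mu_a mulr1.
have vp : 6 * mu p = 12%:R by rewrite p2; lra.
have vx1 : 6 * mu x1 = 8%:R by rewrite mx1; lra.
have vx2 : 6 * mu x2 = 4%:R by rewrite mx2; move: vx1; lra.
have vy1 : 6 * mu y1 = 10%:R by rewrite my1; lra.
have vy2 : 6 * mu y2 = 8%:R by rewrite my2; move: vy1; lra.
have vy3 : 6 * mu y3 = 6%:R by rewrite my3; move: vy2; lra.
have vy4 : 6 * mu y4 = 4%:R by rewrite my4; move: vy3; lra.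
have vy5 : 6 * mu y5 = 2%:R by rewrite my5; move: vy4; lra.
have ne := marks_neq (c := 6).
(* Only three pairs of nodes have equal marks. *)
have x1y2 : x1 != y2.
  apply: contraTneq (nbrs_sym pS _ : p \in nbrs x1) => [->|]; last first.
    by rewrite (perm_mem e) !inE eqxx orbT.
  by rewrite (perm_mem ey2) !inE negb_or (ne _ _ _ _ vp vy1) // (ne _ _ _ _ vp vy3).
have x2y4 : x2 != y4.
  apply/eqP => e'; have : y3 \in nbrs y4.
    by apply: (nbrs_sym y3S); rewrite (perm_mem ey3) !inE eqxx orbT.
  by rewrite -e' ex2 inE; apply/negP; exact: ne vy3 vx1 isT.
have ay3 : a != y3.
  apply/eqP => e'; move: (pn); rewrite e' (perm_mem ey3) !inE.
  by apply/negP; rewrite negb_or (ne _ _ _ _ vp vy2) // (ne _ _ _ _ vp vy4).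
have tab : table [:: a; x2; x1; p; y1; y2; y3; y4; y5]
    [:: [:: 3]; [:: 2]; [:: 3; 1]; [:: 0; 2; 4]; [:: 3; 5]; [:: 4; 6]; [:: 5; 7]; [:: 6; 8]; [:: 7]]%N.
  split=> //.
  - rewrite /= !inE !negb_or; repeat (apply/andP; split=> //);
      by eapply ne; [eassumption|eassumption|].
  - by apply/allP; rewrite /= aS x2S x1S pS y1S y2S y3S y4S y5S.
  - by case=> [|[|[|[|[|[|[|[|[|]]]]]]]]] //= _; rewrite ?(nbrs_a pn) ?ex2 ?ey5.
have pC := nbr_a_C pn; have [r [rC br bother]] := b_node.
have : p \in [:: a; x2; x1; p; y1; y2; y3; y4; y5] by rewrite !inE eqxx !orbT.
move=> /(table_cover tab pC) CE.
have qE i : (i < 9)%N -> q [:: a; x2; x1; p; y1; y2; y3; y4; y5]`_i = q a.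
  by case: i => [|[|[|[|[|[|[|[|[|]]]]]]]]] //= _;
     rewrite ?qy5 ?qy4 ?qy3 ?qy2 ?qy1 ?qx2 ?qx1.
have ry3 : r = y3.
  have ra : q r = q a by have /(nthP 0)[i ilt <-] := CE r rC; exact: qE.
  have [r1 _] := b_bond_same rC br bother ra.
  have vr : 6 * mu r = 6%:R by rewrite r1 mulr1.
  have nr z n : 6 * mu z = n%:R -> (6 != n)%N -> (r == z) = false.
    by move=> vz n6; apply/negbTE; exact: ne vr vz n6.
  have nra : (r == a) = false by apply: contraNF aNC => /eqP<-.
  have := CE r rC; rewrite !inE nra (nr _ _ vx2) // (nr _ _ vx1) // (nr _ _ vp) //.
  rewrite (nr _ _ vy1) // (nr _ _ vy2) // (nr _ _ vy4) // (nr _ _ vy5) //=.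
  by rewrite orbF => /eqP.
by apply: (@table_no_outside r rC br bother _ _ [:: 0; 1; 2; 3; 4; 5; 6; 4; 2] 6 9 tab qE).
Qed.

(** As in [exclude_A8]; the only node with mark 1 is [y4]. *)
Lemma exclude_D8 p v : p \in nbrs a -> q p = q a -> mu p = 2 ->
  perm_eq (nbrs p) [:: a; v] -> q v = q p -> mu v = 3 -> fork p v 2 6 -> False.
Proof.
move=> pn qp p2 ep qv v3 [x [y1 [lx [ly [e [qx qy1] [sx sy] [mx my1] [dx dy]]]]]].
rewrite v3 in mx my1 dx dy.
case: lx sx dx => [|//] _ /= [ex _].
case: ly sy dy => [|y2 [|y3 [|y4 [|y5 []]]]] // _ /=.
move=> [ey1 qy2 my2 [ey2 qy3 my3 [ey3 qy4 my4 [ey4 qy5 my5 [ey5 _]]]]].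
have aS := mem_head a C; have pS := nbrs_S pn.
have mem s l : perm_eq (nbrs s) l -> {subset l <= S}.
  by move=> el t; rewrite -(perm_mem el) => /nbrs_S.
have vS : v \in S by apply: (mem _ _ ep); rewrite !inE eqxx ?orbT.
have [xS y1S] : x \in S /\ y1 \in S by split; apply: (mem _ _ e); rewrite !inE eqxx ?orbT.
have y2S : y2 \in S by apply: (mem _ _ ey1); rewrite !inE eqxx ?orbT.
have y3S : y3 \in S by apply: (mem _ _ ey2); rewrite !inE eqxx ?orbT.
have y4S : y4 \in S by apply: (mem _ _ ey3); rewrite !inE eqxx ?orbT.
have y5S : y5 \in S by apply: (mem _ _ ey4); rewrite !inE eqxx ?orbT.
have va : 2 * mu a = 2%:R by rewrite mu_a mulr1.
have vp : 2 * mu p = 4%:R by rewrite p2; lra.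
have vv : 2 * mu v = 6%:R by rewrite v3; lra.
have vx : 2 * mu x = 3%:R by rewrite mx; lra.
have vy1 : 2 * mu y1 = 5%:R by rewrite my1; lra.
have vy2 : 2 * mu y2 = 4%:R by rewrite my2; move: vy1; lra.
have vy3 : 2 * mu y3 = 3%:R by rewrite my3; move: vy2; lra.
have vy4 : 2 * mu y4 = 2%:R by rewrite my4; move: vy3; lra.
have vy5 : 2 * mu y5 = 1%:R by rewrite my5; move: vy4; lra.
have ne := marks_neq (c := 2).
(* Only three pairs of nodes have equal marks. *)
have py2 : p != y2.
  apply: contraTneq (_ : v \in nbrs p) => [->|]; last by rewrite (perm_mem ep) !inE eqxx orbT.
  by rewrite (perm_mem ey2) !inE negb_or (ne _ _ _ _ vv vy1) // (ne _ _ _ _ vv vy3).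
have xy3 : x != y3.
  apply: contraTneq (_ : v \in nbrs x) => [->|]; last by rewrite ex inE.
  by rewrite (perm_mem ey3) !inE negb_or (ne _ _ _ _ vv vy2) // (ne _ _ _ _ vv vy4).
have ay4 : a != y4.
  apply/eqP => e'; move: (pn); rewrite e' (perm_mem ey4) !inE.
  by apply/negP; rewrite negb_or (ne _ _ _ _ vp vy3) // (ne _ _ _ _ vp vy5).
have tab : table [:: a; p; v; x; y1; y2; y3; y4; y5]
    [:: [:: 1]; [:: 0; 2]; [:: 1; 3; 4]; [:: 2]; [:: 2; 5]; [:: 4; 6]; [:: 5; 7]; [:: 6; 8]; [:: 7]]%N.
  split=> //.
  - rewrite /= !inE !negb_or; repeat (apply/andP; split=> //);
      by eapply ne; [eassumption|eassumption|].
  - by apply/allP; rewrite /= aS pS vS xS y1S y2S y3S y4S y5S.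
  - by case=> [|[|[|[|[|[|[|[|[|]]]]]]]]] //= _; rewrite ?(nbrs_a pn) ?ex ?ey5.
have pC := nbr_a_C pn; have [r [rC br bother]] := b_node.
have : p \in [:: a; p; v; x; y1; y2; y3; y4; y5] by rewrite !inE eqxx !orbT.
move=> /(table_cover tab pC) CE.
have qE i : (i < 9)%N -> q [:: a; p; v; x; y1; y2; y3; y4; y5]`_i = q a.
  by case: i => [|[|[|[|[|[|[|[|[|]]]]]]]]] //= _;
     rewrite ?qy5 ?qy4 ?qy3 ?qy2 ?qy1 ?qx ?qv.
have ry4 : r = y4.
  have ra : q r = q a by have /(nthP 0)[i ilt <-] := CE r rC; exact: qE.
  have [r1 _] := b_bond_same rC br bother ra.
  have vr : 2 * mu r = 2%:R by rewrite r1 mulr1.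
  have nr z n : 2 * mu z = n%:R -> (2 != n)%N -> (r == z) = false.
    by move=> vz n6; apply/negbTE; exact: ne vr vz n6.
  have nra : (r == a) = false by apply: contraNF aNC => /eqP<-.
  have := CE r rC; rewrite !inE nra (nr _ _ vp) // (nr _ _ vv) // (nr _ _ vx) //.
  rewrite (nr _ _ vy1) // (nr _ _ vy2) // (nr _ _ vy3) // (nr _ _ vy5) //=.
  by rewrite orbF => /eqP.
by apply: (@table_no_outside r rC br bother _ _ [:: 0; 1; 2; 1; 2; 2; 2; 2; 1] 7 1 tab qE).
Qed.

(** Here [b] is linked to [u] or [z]. In the first case [b], [z], [u], [t] and
    [p] are the nodes of the extended diagram of type B4, in the second case
    they are a path with a short root at each end. So a combination of them,
    with the marks of this diagram, has norm 0. *)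
Lemma exclude_B4 p t u z : p \in nbrs a -> q p = q a -> mu p = 2 ->
  perm_eq (nbrs p) [:: a; t] -> perm_eq (nbrs t) [:: p; u] ->
  perm_eq (nbrs u) [:: t; z] -> nbrs z = [:: u] ->
  q t = 2 * q p -> q u = q t -> q z = q u ->
  mu t = 3 / 2 -> mu u = 1 -> mu z = 1 / 2 -> False.
Proof.
move=> pn qp p2 ep et eu ez qt qu qz mt m_u mz.
have aS := mem_head a C; have pS := nbrs_S pn.
have tn : t \in nbrs p by rewrite (perm_mem ep) !inE eqxx orbT.
have un : u \in nbrs t by rewrite (perm_mem et) !inE eqxx orbT.
have zn : z \in nbrs u by rewrite (perm_mem eu) !inE eqxx orbT.
have tS := nbrs_S tn; have uS := nbrs_S un; have zS := nbrs_S zn.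
have p0 := q_gt0 pS.
have va : 2 * mu a = 2%:R by rewrite mu_a mulr1.
have vp : 2 * mu p = 4%:R by rewrite p2; lra.
have vt : 2 * mu t = 3%:R by rewrite mt; lra.
have vu : 2 * mu u = 2%:R by rewrite m_u; lra.
have vz : 2 * mu z = 1%:R by rewrite mz; lra.
have ne := marks_neq (c := 2).
have au : a != u by apply/eqP => e'; move: p0 qu qt; rewrite -e'; lra.
have tab : table [:: a; p; t; u; z] [:: [:: 1]; [:: 0; 2]; [:: 1; 3]; [:: 2; 4]; [:: 3]]%N.
  split=> //.
  - rewrite /= !inE !negb_or; repeat (apply/andP; split=> //);
      by eapply ne; [eassumption|eassumption|].
  - by apply/allP; rewrite /= aS pS tS uS zS.
  - by case=> [|[|[|[|[|]]]]] //= _; rewrite ?(nbrs_a pn) ?ez.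
have pC := nbr_a_C pn; have [r [rC br bother]] := b_node.
have : p \in [:: a; p; t; u; z] by rewrite !inE eqxx !orbT.
move=> /(table_cover tab pC) CE.
have tu := ne _ _ _ _ vt vu isT; have up := ne _ _ _ _ vu vp isT.
have uz := ne _ _ _ _ vu vz isT; have zt := ne _ _ _ _ vz vt isT.
have zp := ne _ _ _ _ vz vp isT; have tp := ne _ _ _ _ vt vp isT.
have inC s : s \in S -> s != a -> s \in C by rewrite inE => /orP[->|].
have tC : t \in C by apply: inC => //; exact: ne vt va isT.
have u_C : u \in C by apply: inC => //; rewrite eq_sym.
have zC : z \in C by apply: inC => //; exact: ne vz va isT.
have dpt : dot p t = - q p.
  exact: dot_longer.
have dtu : dot t u = - q p.
  by have := dot_same tS un qu; rewrite qt; lra.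
have duz : dot u z = - q p.
  by have := dot_same uS zn qz; rewrite qu qt; lra.
have dup : dot u p <= 0 by exact: (pi_obtuse R_root piC).
have dzt : dot z t <= 0 by exact: (pi_obtuse R_root piC).
have dzp : dot z p <= 0 by exact: (pi_obtuse R_root piC).
have out w : w \in <<C>>%VS -> 0 < q (b + w).
  move=> wC; apply: dot_gt0; apply: contra bC; rewrite addr_eq0 => /eqP->.
  by rewrite rpredN.
have [rp|rp] := eqVneq r p.
  by have [] := b_bond_same rC br bother; rewrite rp // p2 => /eqP; rewrite (eqr_nat K 2 1).
have {CE} : [|| r == t, r == u | r == z].
  have := CE r rC; rewrite !inE (negPf rp) /= => /orP[/eqP e'|//].
  by move: aNC; rewrite -e' rC.
have rq : r = t \/ r = u \/ r = z -> q r = 2 * q a.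
  by case=> [->|[]->]; rewrite ?qz ?qu qt qp.
have b0 c : c \in C -> c != r -> dot b c = 0 by exact: bother.
case/or3P => /eqP re.
- have := b_bond_long rC br bother (rq (or_introl re)).
  by rewrite re mt; case=> -[_ _]; lra.
- have := b_bond_long rC br bother (rq (or_intror (or_introl re))).
  rewrite re m_u => -[[qb db _]|[_ _]]; last by lra.
  have := out (z + 2 *: (u + t + p)).
  have -> : z + 2 *: (u + t + p) \in <<C>>%VS.
    by rewrite !(rpredD, rpredZ) ?memv_span.
  move=> /(_ isT); rewrite !dotE (dotC _ z u) (dotC _ t p) (dotC _ u t) (dotC _ p u).
  rewrite (dotC _ t z) (dotC _ p z) (dotC _ _ b) (dotC _ u b) (dotC _ t b) (dotC _ p b).
  rewrite (b0 z zC) ?re 1?eq_sym // (b0 t tC) ?re // (b0 p pC) ?re 1?eq_sym //.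
  by move: p0 qt qu qz qb db dpt dtu duz dup dzt dzp; lra.
- have := b_bond_long rC br bother (rq (or_intror (or_intror re))).
  rewrite re mz => -[[_ _]|[qb db _]]; first by lra.
  have := out (z + (u + t + p)).
  have -> : z + (u + t + p) \in <<C>>%VS by rewrite !rpredD ?memv_span.
  move=> /(_ isT); rewrite !dotE (dotC _ z u) (dotC _ t p) (dotC _ u t) (dotC _ p u).
  rewrite (dotC _ t z) (dotC _ p z) (dotC _ _ b) (dotC _ u b) (dotC _ t b) (dotC _ p b).
  rewrite (b0 u u_C) ?re // (b0 t tC) ?re 1?eq_sym // (b0 p pC) ?re 1?eq_sym //.
  by move: p0 qt qu qz qb db dpt dtu duz dup dzt dzp; rewrite ?re ?qp; lra.
Qed.

Definition path7 : seq (seq nat) :=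
  [:: [:: 4]; [:: 2]; [:: 3; 1]; [:: 4; 2]; [:: 0; 3; 5]; [:: 4; 6]; [:: 5; 7]; [:: 6]]%N.

(** The roots [a], [b] and all but the first one of the path generate a
    unimodular lattice of type E8. The image of [C] in [B] is the path of seven
    nodes required by [unimodular_type_E8]. *)
Lemma path7_E8 (t : 7.-tuple V) B (g : V -> V) : table (a :: t) path7 ->
  (forall i, (i < 8)%N -> q (a :: t)`_i = q a) ->
  mu t`_1 = 1 -> dot b t`_1 < 0 ->
  (forall c, c \in C -> c != t`_1 -> dot b c = 0) ->
  root_basis R B -> {in C, forall x, g x \in B} ->
  {in C &, forall x y, dot (g x) (g y) = dot x y} ->
  root_system_of_type dot R type_E8 /\ @labelled_by K V dot (type_A 7) C (tnth t).
Proof.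
move=> tab qE m2 br bother BB gB iso.
set es : seq V := a :: t in tab qE; have s8 : size es = 8%N by rewrite /= size_tuple.
have [ues sub lt sz nb] := tab; have N0 := q_gt0 (mem_head a C).
have gr := table_is_gram tab (N := q a); rewrite s8 in gr; have {}gr := gr qE.
have tC i : (i < 7)%N -> t`_i \in C.
  move=> i7; have : es`_i.+1 \in S by apply/sub/mem_nth; rewrite s8.
  rewrite inE => /predU1P[ta|//]; move: ues; rewrite /= => /andP[/negP[]].
  by rewrite -ta; apply: mem_nth; rewrite size_tuple.
have ut : uniq t by move: ues => /= /andP[].
have Ct : C =i t.
  move=> c; apply/idP/idP => [cC|/(nthP 0)[i i7 <-]]; last by rewrite tC // -(size_tuple t).
  have t0 : t`_0 \in es by rewrite inE mem_nth ?orbT ?size_tuple.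
  have := table_cover tab (tC 0%N isT) t0 cC; rewrite inE => /predU1P[ca|//].
  by move: aNC; rewrite -ca cC.
have rC := tC 1%N isT; have b0 := root_gt0 R_root bR.
have qr : q t`_1 = q a by rewrite -(qE 2%N).
have [_ bonds] := b_bond_same rC br bother qr.
(* The projection of b has 3/4 of the norm of a or, if b is longer, three times
   this norm; it is too long unless b has the same length as a. *)
pose w := lin es [:: 0; 3; 6; 5; 4; 3; 2; 1].
have bw : dot b w = 6 * dot b t`_1.
  rewrite /w (@dot_lin_single _ _ _ es _ b 2) ?s8 // => -[|j] j8 j2 xj.
    by rewrite eqxx in xj.
  by apply: bother; [exact: tC|rewrite -[t`_1]/(es`_2) nth_uniq ?s8].
have ww : q w = 12 * q a.
  rewrite /w (dot_lin _ _ gr) s8.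
  have -> : zform 8 (table_gram path7) [:: 0; 3; 6; 5; 4; 3; 2; 1] [:: 0; 3; 6; 5; 4; 3; 2; 1] = 24.
    by vm_compute.
  by field.
have [bN br2] : q b = q a /\ 2 * dot b t`_1 = - q a.
  case: bonds => -[e1 e2]; rewrite qr in e1 e2; first by [].
  - have := dot_ge0 dot (2 *: b + w); rewrite !dotE (dotC _ w b) bw ww e1 e2; lra.
  - have := dot_ge0 dot (4 *: b + w); rewrite !dotE (dotC _ w b) bw ww e2; lra.
have ba : dot b a = q a / 2 by rewrite (dot_b_a rC bother) m2; lra.
pose f := [:: a; t`_1; t`_2; t`_3; t`_4; t`_5; t`_6; b].
have fR : {subset f <= R}.
  apply/allP; rewrite /= aR bR !(CR (tC _ _)) //.
have grf : is_gram dot (q a) (entry gram8) f.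
  pose sg i := nth 0%N [:: 0; 2; 3; 4; 5; 6; 7]%N i.
  have fE i : (i < 7)%N -> f`_i = es`_(sg i) by do 7! [case: i => [//|i]].
  have sg8 i : (i < 7)%N -> (sg i < 8)%N by do 7! [case: i => [//|i]].
  have chk : all (fun i => all (fun j => table_gram path7 (sg i) (sg j) == entry gram8 i j) (iota 0 7)) (iota 0 7).
    by vm_compute.
  have bf i : (i < 7)%N -> dot b f`_i = q a / 2 * (entry gram8 7 i)%:~R.
    case: i => [|[|i]] i7; first by rewrite ba mulr1.
      by rewrite /= mulrN1; move: br2; lra.
    have -> : entry gram8 7 i.+2 = 0 by do 5! [case: i i7 => [//|i] i7].
    rewrite mulr0; apply: bother.
      by do 5! [case: i i7 => [|i] i7; first exact: tC].
    rewrite fE // -[t`_1]/(es`_2) nth_uniq ?s8 ?sg8 //.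
    by do 5! [case: i i7 => [//|i] i7].
  have bsym i : (i < 7)%N -> entry gram8 i 7 = entry gram8 7 i.
    by do 7! [case: i => [//|i]].
  move=> i j /=; rewrite !ltnS leq_eqVlt => /predU1P[->|i7]; rewrite leq_eqVlt => /predU1P[->|j7].
  - by rewrite /= bN; field.
  - exact: bf.
  - by rewrite dotC bsym // bf.
  - rewrite !fE // gr ?s8 ?sg8 //; congr (_ * _%:~R).
    by move: chk => /allP/(_ i)/[!mem_iota]/(_ i7)/allP/(_ j)/[!mem_iota]/(_ j7)/eqP.
have unim := unimodular_roots R_root R_indec N0 fR erefl grf.
have fB := root_basis_free BB; have [BR _ _] := BB.
have sC : size C = 7%N by rewrite (perm_size (uniq_perm uC ut Ct)) size_tuple.
have B8 : size B = 8%N.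
  apply/eqP; rewrite eqn_leq (root_basis_size BB); apply/andP; split.
    apply: leq_trans (dim_span f); apply: dimvS.
    case: R_root => <- _ _ _ _; apply/span_subvP => x /unim[_ [m ->]].
    by apply: memv_suml => i _; rewrite memvZ ?memv_span ?mem_nth.
  have : (\dim <<C>> = 7)%N by rewrite -sC; apply/eqP; exact: fC.
  move=> <-; rewrite ltn_neqAle dimvS ?subvf // andbT.
  apply: contraNneq bC => e; have : <<C>>%VS == fullv by rewrite eqEdim subvf e leqnn.
  by move=> /eqP->; rewrite memvf.
have gt i j : (i < 7)%N -> (j < 7)%N -> dot t`_i t`_j =
    q a / 2 * (if i == j then 2 else if consecutive i j then -1 else 0 : int)%:~R.
  move=> i7 j7; rewrite -[t`_i]/(es`_i.+1) -[t`_j]/(es`_j.+1) gr ?s8 //.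
  congr (_ * _%:~R).
  have chk : all (fun i => all (fun j => table_gram path7 i.+1 j.+1 ==
      if i == j then 2 else if consecutive i j then -1 else 0) (iota 0 7)) (iota 0 7).
    by vm_compute.
  by move: chk => /allP/(_ i)/[!mem_iota]/(_ i7)/allP/(_ j)/[!mem_iota]/(_ j7)/eqP.
split; last exact: type_A_labels N0 ut Ct gt.
have injg := dot_isometric iso.
apply: (unimodular_type_E8 R_root R_indec N0 fR erefl grf BB B8 (d := map g t)).
- by rewrite map_inj_in_uniq // => x y; rewrite -!Ct; exact: injg.
- by rewrite size_map size_tuple.
- by move=> _ /mapP[x xt ->]; apply: gB; rewrite Ct.
- move=> i j i7 j7; rewrite !(nth_map 0) ?size_tuple // iso ?tC //.
  exact: gt.
Qed.

(** The nodes with mark 1 are those next to the ends of the path, so that [b] is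
    linked to one of them; the two cases are mirror images. *)
Lemma fork44_E8 p B (g : V -> V) : p \in nbrs a -> q p = q a -> mu p = 2 ->
  fork a p 4 4 -> root_basis R B -> {in C, forall x, g x \in B} ->
  {in C &, forall x y, dot (g x) (g y) = dot x y} -> exceptional_E8 dot R C.
Proof.
move=> pn qp p2 [x1 [y1 [lx [ly [e [qx1 qy1] [sx sy] [mx1 my1] [dx dy]]]]]] BB gB iso.
rewrite p2 in mx1 my1 dx dy.
case: lx sx dx => [|x2 [|x3 []]] // _ /= [ex1 qx2 mx2 [ex2 qx3 mx3 [ex3 _]]].
case: ly sy dy => [|y2 [|y3 []]] // _ /= [ey1 qy2 my2 [ey2 qy3 my3 [ey3 _]]].
have aS := mem_head a C; have pS := nbrs_S pn.
have mem s l : perm_eq (nbrs s) l -> {subset l <= S}.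
  by move=> el t; rewrite -(perm_mem el) => /nbrs_S.
have [x1S y1S] : x1 \in S /\ y1 \in S by split; apply: (mem _ _ e); rewrite !inE eqxx ?orbT.
have x2S : x2 \in S by apply: (mem _ _ ex1); rewrite !inE eqxx ?orbT.
have x3S : x3 \in S by apply: (mem _ _ ex2); rewrite !inE eqxx ?orbT.
have y2S : y2 \in S by apply: (mem _ _ ey1); rewrite !inE eqxx ?orbT.
have y3S : y3 \in S by apply: (mem _ _ ey2); rewrite !inE eqxx ?orbT.
have va : 2 * mu a = 2%:R by rewrite mu_a mulr1.
have vp : 2 * mu p = 4%:R by rewrite p2; lra.
have vx1 : 2 * mu x1 = 3%:R by rewrite mx1; lra.
have vx2 : 2 * mu x2 = 2%:R by rewrite mx2; move: vx1; lra.
have vx3 : 2 * mu x3 = 1%:R by rewrite mx3; move: vx2; lra.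
have vy1 : 2 * mu y1 = 3%:R by rewrite my1; lra.
have vy2 : 2 * mu y2 = 2%:R by rewrite my2; move: vy1; lra.
have vy3 : 2 * mu y3 = 1%:R by rewrite my3; move: vy2; lra.
have ne := marks_neq (c := 2).
have xy1 : x1 != y1 by have := uniq_nbrs p; rewrite (perm_uniq e) /= !inE negb_or; case: (x1 =P y1); rewrite ?andbF.
have xy2 : x2 != y2.
  apply: contraTneq (_ : x1 \in nbrs x2) => [->|]; last by rewrite (perm_mem ex2) inE eqxx.
  by rewrite (perm_mem ey2) !inE negb_or xy1 (ne _ _ _ _ vx1 vy3).
have xy3 : x3 != y3.
  apply: contraTneq (_ : x2 \in nbrs x3) => [->|]; last by rewrite ex3 inE.
  by rewrite ey3 inE.
have ax2 : a != x2.
  apply/eqP => e'; move: (pn); rewrite e' (perm_mem ex2) !inE.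
  by apply/negP; rewrite negb_or (ne _ _ _ _ vp vx1) // (ne _ _ _ _ vp vx3).
have ay2 : a != y2.
  apply/eqP => e'; move: (pn); rewrite e' (perm_mem ey2) !inE.
  by apply/negP; rewrite negb_or (ne _ _ _ _ vp vy1) // (ne _ _ _ _ vp vy3).
have e2 : perm_eq (nbrs p) [:: a; y1; x1].
  by rewrite (perm_trans e) // perm_cons (perm_catC [:: x1] [:: y1]).
have ues : uniq [:: a; x3; x2; x1; p; y1; y2; y3].
  rewrite /= !inE !negb_or; repeat (apply/andP; split=> //);
    by eapply ne; [eassumption|eassumption|].
have tab1 : table [:: a; x3; x2; x1; p; y1; y2; y3] path7.
  split=> //; first by apply/allP; rewrite /= aS x3S x2S x1S pS y1S y2S y3S.
  by case=> [|[|[|[|[|[|[|[|]]]]]]]] //= _; rewrite ?(nbrs_a pn) ?ex3 ?ey3.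
have tab2 : table [:: a; y3; y2; y1; p; x1; x2; x3] path7.
  split=> //; last by case=> [|[|[|[|[|[|[|[|]]]]]]]] //= _; rewrite ?(nbrs_a pn) ?ex3 ?ey3.
    by move: ues; rewrite -(rev_uniq [:: a; y3; y2; y1; p; x1; x2; x3]) (perm_uniq (s2 := [:: a; x3; x2; x1; p; y1; y2; y3])) // -[X in perm_eq X]cat1s /rev /= (perm_catC [:: x3; x2; x1; p; y1; y2; y3] [:: a]).
  by apply/allP; rewrite /= aS x3S x2S x1S pS y1S y2S y3S.
have qE1 i : (i < 8)%N -> q [:: a; x3; x2; x1; p; y1; y2; y3]`_i = q a.
  by case: i => [|[|[|[|[|[|[|[|]]]]]]]] //= _; rewrite ?qx3 ?qx2 ?qx1 ?qy3 ?qy2 ?qy1.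
have qE2 i : (i < 8)%N -> q [:: a; y3; y2; y1; p; x1; x2; x3]`_i = q a.
  by case: i => [|[|[|[|[|[|[|[|]]]]]]]] //= _; rewrite ?qx3 ?qx2 ?qx1 ?qy3 ?qy2 ?qy1.
have pC := nbr_a_C pn; have [r [rC br bother]] := b_node.
have : p \in [:: a; x3; x2; x1; p; y1; y2; y3] by rewrite !inE eqxx !orbT.
move=> /(table_cover tab1 pC) CE.
have permC : perm_eq C [:: x3; x2; x1; p; y1; y2; y3].
  have uX : uniq [:: x3; x2; x1; p; y1; y2; y3] by move: ues; rewrite cons_uniq => /andP[].
  apply: uniq_perm => // c; apply/idP/idP => [cC|cX].
    by have := CE c cC; rewrite inE => /predU1P[ca|//]; move: aNC; rewrite -ca cC.
  have [_ sub _ _ _] := tab1; have : c \in S by apply: sub; rewrite inE cX orbT.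
  rewrite inE => /predU1P[ca|//]; move: ues; rewrite cons_uniq -ca cX //.
have root : 2^-1 *: (x3 + 2 *: x2 + 3 *: x1 + 4 *: p + 3 *: y1 + 2 *: y2 + y3) \in R.
  suff -> : 2^-1 *: (x3 + 2 *: x2 + 3 *: x1 + 4 *: p + 3 *: y1 + 2 *: y2 + y3) = - a.
    exact: (root_opp R_root).
  have e0 := mu_sum; rewrite big_cons mu_a scale1r (perm_big _ permC) in e0.
  move: e0; rewrite /= !big_cons big_nil addr0 => /eqP; rewrite addr_eq0 => /eqP->.
  have half s (n : nat) : 2 * mu s = n%:R -> mu s = n%:R / 2 by move=> <-; field.
  rewrite (half _ _ vx3) (half _ _ vx2) (half _ _ vx1) (half _ _ vp).
  rewrite (half _ _ vy1) (half _ _ vy2) (half _ _ vy3) opprK !addrA !scalerDr !scalerA.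
  by rewrite ![2^-1 * _]mulrC mul1r divff ?scale1r // pnatr_eq0.
have cases : r = x2 \/ r = y2.
  have ra : q r = q a by have /(nthP 0)[i ilt <-] := CE r rC; exact: qE1.
  have [r1 _] := b_bond_same rC br bother ra.
  have vr : 2 * mu r = 2%:R by rewrite r1 mulr1.
  have nr z n : 2 * mu z = n%:R -> (2 != n)%N -> (r == z) = false.
    by move=> vz n2; apply/negbTE; exact: ne vr vz n2.
  have nra : (r == a) = false by apply: contraNF aNC => /eqP<-.
  have := CE r rC; rewrite !inE nra (nr _ _ vx3) // (nr _ _ vx1) // (nr _ _ vp) //.
  by rewrite (nr _ _ vy1) // (nr _ _ vy3) //= orbF => /orP[]/eqP; [left|right].
case: cases => re; rewrite re in br bother.
- have m2 : mu x2 = 1 by move: vx2; lra.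
  have [type lab] := @path7_E8 [tuple x3; x2; x1; p; y1; y2; y3] B g tab1 qE1 m2 br bother BB gB iso.
  by split=> //; exists x3, x2, x1, p, y1, y2, y3.
- have m2 : mu y2 = 1 by move: vy2; lra.
  have [type lab] := @path7_E8 [tuple y3; y2; y1; p; x1; x2; x3] B g tab2 qE2 m2 br bother BB gB iso.
  split=> //; exists y3, y2, y1, p, x1, x2, x3; split=> //.
  by move: root; rewrite (ACl (7*6*5*4*3*2*1)).
Qed.

End Outside.

End Walk.

(** * Root systems of type B *)

Section TypeB.
Variables (K : realType) (V : vectType K) (dot : {dot V for (@idfun K)}).
Variables (R B : seq V) (N : K).
Hypotheses (BB : root_basis R B) (lB : linked dot B) (N0 : 0 < N).
Local Notation q x := (dot x x).
Local Notation long x := (q x = N).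
Local Notation short x := (2 * q x = N).
Hypothesis Bq : forall x, x \in B -> long x \/ short x.
Hypothesis Bobt : {in B &, forall x y, x != y -> dot x y <= 0}.
Hypothesis Blong : forall x y, x \in B -> y \in B -> dot x y < 0 -> long x -> 2 * dot x y = - N.
Hypothesis Bshort : forall x y, x \in B -> y \in B -> dot x y < 0 -> short x -> short y ->
  4 * dot x y = - N.
Implicit Types (x y z s v : V) (l p L : seq V).

Let fB : free B. Proof. exact: root_basis_free BB. Qed.

Let adj x y := dot x y < 0.

Let adj_neq x y : adj x y -> x != y.
Proof. by apply: contraTneq => ->; rewrite /adj -leNgt dot_ge0. Qed.

Let q_le x : x \in B -> q x <= N.
Proof. by have := N0; move=> n0 xB; case: (Bq xB) => h; lra. Qed.

Lemma dot_sum_le x L z : x \in B -> {subset L <= B} -> x \notin L -> uniq L -> z \in L ->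
  dot x (\sum_(y <- L) y) <= dot x z.
Proof.
move=> xB LB xL uL zL; rewrite (bigD1_seq z) //= dotDr -[leRHS]addr0 lerD //.
rewrite dot_sumr big_seq_cond; apply: sumr_le0 => y /andP[yL _].
by apply: Bobt => //; [exact: LB|apply: contraNneq xL => ->].
Qed.

Lemma crd_seq_sum L x : {subset L <= B} -> x \in B -> x \notin L ->
  crd B (\sum_(y <- L) y) x = 0.
Proof.
move=> LB xB xL; rewrite big_seq.
apply: (big_ind (fun u => crd B u x = 0)) => [|u v cu cv|y yL].
- by rewrite -(scale0r 0) crdZ mul0r.
- by rewrite crdD cu cv addr0.
- rewrite (crd_id fB (LB y yL) xB); case: (y =P x) => // yx.
  by move: xL; rewrite -yx yL.
Qed.

(** A chain of long roots which may end in a short one. *)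
Definition chain x l s := [/\ path adj x (rcons l s), uniq (x :: rcons l s),
  {subset x :: rcons l s <= B} & forall y, y \in x :: l -> long y].

Lemma chain_sum x l s : chain x l s ->
  q (\sum_(y <- x :: rcons l s) y) <= q s.
Proof.
move=> [pl ul sub lng]; rewrite -[s in leRHS](last_rcons x l s).
apply: (@chain_norm _ _ dot N) => //.
- by move=> y /sub; exact: q_le.
- by move=> y z /sub yB /sub zB; exact: Bobt.
- elim: l x pl {ul} sub lng => [|y l IH] x pl sub lng.
    have xs : adj x s by move: pl => /= /andP[].
    by rewrite /= andbT Blong ?lng ?sub ?mem_head // !inE eqxx orbT.
  have [xy pl'] : adj x y /\ path adj y (rcons l s) by move: pl => /= /andP[].
  have yB : y \in B by apply: sub; rewrite !inE eqxx orbT.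
  have xB : x \in B by apply: sub; exact: mem_head.
  have lx : long x by apply: lng; exact: mem_head.
  apply/andP; split; first by rewrite (Blong xB yB xy lx).
  apply: (IH y pl') => z zl.
    by apply: sub; rewrite inE zl orbT.
  by apply: lng; rewrite inE zl orbT.
Qed.

(** This would be the extended diagram of type B, with a combination of norm 0
    in which [x] and [y] have coefficient 1 and the chain has coefficient 2. *)
Lemma no_two_on_chain v l s x y : chain v l s -> short s -> x \in B -> y \in B ->
  long x -> long y -> x != y -> x \notin v :: rcons l s -> y \notin v :: rcons l s ->
  adj x v -> adj y v -> False.
Proof.
move=> ch ss xB yB lx ly xy xl yl xv yv; have [_ uL sub lng] := ch.
have := chain_sum ch; set T := \sum_(z <- _) _ => /= qT.
have vB := sub v (mem_head _ _).
have dx : 2 * dot x T <= - N.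
  by rewrite -(Blong xB vB xv lx) ler_pM2l //; apply: dot_sum_le; rewrite ?mem_head.
have dy : 2 * dot y T <= - N.
  by rewrite -(Blong yB vB yv ly) ler_pM2l //; apply: dot_sum_le; rewrite ?mem_head.
have u0 : x + y + 2 *: T = 0.
  apply: (@dot_le0 _ _ dot); rewrite !dotE (dotC _ T x) (dotC _ T y) (dotC _ y x).
  by have := Bobt xB yB xy; move: N0 qT dx dy lx ly ss; lra.
have := congr1 (fun u => crd B u x) u0; rewrite -(scale0r 0) !crdD !crdZ mul0r /=.
rewrite crd_seq_sum // !crd_id // eqxx eq_sym (negPf xy) mulr0 !addr0.
by move/eqP; rewrite oner_eq0.
Qed.

(** On a shortest path from [v] to the short roots only the last one is short,
    and no later root than the first one is linked to [v]. *)
Lemma shortest_chain v w : v \in B -> long v -> w \in B -> short w ->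
  exists l s, [/\ chain v l s, short s & forall y, y \in rcons l s -> adj v y -> y = head s l].
Proof.
move=> vB lv wB sw.
pose Q n := exists l s, [/\ size l = n, path adj v (rcons l s), uniq (v :: rcons l s),
  {subset v :: rcons l s <= B} & short s].
have exQ : exists n, `[< Q n >].
  have [p [pp pl pu ps]] := linked_path lB vB wB.
  case/lastP: p pp pl pu ps => [|l s] pp pl pu ps.
    by move: pl lv sw N0 => /= ->; lra.
  exists (size l); apply/asboolP; exists l, s; split=> //.
    by move=> y; rewrite inE => /predU1P[->//|]; exact: ps.
  by move: pl; rewrite last_rcons => ->.
case: (ex_minnP exQ) => n /asboolP[l [s [ln pl ul sub ss]]] min; rewrite -{}ln in min.
have {}min l' s' : path adj v (rcons l' s') -> uniq (v :: rcons l' s') ->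
    {subset v :: rcons l' s' <= B} -> short s' -> (size l <= size l')%N.
  by move=> *; apply: min; apply/asboolP; exists l', s'.
exists l, s; split=> //.
  split=> // y; rewrite inE => /predU1P[->//|yl].
  have yB : y \in B by apply: sub; rewrite inE mem_rcons inE yl !orbT.
  have [//|sy] := Bq yB; case/splitPr: yl min pl ul sub => l1 l2 min pl ul sub.
  have e : rcons (l1 ++ y :: l2) s = rcons l1 y ++ rcons l2 s.
    by rewrite rcons_cat cat_rcons.
  move: pl ul sub; rewrite e cat_path -cat_cons cat_uniq => /andP[pl _] /andP[ul _] sub.
  have := min l1 y pl ul _ sy; rewrite size_cat /= addnS ltnNge leq_addr => h.
  by case: notF; apply: h => z zl; apply: sub; rewrite mem_cat zl.
move=> y; case: l pl ul sub min => [|c l] pl ul sub min; first by rewrite /= inE => /eqP.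
rewrite rcons_cons inE => /predU1P[//|yl] vy.
have [p1 [p2 e]] : exists p1 p2, rcons l s = p1 ++ y :: p2.
  by case/splitPr: yl => p1 p2; exists p1, p2.
move: pl ul sub min; rewrite rcons_cons /= e cat_path => /andP[_ /andP[_ /= /andP[_ pl]]].
case/lastP E: (y :: p2) e => [//|l' s'] e.
have [le ss'] := rcons_inj (etrans e (esym (rcons_cat _ _ _))); rewrite -{}ss' in E e *.
rewrite !inE !negb_or mem_cat negb_or cat_uniq => /and3P[/and3P[_ _ vl'] _ /and3P[_ _ ul']].
move=> sub min; have : (size l < size l')%N.
  apply: (min l' s) => //; first by rewrite -E /= vy.
    by rewrite vl'.
  move=> z; rewrite inE => /predU1P[->//|zl]; apply: sub.
  by rewrite !inE mem_cat zl !orbT.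
by rewrite le size_cat ltnNge leq_addl.
Qed.

(** At least two of the neighbours are not on a shortest path from [v] to a
    short root, so that [no_two_on_chain] applies. *)
Lemma no_short_fork v x y z w : [/\ v \in B, x \in B, y \in B & z \in B] ->
  [/\ long v, long x, long y & long z] -> [/\ x != y, x != z & y != z] ->
  [/\ adj x v, adj y v & adj z v] -> w \in B -> short w -> False.
Proof.
move=> [vB xB yB zB] [lv lx ly lz] [xy xz yz] [xv yv zv] wB sw.
have [l [s [ch ss hd]]] := shortest_chain vB lv wB sw.
have notv u : adj u v -> (u \in v :: rcons l s) = (u \in rcons l s).
  by move=> uv; rewrite inE (negPf (adj_neq uv)).
have two u u' : u != u' -> adj u v -> adj u' v -> u \in rcons l s -> u' \notin v :: rcons l s.
  move=> uu' uv u'v ul; rewrite notv //; apply: contra uu' => u'l.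
  have vu : adj v u by rewrite /adj (dotC _ v).
  have vu' : adj v u' by rewrite /adj (dotC _ v).
  by apply/eqP; rewrite (hd u ul vu); exact/esym/hd.
have [xl|xl] := boolP (x \in rcons l s).
  exact: (no_two_on_chain ch ss yB zB ly lz yz (two x y xy xv yv xl) (two x z xz xv zv xl)).
have [yl|yl] := boolP (y \in rcons l s).
  apply: (no_two_on_chain ch ss xB zB lx lz xz _ (two y z yz yv zv yl)) => //.
  by rewrite notv.
by apply: (no_two_on_chain ch ss xB yB lx ly xy); rewrite ?notv.
Qed.

(** A chain with at least three long roots and a short end can only be continued
    at its long end: in the other cases there is an extended diagram of type B,
    C or F4, or a path with two short ends. *)
Lemma chain_neighbour h l s y z : chain h l s -> short s -> (2 <= size l)%N -> y \in B ->
  y \notin h :: rcons l s -> z \in h :: rcons l s -> adj y z -> z = h /\ long y.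
Proof.
move=> ch ss l2 yB yL zL yz; have [pl ul sub lng] := ch.
have zB := sub z zL; have sB : s \in B by apply: sub; rewrite inE mem_rcons mem_head orbT.
have nz u : u \in h :: rcons l s -> y != u by apply: contraTneq => <-.
have [zs|zs] := eqVneq z s.
  exfalso; subst z; case/lastP: l ch l2 yL zL pl ul sub lng nz => [//|l v1].
  case/lastP: l => [//|l v2] ch _ yL zL pl ul sub lng nz.
  have v1L : v1 \in h :: rcons (rcons (rcons l v2) v1) s by rewrite !(mem_rcons, inE) eqxx !orbT.
  have v2L : v2 \in h :: rcons (rcons (rcons l v2) v1) s by rewrite !(mem_rcons, inE) eqxx !orbT.
  have lv1 : long v1 by apply: lng; rewrite !(mem_rcons, inE) eqxx !orbT.
  have lv2 : long v2 by apply: lng; rewrite !(mem_rcons, inE) eqxx !orbT.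
  pose v3 := last h l.
  have v3L : v3 \in h :: rcons (rcons (rcons l v2) v1) s.
    have := mem_last h l; rewrite inE -/v3 => /predU1P[->|v3l]; first exact: mem_head.
    by rewrite !(inE, mem_rcons) v3l !orbT.
  have lv3 : long v3.
    have := mem_last h l; rewrite inE -/v3 => /predU1P[->|v3l]; apply: lng.
      exact: mem_head.
    by rewrite !(inE, mem_rcons) v3l !orbT.
  move: pl; rewrite !rcons_path !last_rcons -/v3 -!andbA => /and4P[_ a32 a21 a1s].
  have [n13 n23] : v1 != v3 /\ v2 != v3.
    have := mem_last h l; rewrite -/v3 => v3l.
    move: ul; rewrite -!rcons_cons !rcons_uniq !mem_rcons !inE !negb_or.
    move=> /and3P[_ /andP[_ v1l] /andP[v2l _]].
    by split; apply: contraTneq v3l => <-; rewrite inE negb_or.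
  have [ns1 ns2] : s != v1 /\ s != v2.
    move: ul; rewrite -!rcons_cons rcons_uniq !(mem_rcons, inE) !negb_or.
    by move=> /andP[/and3P[-> ->]].
  have ns3 : s != v3.
    have := mem_last h l; rewrite -/v3; apply: contraTneq => <-.
    move: ul; rewrite -!rcons_cons rcons_uniq !(mem_rcons, inE) !negb_or.
    by move=> /andP[/and3P[]].
  have v1B := sub _ v1L; have v2B := sub _ v2L; have v3B := sub _ v3L.
  have d32 := Blong v3B v2B a32 lv3; have d21 := Blong v2B v1B a21 lv2.
  have d1s := Blong v1B sB a1s lv1.
  have o1 := Bobt yB v1B (nz _ v1L); have o2 := Bobt yB v2B (nz _ v2L).
  have o3 := Bobt yB v3B (nz _ v3L); have o13 := Bobt v1B v3B n13.
  have os2 := Bobt sB v2B ns2; have os3 := Bobt sB v3B ns3.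
  have [ly|sy] := Bq yB.
    have dys := Blong yB sB yz ly.
    have u0 : v1 + y + 2 *: s = 0.
      apply: (@dot_le0 _ _ dot); rewrite !dotE (dotC _ s v1) (dotC _ s y) (dotC _ v1 y).
      by move: N0 lv1 ly ss d1s dys o1; lra.
    have := congr1 (fun u => crd B u y) u0; rewrite -(scale0r 0) !crdD !crdZ mul0r /=.
    rewrite (crd_id fB v1B yB) (crd_id fB yB yB) (crd_id fB sB yB) eqxx.
    rewrite eq_sym (negPf (nz _ v1L)) eq_sym (negPf (nz _ zL)) mulr0 addr0 add0r.
    by move/eqP; rewrite oner_eq0.
  have dys := Bshort yB sB yz sy ss.
  have u0 : v3 + 2 *: v2 + 3 *: v1 + 4 *: s + 2 *: y = 0.
    apply: (@dot_le0 _ _ dot); rewrite !dotE (dotC _ v2 v3) (dotC _ v1 v2) (dotC _ s v1).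
    rewrite (dotC _ s y) (dotC _ v1 y) (dotC _ v2 y) (dotC _ v3 y) (dotC _ v3 v1).
    rewrite (dotC _ v2 s) (dotC _ v3 s).
    by move: N0 lv1 lv2 lv3 sy ss d32 d21 d1s dys o1 o2 o3 o13 os2 os3; lra.
  have := congr1 (fun u => crd B u y) u0; rewrite -(scale0r 0) !crdD !crdZ mul0r /=.
  rewrite (crd_id fB v1B yB) (crd_id fB v2B yB) (crd_id fB v3B yB) (crd_id fB yB yB).
  rewrite (crd_id fB sB yB) eqxx ![_ == y]eq_sym (negPf (nz _ v1L)) (negPf (nz _ v2L)).
  rewrite (negPf (nz _ v3L)) (negPf (nz _ zL)) !mulr0 !add0r mulr1.
  by move/eqP; rewrite pnatr_eq0.
have zl : z \in h :: l by move: zL; rewrite inE mem_rcons inE (negPf zs) -in_cons.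
have lz := lng z zl.
have dyz : 2 * dot y z = - N by rewrite dotC; apply: Blong; rewrite // dotC.
have [k1 [k2 e]] : exists k1 k2, h :: l = k1 ++ z :: k2.
  by case/splitPr: zl => k1 k2; exists k1, k2.
have e2 : h :: rcons l s = k1 ++ z :: rcons k2 s by rewrite -rcons_cons e rcons_cat.
have chz : chain z k2 s.
  split.
  - case: k1 e2 {e} pl => [[-> ->]//|k k1 [_ ->]].
    by rewrite cat_path => /andP[_] /= /andP[].
  - by move: ul; rewrite e2 cat_uniq => /and3P[].
  - by move=> u uk; apply: sub; rewrite e2 mem_cat uk orbT.
  - by move=> u uk; apply: lng; rewrite e mem_cat uk orbT.
have yk : y \notin z :: rcons k2 s by apply: contra yL => yk; rewrite e2 mem_cat yk orbT.
have [_ uk subk _] := chz.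
have [ly|sy] := Bq yB; last first.
  exfalso; have := chain_sum chz; set T := \sum_(u <- _) _ => qT.
  have dy : 2 * dot y T <= - N.
    by rewrite -dyz ler_pM2l //; apply: dot_sum_le; rewrite ?mem_head.
  have u0 : y + T = 0.
    apply: (@dot_le0 _ _ dot); rewrite !dotDl !dotDr (dotC _ T y).
    by move: N0 qT dy sy ss; lra.
  have := congr1 (fun u => crd B u y) u0; rewrite -(scale0r 0) crdD crdZ mul0r.
  rewrite crd_seq_sum // (crd_id fB yB yB) eqxx addr0.
  by move/eqP; rewrite oner_eq0.
split=> //; case/lastP: k1 e e2 => [[->]//|k1 w] e e2; exfalso.
have wL : w \in h :: l by rewrite e mem_cat mem_rcons mem_head.
have wB : w \in B by apply: sub; rewrite -rcons_cons mem_rcons inE wL orbT.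
have wz : adj w z.
  move: pl; case: k1 e2 {e} => [|k k1] [-> ->] /=; first by case/andP.
  by rewrite cat_path rcons_path last_rcons /= => /and3P[_].
apply: (no_two_on_chain chz ss wB yB (lng w wL) ly) => //.
- by rewrite eq_sym nz // -rcons_cons mem_rcons inE wL orbT.
- move: ul; rewrite e2 cat_uniq => /and3P[_ /hasPn h' _].
  by apply/negP => /h'; rewrite mem_rcons mem_head.
Qed.

Lemma chain_tail h c l s : chain h (c :: l) s -> chain c l s.
Proof.
move=> [/= /andP[_ pl] /andP[_ ul] sub lng]; split=> //.
  by move=> u uk; apply: sub; rewrite inE uk orbT.
by move=> u uk; apply: lng; rewrite inE uk orbT.
Qed.

(** A further link from the first vertex would close a cycle. *)
Lemma chain_first h l s z : chain h l s -> z \in rcons l s -> adj h z -> z = head s l.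
Proof.
case: l => [|c l] ch; first by rewrite /= inE => /eqP.
rewrite rcons_cons inE => /predU1P[//|zl] hz; exfalso; have [pl ul sub lng] := ch.
have [k1 [k2 e]] : exists k1 k2, rcons l s = k1 ++ z :: k2.
  by case/splitPr: zl => k1 k2; exists k1, k2.
have k1l : {subset k1 <= l}.
  move=> u uk; have : u \in rcons l s by rewrite e mem_cat uk.
  rewrite mem_rcons inE => /predU1P[us|//]; move: ul; rewrite /= e cat_uniq => /and3P[_ _].
  case/and3P=> _ /hasPn dis _; case/lastP: k2 e dis => [|k2 t] e dis.
    have := dis z (mem_head _ _); move: e; rewrite cats1 => /rcons_inj[_ sz].
    by rewrite /= -sz -us uk.
  have := dis t; rewrite inE mem_rcons mem_head orbT => /(_ isT).
  by move: e; rewrite -rcons_cons -rcons_cat => /rcons_inj[_ st]; rewrite /= -st -us uk.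
have ec : rcons (c :: l) s = rcons (c :: k1) z ++ k2 by rewrite /= e cat_rcons.
have chz : chain c k1 z.
  have tl : chain c l s := chain_tail ch; have [pl' ul' sub' lng'] := tl; split.
  - by move: pl'; rewrite e -cat_rcons cat_path => /andP[].
  - by move: ul'; rewrite -rcons_cons ec cat_uniq => /and3P[].
  - by move=> u uk; apply: sub'; rewrite -rcons_cons ec mem_cat uk.
  - by move=> u; rewrite inE => /predU1P[->|/k1l uk]; apply: lng'; rewrite inE ?eqxx ?uk ?orbT.
have [_ uz subz _] := chz; have hB := sub h (mem_head _ _).
have hk : h \notin c :: rcons k1 z.
  move: ul; rewrite cons_uniq ec => /andP[+ _]; apply: contra => hk.
  by rewrite mem_cat rcons_cons hk.
have lh : long h by apply: lng; exact: mem_head.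
have hc : adj h c by move: pl => /= /andP[].
have cB : c \in B by apply: subz; exact: mem_head.
have zB : z \in B by apply: subz; rewrite inE mem_rcons mem_head orbT.
have := chain_sum chz; rewrite big_cons; set T := \sum_(u <- _) _ => qT.
have hT : dot h T <= dot h z.
  apply: dot_sum_le => //; last by rewrite mem_rcons mem_head.
  - by move=> u uk; apply: subz; rewrite inE uk orbT.
  - by move: hk; rewrite inE negb_or => /andP[].
  - by move: uz => /= /andP[].
have dc := Blong hB cB hc lh; have dz := Blong hB zB hz lh.
have u0 : h + (c + T) = 0.
  apply: (@dot_le0 _ _ dot); move: qT; rewrite !dotDl !dotDr (dotC _ c h) (dotC _ T h).
  by have := q_le zB; move: N0 lh hT dc dz; lra.
have := congr1 (fun u => crd B u h) u0; rewrite -(scale0r 0) crdD crdZ mul0r.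
rewrite -[c + T](big_cons _ _ c _ xpredT id) crd_seq_sum // (crd_id fB hB hB) eqxx addr0.
by move/eqP; rewrite oner_eq0.
Qed.

Lemma chain_gram h l s i j : chain h l s -> (i < j < size (h :: rcons l s))%N ->
  2 * dot (h :: rcons l s)`_i (h :: rcons l s)`_j = if j == i.+1 then - N else 0.
Proof.
elim: l h i j => [|c l IH] h [|i] [|j] // ch /andP[ij jlt].
- have [pl ul sub lng] := ch; case: j ij jlt => // _ _ /=; apply: Blong.
  + by apply: sub; rewrite inE eqxx.
  + by apply: sub; rewrite !inE eqxx orbT.
  + by move: pl => /= /andP[].
  + by apply: lng; rewrite inE.
- by move: jlt ij => /=; case: j.
- have [pl ul sub lng] := ch; have hB := sub h (mem_head _ _).
  have lh : long h by apply: lng; exact: mem_head.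
  case: j ij jlt => [|j] ij jlt.
    by apply: (Blong hB _ _ lh); [apply: sub; rewrite !inE eqxx orbT|move: pl => /= /andP[]].
  have zl : (rcons l s)`_j \in rcons l s by apply: mem_nth.
  have zB : (rcons l s)`_j \in B by apply: sub; rewrite !inE zl !orbT.
  have hz : h != (rcons l s)`_j.
    apply: contraTneq zl => <-; move: ul; rewrite /= inE negb_or -andbA.
    by case/and3P.
  rewrite -[_`_j.+2]/((rcons l s)`_j) [RHS]/=; apply/eqP; rewrite mulf_eq0 pnatr_eq0 /=.
  rewrite eq_le (Bobt hB zB hz) leNgt /=; apply/negP => neg.
  have := chain_first ch _ neg; rewrite inE zl orbT => /(_ isT) /= e.
  by move: ul => /= /and3P[_ + _]; rewrite -e zl.
- by rewrite eqSS -(IH c i j (chain_tail ch)) // -ltnS ij.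
Qed.

Lemma chain_grow h l s : chain h l s -> short s -> (2 <= size l)%N ->
  exists h' l', [/\ chain h' l' s, (2 <= size l')%N & {subset B <= h' :: rcons l' s}].
Proof.
move: {2}(size B - size l)%N (leqnn (size B - size l)) => n.
elim: n h l => [|n IH] h l le ch ss l2; have [pl ul sub lng] := ch.
  have := uniq_leq_size ul sub; rewrite /= size_rcons => h'.
  by exfalso; move: le h'; clear; lia.
have [BL|nBL] := pselect {subset B <= h :: rcons l s}; first by exists h, l.
have [y [z [yB yL zL yz]]] : exists y z, [/\ y \in B, y \notin h :: rcons l s,
    z \in h :: rcons l s & adj y z].
  apply: contrapT => none; apply: nBL.
  apply: (lB (P := fun x => x \in h :: rcons l s) (sub h (mem_head _ _)) (mem_head _ _)).
  move=> x y xB yB xL xy; apply: contrapT => /negP yL; apply: none.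
  by exists y, x; split=> //; rewrite /adj dotC.
have [zh ly] := chain_neighbour ch ss l2 yB yL zL yz.
apply: (IH y (h :: l)) => //=; last exact: leqW.
  by move: le l2; clear; lia.
split.
- by rewrite /= -zh yz /= zh.
- by rewrite rcons_cons cons_uniq yL.
- by move=> u; rewrite rcons_cons inE => /predU1P[->//|]; exact: sub.
- by move=> u; rewrite inE => /predU1P[->//|]; exact: lng.
Qed.

(** A shortest path from [d2] to a short root contains at most one of [d1] and
    [d3]. With the other one as first vertex, it is a chain with three long
    roots, which grows to contain [B]. *)
Lemma type_B_recognition d1 d2 d3 w : [/\ d1 \in B, d2 \in B & d3 \in B] ->
  [/\ long d1, long d2 & long d3] -> d1 != d3 -> adj d1 d2 -> adj d3 d2 ->
  w \in B -> short w -> exists2 n, (4 <= n)%N & root_system_of_type dot R (type_B n).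
Proof.
move=> dB dl d13 d12 d32 wB sw; have [h [l [s [ch ss l2 BL]]]] : exists h l s,
    [/\ chain h l s, short s, (2 <= size l)%N & {subset B <= h :: rcons l s}].
  have [[d1B d2B d3B] [l1 l2 l3]] := (dB, dl).
  have [l [s [ch ss hd]]] := shortest_chain d2B l2 wB sw.
  have nrot d : adj d d2 -> (d \in d2 :: rcons l s) = (d \in rcons l s).
    by move=> dd; rewrite inE (negPf (adj_neq dd)).
  have start d d' : d \in B -> d' \in B -> long d -> long d' -> d != d' -> adj d d2 ->
      adj d' d2 -> d' \in rcons l s -> exists h l s,
      [/\ chain h l s, short s, (2 <= size l)%N & {subset B <= h :: rcons l s}].
    move=> dB' d'B ld ld' dd' ad ad' d'l.
    have d'd2 : adj d2 d' by rewrite /adj dotC.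
    have dl' : d \notin d2 :: rcons l s.
      rewrite nrot //; apply: contra dd' => dl'; apply/eqP.
      by rewrite (hd d' d'l d'd2); apply: hd => //; rewrite /adj dotC.
    have l_pos : (0 < size l)%N.
      case: (l) (hd d' d'l d'd2) => //= e; move: ss; rewrite -e; move: N0 ld'; lra.
    have [pl ul sub lng] := ch.
    have ch' : chain d (d2 :: l) s.
      split.
      - by rewrite /= ad.
      - by rewrite rcons_cons cons_uniq dl'.
      - by move=> u; rewrite rcons_cons inE => /predU1P[->//|]; exact: sub.
      - by move=> u; rewrite inE => /predU1P[->//|]; exact: lng.
    have [h' [k [chk k2 Bk]]] := chain_grow ch' ss l_pos.
    by exists h', k, s.
  have [d3l|d3l] := boolP (d3 \in rcons l s); first exact: (start d1 d3).
  have [d1l|d1l] := boolP (d1 \in rcons l s).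
    by apply: (start d3 d1) => //; rewrite eq_sym.
  by exfalso; apply: (no_two_on_chain ch ss d1B d3B l1 l3 d13); rewrite ?nrot.
have [pl ul sub lng] := ch; set L := h :: rcons l s in ul sub BL.
have sL : size L = (size l).+2 by rewrite /= size_rcons.
exists (size L); first by rewrite sL.
pose r (i : 'I_(size L)) := L`_i.
have rB i : r i \in B by apply: sub; exact: mem_nth.
have qL k : (k < size L)%N -> q L`_k = if k.+1 == size L then N / 2 else N.
  rewrite sL eqSS => kL; case: eqP => [->|/eqP ne].
    by rewrite /= nth_rcons ltnn eqxx; move: ss; lra.
  have kl : (k < (size l).+1)%N by move: kL ne; clear; lia.
  by apply: lng; rewrite /L -rcons_cons nth_rcons /= kl mem_nth.
have qr (i : 'I_(size L)) : q (r i) = if i.+1 == size L then N / 2 else N.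
  exact: (qL i (ltn_ord i)).
have links (i j : 'I_(size L)) : (i < j)%N ->
    cartan dot (r i) (r j) * cartan dot (r j) (r i) =
    (if j == i.+1 :> nat then if j.+1 == size L then 2 else 1 else 0)%N%:R.
  move=> ij; have := chain_gram ch (i := i) (j := j); rewrite ij ltn_ord => /(_ isT) e.
  have iL : (i.+1 == size L) = false.
    by rewrite ltn_eqF //; apply: leq_trans (ltn_ord j).
  rewrite /cartan (dotC _ (r j)) !qr iL /r e; case: eqP => [_|_]; last by rewrite !mul0r.
  by case: eqP => _; field; rewrite gt_eqF.
have [||||||f [iso _]] := @labels_isomorphism _ _ dot (type_B (size L)) B r.
- by move=> i j /eqP; rewrite nth_uniq // => /eqP/val_inj.
- exact: rB.
- move=> b /BL bL; have ib : (index b L < size L)%N by rewrite index_mem.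
  by exists (Ordinal ib); rewrite /r /= nth_index.
- move=> i j ij; have : (i : nat) != j by [].
  rewrite neq_ltn => /orP[ij'|ij'].
    rewrite links // natrK /= /consecutive eq_sym; case: eqP => [e|_] /=.
      by rewrite -e (maxn_idPr _) // ltnW.
    by rewrite gtn_eqF // ltnW.
  rewrite mulrC links // natrK /= /consecutive orbC eq_sym; case: eqP => [e|_] /=.
    by rewrite -e (maxn_idPl _) // ltnW.
  by rewrite gtn_eqF // ltnW.
- by move=> i; rewrite /= /consecutive gtn_eqF.
- have key (n i j : nat) : (i < n)%N -> (j < n)%N -> (i.+1 == j) && (j.+1 == n) =
      (0 < if consecutive i j then if (maxn i j).+1 == n then 2 else 1 else 0)%N &&
      ((if j.+1 == n then N / 2 else N) < (if i.+1 == n then N / 2 else N)).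
    move=> li lj; have NN : N / 2 < N by move: N0; lra.
    case: (j.+1 =P n) => [jn|_]; last by case: (i.+1 =P n) => _; rewrite ?ltxx ?(lt_gtF NN) !andbF.
    case: (i.+1 =P n) => [iN|/eqP iN].
      by rewrite ltxx andbF andbT; apply/negbTE; move: jn iN; clear; lia.
    rewrite NN !andbT /consecutive; have -> : (j.+1 == i) = false.
      by move: jn li; clear; lia.
    by rewrite orbF; case: (i.+1 == j) => //; case: ifP.
  by move=> i j; rewrite !qr; exact: key.
by exists B, f.
Qed.

End TypeB.

(** * The theorem *)

Section Final.
Variables (K : realType) (V : vectType K) (dot : {dot V for (@idfun K)}).
Variables (R : seq V) (R_root : root_system dot R).
Variable (R_indec : indecomposable_root_system dot R).
Local Notation q x := (dot x x).

Lemma half_not_int (k : K) : 2 * k = 1 -> k \is a Num.int -> False.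
Proof.
move=> e /intrP[m mE]; have : (2 * m)%:~R = 1%:~R :> K by rewrite rmorphM /= -mE e.
by move/eqP; rewrite eqr_int; clear; lia.
Qed.

(** The mixed terms of the norm occur twice. So, if all roots of a basis are of
    equal length, there are no shorter roots. *)
Lemma equal_length_norms B (N : K) v :
  (forall x, x \in B -> q x = N) ->
  (forall x y, x \in B -> y \in B -> x != y -> exists k : int, 2 * dot x y = N * k%:~R) ->
  uniq B -> int_span B v -> exists k : int, q v = N * k%:~R.
Proof.
move=> + + + [z ->]; elim: B => [|x B IH] qN dN.
  by exists 0; rewrite big_nil dot0l mulr0.
rewrite cons_uniq => /andP[xB uB]; rewrite big_cons.
have [||//|k kE] := IH.
- by move=> y yB; apply: qN; rewrite inE yB orbT.
- by move=> y t yB tB; apply: dN; rewrite inE ?yB ?tB orbT.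
set T := \sum_(b <- B) _ in kE *.
have [j jE] : exists j : int, 2 * dot x T = N * j%:~R.
  rewrite /T dot_sumr big_distrr /= big_seq.
  apply: (big_ind (fun r => exists j : int, r = N * j%:~R)).
  - by exists 0; rewrite mulr0.
  - by move=> _ _ [m ->] [n ->]; exists (m + n); rewrite rmorphD mulrDr.
  - move=> y yB; have [|||m mE] := dN x y; rewrite ?mem_head ?inE ?yB ?orbT //.
      by apply: contraNneq xB => ->.
    by exists (z y * m); rewrite dotZr mulrCA mE rmorphM mulrCA.
exists (z x * z x + z x * j + k).
rewrite !dotDl !dotDr !dotZl !dotZr kE qN ?mem_head // (dotC _ T x) !rmorphD !rmorphM /=.
have -> : (z x)%:~R * ((z x)%:~R * N) + (z x)%:~R * dot x T +
  ((z x)%:~R * dot x T + N * k%:~R) =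
  (z x)%:~R * ((z x)%:~R * N) + (z x)%:~R * (2 * dot x T) + N * k%:~R by ring.
by rewrite jE; ring.
Qed.

Variables (B C : seq V) (g : V -> V).
Hypotheses (BB : root_basis R B) (piC : pi_system R C) (lC : linked dot C).
Hypothesis gB : {in C, forall x, g x \in B}.
Hypothesis iso : {in C &, forall x y, dot (g x) (g y) = dot x y}.

Lemma small_span : <<C>>%VS != fullv -> (size C < size B)%N.
Proof.
move=> CT; have [_ fC _] := piC; move: (fC); rewrite /free => /eqP <-.
rewrite (root_basis_size BB) ltn_neqAle dimvS ?subvf // andbT.
by apply: contraNneq CT => e; rewrite eqEdim subvf e leqnn.
Qed.

(** Otherwise [full_rank_int_span] applies, since [C] is isometric to a part of
    [B]. *)
Lemma imprimitive_span : ~ primitive R C -> <<C>>%VS != fullv.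
Proof.
move=> nprim; apply/negP => /eqP CT; apply: nprim; split=> // a aR _.
have [_ fC _] := piC.
apply: (full_rank_int_span (dot := dot) BB piC _ gB iso) => //.
by rewrite (root_basis_size BB) -CT; apply/esym/eqP; exact: fC.
Qed.

(** A triple bond only occurs in rank 2, where a pi-system that does not span
    the plane is a single root and hence primitive. *)
Lemma no_triple_bond : C != [::] -> ~ primitive R C ->
  forall s t, s \in R -> t \in R -> cartan dot s t = -1 -> cartan dot t s = - 3 -> False.
Proof.
move=> C0 nprim s t sR tR st ts; have span2 := triple_bond R_root R_indec sR tR st ts.
have [CR fC _] := piC.
have B2 : (size B <= 2)%N.
  rewrite (root_basis_size BB); apply: leq_trans (dim_span [:: s; t]); apply: dimvS.
  by case: R_root => <- _ _ _ _; apply/span_subvP.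
have := small_span (imprimitive_span nprim).
case EC: C C0 => [//|c [|c' C']] _ /= lt; last first.
  by have := leq_trans lt B2.
apply: nprim; split=> // a aR; rewrite EC span_seq1 => aC.
have cR : c \in R by apply: CR; rewrite EC mem_head.
have ic : int_span [:: c] c by apply: int_span_id; rewrite ?mem_head.
by case: (root_line R_root cR aR aC) => ->; [|exact: int_spanN].
Qed.

(** As [a] is short, the basis [B] contains a short root. So its long roots have
    no fork, and the path of long roots from [a] to the leaves [x] and [y] has
    only the node [v]. Then [B] contains the image of [x], [v] and [y] and is of
    type B. *)
Lemma short_end_B a p : (forall s t, s \in R -> t \in R ->
    cartan dot s t = -1 -> cartan dot t s = - 3 -> False) ->
  a \in R -> a \in <<C>>%VS -> ~ int_span C a -> (forall c, c \in C -> dot a c <= 0) ->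
  p \in nbrs dot C a a -> q p = 2 * q a -> exceptional_B dot R C.
Proof.
move=> no3 aR aC aZ aobt pn qp.
have [u [v [x [y [e [vC [qv muv]] [nx ny] [qx qy mux muy] ucase]]]]] :=
  short_end R_root R_indec no3 piC lC aR aC aZ aobt pn qp.
have [CR fC _] := piC; have uC := free_uniq fC; have [BR _ _] := BB.
have aNC := aNC piC aZ.
have a0 := root_gt0 R_root aR.
have N0 : 0 < q v by rewrite qv mulr_gt0.
have piB := root_basis_pi R_root BB; have fB := root_basis_free BB.
have lenR z : z \in R -> q z = q v \/ 2 * q z = q v.
  move=> zR; have vR := CR _ vC; have av : q a < q v by rewrite qv; move: a0; lra.
  have tl := two_lengths R_root R_indec.
  have [za|za|za] := ltrgtP (q z) (q a); first by case: (tl _ _ _ zR aR vR).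
    have [zv|zv|zv] := ltrgtP (q z) (q v); last by left.
      by case: (tl _ _ _ aR zR vR).
    by case: (tl _ _ _ aR vR zR).
  by right; rewrite za qv.
have Bobt := pi_obtuse R_root piB.
have bond b c : b \in B -> c \in B -> dot b c < 0 ->
    [\/ q b = q c /\ 2 * dot b c = - q c,
      q b = 2 * q c /\ dot b c = - q c | q c = 2 * q b /\ dot b c = - q b].
  move=> bB cB bc; apply: (root_bond R_root no3 (BR _ bB) (BR _ cB) bc).
  exact: free_neq_opp fB bB cB.
have Blong b c : b \in B -> c \in B -> dot b c < 0 -> q b = q v -> 2 * dot b c = - q v.
  move=> bB cB bc qb; have := lenR c (BR _ cB); have := bond b c bB cB bc.
  by case=> -[e1 e2] [e3|e3]; move: N0 e1 e2 e3 qb; lra.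
have Bshort b c : b \in B -> c \in B -> dot b c < 0 -> 2 * q b = q v -> 2 * q c = q v ->
    4 * dot b c = - q v.
  move=> bB cB bc qb qc; have := bond b c bB cB bc.
  by case=> -[e1 e2]; move: N0 e1 e2 qb qc; lra.
have [w wB sw] : exists2 w, w \in B & 2 * q w = q v.
  apply: contrapT => none; have allN b : b \in B -> q b = q v.
    by move=> bB; case: (lenR b (BR _ bB)) => // h; case: none; exists b.
  have [|k kE] := equal_length_norms allN _ (free_uniq fB) (root_basis_int BB aR).
    move=> b c bB cB bc; have := Bobt b c bB cB bc; rewrite le_eqVlt => /predU1P[->|lt].
      by exists 0; rewrite !mulr0.
    by exists (-1); rewrite Blong ?allN // rmorphN1 mulrN1.
  apply: (@half_not_int k%:~R); last exact: rpred_int_num.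
  apply: (mulfI (lt0r_neq0 N0)); rewrite mulr1 mulrCA -kE qv; ring.
have lB := root_basis_linked R_root R_indec BB.
have Bq b : b \in B -> q b = q v \/ 2 * q b = q v by move/BR/lenR.
have aS : a \in a :: C by rewrite mem_head.
have vS : v \in a :: C by rewrite inE vC orbT.
have un := uniq_nbrs dot piC aZ v; rewrite (perm_uniq e) /= !inE negb_or andbT in un.
case/andP: un => /andP[ux uy] xy.
have nb z : z \in [:: u; x; y] -> z \in a :: C /\ dot v z < 0.
  by rewrite -(perm_mem e) mem_nbrs => /andP[].
have [xS vx] : x \in a :: C /\ dot v x < 0 by apply: nb; rewrite !inE eqxx orbT.
have [yS vy] : y \in a :: C /\ dot v y < 0 by apply: nb; rewrite !inE eqxx !orbT.
have [uS vu] : u \in a :: C /\ dot v u < 0 by apply: nb; rewrite !inE eqxx.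
have longC z : z \in a :: C -> q z = q v -> z \in C.
  by rewrite inE => /predU1P[->|//] h; exfalso; move: h qv a0; lra.
have xC := longC x xS qx; have yC := longC y yS qy.
have injg := dot_isometric iso.
have gneq s t : s \in C -> t \in C -> s != t -> g s != g t.
  by move=> sC tC; apply: contraNneq => /(injg s t sC tC)->.
have gadj s t : s \in C -> t \in C -> dot t s < 0 -> dot (g s) (g t) < 0.
  by move=> sC tC ts; rewrite iso // dotC.
have glong s : s \in C -> q s = q v -> q (g s) = q v by move=> sC <-; rewrite iso.
case: ucase => [ua|[u_C qu]]; last first.
  exfalso; apply: (no_short_fork BB lB N0 Bq Bobt Blong (v := g v) (x := g u) (y := g x)
    (z := g y) _ _ _ _ wB sw); split; solve [exact: gB | exact: glong | exact: gneq | exact: gadj].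
split.
  have [|||||n n4 type] := type_B_recognition BB lB N0 Bq Bobt Blong Bshort
    (d1 := g x) (d2 := g v) (d3 := g y) _ _ _ _ _ wB sw; last by exists n.
  - by split; exact: gB.
  - by split; exact: glong.
  - exact: gneq.
  - exact: gadj.
  - exact: gadj.
have Ct : C =i [:: x; v; y].
  move=> c; apply/idP/idP => [cC|]; last by rewrite !inE => /or3P[] /eqP->.
  apply: (lC (P := fun c => c \in [:: x; v; y]) vC _ _ cC); first by rewrite !inE eqxx orbT.
  move=> s t sC tC; have tS : t \in a :: C by rewrite inE tC orbT.
  have nbt : dot s t < 0 -> t \in nbrs dot C a s by rewrite mem_nbrs tS.
  rewrite !inE => + /nbt; case/or3P => /eqP->.
  - by rewrite nx !inE => /eqP->; rewrite eqxx ?orbT.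
  - rewrite (perm_mem e) ua !inE => /predU1P[ta|]; first by move: aNC; rewrite -ta tC.
    by case/orP => ->; rewrite ?orbT.
  - by rewrite ny !inE => /eqP->; rewrite eqxx ?orbT.
have nxv : x != v by apply: contraTneq vx => ->; rewrite -leNgt dot_ge0.
have nyv : y != v by apply: contraTneq vy => ->; rewrite -leNgt dot_ge0.
have ut : uniq [:: x; v; y] by rewrite /= !inE negb_or nxv xy eq_sym nyv.
have dvx : 2 * dot v x = - q v.
  by apply: (dot_same R_root no3 piC aR aZ vS _ qx); rewrite mem_nbrs xS.
have dvy : 2 * dot v y = - q v.
  by apply: (dot_same R_root no3 piC aR aZ vS _ qy); rewrite mem_nbrs yS.
have hv (r : K) : 2 * r = - q v -> r = - (q v / 2).
  by move=> h; rewrite -mulNr -h mulrC mulKf // pnatr_eq0.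
have evx := hv _ dvx; have evy := hv _ dvy.
have dxy : dot x y = 0.
  apply/eqP; have := pi_obtuse R_root piC xC yC xy; rewrite le_eqVlt => /orP[//|lt].
  have : y \in nbrs dot C a x by rewrite mem_nbrs yS.
  by rewrite nx !inE (negPf nyv).
exists x, v, y; split.
  apply: (type_A_labels N0 (t := [tuple x; v; y])) => // i j.
  rewrite !ltnS; case: i => [|[|[|//]]] _; case: j => [|[|[|//]]] _ /=;
  rewrite ?(dotC _ x v) ?(dotC _ y v) ?(dotC _ y x) ?dxy ?qx ?qy ?evx ?evy;
  by rewrite ?mulr0 ?mulrN1 // divfK // pnatr_eq0.
suff -> : 2^-1 *: (x + 2 *: v + y) = - a by exact: (root_opp R_root).
have e0 := mu_sum piC aC aZ; rewrite big_cons mu_a scale1r in e0.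
rewrite (perm_big _ (uniq_perm uC ut Ct)) /= !big_cons big_nil addr0 muv in e0.
have half (r : K) : 2 * r = 1 -> r = 2^-1.
  by move=> h; rewrite -[r](mulKf (x := 2)) ?h ?mulr1 // pnatr_eq0.
rewrite (half _ mux) (half _ muy) in e0; move/eqP: e0; rewrite addr_eq0 => /eqP->.
by rewrite opprK !scalerDr scalerA mulVf ?pnatr_eq0 // addrA.
Qed.

End Final.

Lemma labels_uniq (K : realType) (V : vectType K) (dot : {dot V for (@idfun K)})
    (C : seq V) n (t : n.-tuple V) :
  @labelled_by K V dot (type_A n) C (tnth t) -> uniq t /\ {subset t <= C}.
Proof.
case=> f [[_ [injf _ _]] tE]; split; last by move=> _ /tnthP[i ->]; rewrite tE ssvalP.
by apply/tuple_uniqP => i j; rewrite !tE => /val_inj; exact: injf.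
Qed.

Lemma basis_crd_int (K : realType) (V : vectType K) (R B : seq V) v r :
  root_basis R B -> r \in B -> v \in R -> crd B v r \is a Num.int.
Proof.
move=> BB rB vR; have fB := root_basis_free BB.
by apply: crd_int => //; exact: root_basis_int BB vR.
Qed.

Theorem theorem9 (K : realType) (V : vectType K)
    (dot : {dot V for (@idfun K)}) (R C : seq V)
    (R_root : root_system dot R)
    (R_indec : indecomposable_root_system dot R)
    (C_pi : pi_system R C)
    (C_indec : indecomposable_pi_system dot C)
    (C_sub : subdiagram_of_root_system dot R C) :
  (~ (exceptional_B dot R C \/ exceptional_E8 dot R C) ->
     extends_to_basis R C) /\
  (exceptional_B dot R C \/ exceptional_E8 dot R C ->
     ~ extends_to_basis R C).
Proof.
split=> [nexc|].
  apply: contrapT => next; have nprim : ~ primitive R C.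
    by move/(primitive_extends R_root).
  have [C0 conn] := C_indec; have lC := pi_linked R_root C_pi conn.
  have [B [BB [f [emb mark]]]] := C_sub.
  have [g [gB iso]] := embedding_isometry R_root R_indec C_pi (root_basis_pi R_root BB) emb mark.
  have [a [aR aC aZ aobt]] := imprimitive_root R_root C_pi nprim.
  have CT := imprimitive_span BB C_pi gB iso nprim.
  have [b [bR bC bobt blink]] := linked_outside R_root R_indec C_pi C0 CT.
  have no3 := no_triple_bond R_root R_indec BB C_pi gB iso C0 nprim.
  have [p pn] := a_has_nbr R_root C_pi aR aC aZ aobt.
  case: (affine_shapes R_root no3 C_pi lC aR aC aZ aobt pn) => [qp|[qp mp]].
    apply: nexc; left.
    exact: (short_end_B R_root R_indec BB C_pi lC gB iso no3 aR aC aZ aobt pn qp).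
  case=> [f44|f36|[v ev [qv mv f26]]|[t [u [z [ep et [eu ez] [qt qu qz] [mt m_u mz]]]]]].
  - apply: nexc; right.
    exact: (fork44_E8 R_root R_indec no3 C_pi lC aR aC aZ aobt bR bC bobt blink pn qp mp f44 BB gB iso).
  - exact: (exclude_A8 R_root no3 C_pi lC aR aC aZ aobt bR bC bobt blink pn qp mp f36).
  - exact: (exclude_D8 R_root no3 C_pi lC aR aC aZ aobt bR bC bobt blink pn qp mp ev qv mv f26).
  - exact: (exclude_B4 R_root no3 C_pi lC aR aC aZ aobt bR bC bobt blink pn qp mp ep et eu ez qt qu qz mt m_u mz).
move=> exc [B [BB CB]]; have fB := root_basis_free BB.
case: exc => [] [_].
  move=> [r1 [r2 [r3 [/labels_uniq[ut tC] root]]]].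
  have tB : {subset [:: r1; r2; r3] <= B} by move=> x /tC/CB.
  move: ut; rewrite /= !inE !negb_or => /andP[/andP[n2 n3] _].
  have r1B : r1 \in B by apply: tB; rewrite inE eqxx.
  have cr x : x \in [:: r1; r2; r3] -> crd B x r1 = (x == r1)%:R.
    by move=> /tB xB; rewrite crd_id.
  have := basis_crd_int BB r1B root; rewrite crdZ !crdD crdZ !cr ?inE ?eqxx ?orbT //.
  rewrite ![_ == r1]eq_sym ?eqxx (negPf n2) (negPf n3) mulr0 !addr0.
  by apply: half_not_int; rewrite mulr1 divff // pnatr_eq0.
move=> [r1 [r2 [r3 [r4 [r5 [r6 [r7 [/labels_uniq[ut tC] root]]]]]]]].
have tB : {subset [:: r1; r2; r3; r4; r5; r6; r7] <= B} by move=> x /tC/CB.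
move: ut; rewrite /= !inE !negb_or => /andP[/and5P[n2 n3 n4 n5 /andP[n6 n7]] _].
have r1B : r1 \in B by apply: tB; rewrite inE eqxx.
have cr x : x \in [:: r1; r2; r3; r4; r5; r6; r7] -> crd B x r1 = (x == r1)%:R.
  by move=> /tB xB; rewrite crd_id.
have := basis_crd_int BB r1B root.
rewrite crdZ !crdD !crdZ !cr ?inE ?eqxx ?orbT //.
rewrite ![_ == r1]eq_sym ?eqxx !(negPf n2, negPf n3, negPf n4, negPf n5, negPf n6, negPf n7).
rewrite !mulr0 !addr0; apply: half_not_int.
by rewrite mulr1 divff // pnatr_eq0.
Qed.
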